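(* Let $d\ge 1$, $k\in\{0,1,\ldots,d-1\}$, and consider a great hypersphere tessellation of $\mathbb{S}^d$ with non-degenerate directional distribution $\kappa$ and intensity $n\ge d-k$. For every Borel set $C\subset\mathbb{G}_s(d,k)$ one has $$\mathbf{P}(D(Z_{n,d}^{(k)})\in C)=\mathbf{P}(D(W_{n,d}^{(k)})\in C)=\kappa_k(C).$$
   Context: $\mathbb{S}^d$ is the unit sphere of $\mathbb{R}^{d+1}$. For $k\in\{0,\ldots,d\}$, $\mathbb{G}_s(d,k)$ is the set of $k$-dimensional great subspheres of $\mathbb{S}^d$ (intersections of $\mathbb{S}^d$ with $(k+1)$-dimensional linear subspaces), with its usual topology; elements of $\mathbb{G}_s(d,d-1)$ are great hyperspheres. $\mathcal{H}^k$ is $k$-dimensional Hausdorff measure. A spherical polytope is $P=C\cap\mathbb{S}^d$ with $C\ne\{0\}$ a polyhedral cone in $\mathbb{R}^{d+1}$; its $\ell$-dimensional faces are the intersections of $\mathbb{S}^d$ with the $(\ell+1)$-dimensional faces of $C$; $\mathcal{F}_\ell(P)$ is the set of these. Tessellation: let $\kappa^\circ$ be an even Borel probability measure on $\mathbb{S}^d$ with $\kappa^\circ(S)=0$ for every $S\in\mathbb{G}_s(d,d-1)$, and let $\kappa$ be its image under $u\mapsto u^\perp\cap\mathbb{S}^d$; such a $\kappa$ is what is meant here by a non-degenerate directional distribution. For $n\ge1$ let $S_1,\ldots,S_n$ be independent random great hyperspheres with distribution $\kappa$. The great hypersphere tessellation $T_{n,d}=T_d(S_1,\ldots,S_n)$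 of intensity $n$ and directional distribution $\kappa$ is the random finite collection of spherical polytopes (cells) that are the closures of the connected components of $\mathbb{S}^d\setminus(S_1\cup\cdots\cup S_n)$. Put $\mathcal{F}_k(T_{n,d})=\bigcup_{P\in T_{n,d}}\mathcal{F}_k(P)$ and ${\rm skel}_k(T_{n,d})=\bigcup_{F\in\mathcal{F}_k(T_{n,d})}F$. Typical spherical $k$-face: given $T_{n,d}$, $Z_{n,d}^{(k)}$ is chosen uniformly at random from the almost surely finite set $\mathcal{F}_k(T_{n,d})$. Weighted typical spherical $k$-face: $W_{n,d}^{(k)}$ is the almost surely unique $F\in\mathcal{F}_k(T_{n,d})$ containing in its relative interior a random point $v$ which, given $T_{n,d}$, is distributed on ${\rm skel}_k(T_{n,d})$ according to normalized $\mathcal{H}^k$. The direction of a spherical convex set $K$ (intersection of $\mathbb{S}^d$ with a closed convex cone) whose linear hull $\mathrm{lin}(K)$ has dimension $k+1$ is $D(K)=\mathrm{lin}(K)\cap\mathbb{S}^d\in\mathbb{G}_s(d,k)$. The measure $\kappa_k$ is the distribution of $S_1\cap\cdots\cap S_{d-k}$ where $S_1,\ldots,S_{d-k}$ are independent with distribution $\kappa$ (a probability measure on $\mathbb{G}_s(d,k)$). *)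

(* Defs.v *)
From HB Require Import structures.
From mathcomp Require Import all_boot all_order all_algebra.
From mathcomp Require Import all_classical all_reals all_analysis.

Set Implicit Arguments.
Unset Strict Implicit.
Unset Printing Implicit Defensive.

Import Order.TTheory GRing.Theory Num.Theory.
Import numFieldNormedType.Exports.

Local Open Scope classical_set_scope.
Local Open Scope ring_scope.

(* Points live in 'rV[R]_d.+1.  The norm of the library on row vectors is the
   sup norm: it is used only for the topology, and all metric notions below
   refer to the Euclidean norm [enorm]. *)

Section Euclidean.
Context {R : realType} {d : nat}.
Local Notation V := ('rV[R]_d.+1).

Definition dot (x y : V) : R := \sum_i x ord0 i * y ord0 i.

Definition enorm (x : V) : R := Num.sqrt (dot x x).

Definition sphere : set V := [set x | enorm x = 1].

Definition lin (A : set V) : set V :=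
  [set x | forall U : {vspace V}, A `<=` [set` U] -> x \in U].

(* Borel sigma-algebra of R^(d+1) *)
Definition borelV : measurableType (@open V).-sigma :=
  g_sigma_algebraType (@open V).

End Euclidean.

Arguments sphere R d : clear implicits.
Arguments borelV R d : clear implicits.

Section Hausdorff.
Context {R : realType} {d : nat}.
Local Notation V := ('rV[R]_d.+1).

Definition ediam (A : set V) : \bar R :=
  ereal_sup [set (enorm (p.1 - p.2))%:E | p in A `*` A].

(* [diam^0] of a nonempty set is 1, whereas the empty set always has size 0. *)
Definition hgauge (k : nat) (A : set V) : \bar R :=
  (if A == set0 then 0 else ediam A ^+ k)%E.

Definition hausdorff_premeasure (k : nat) (e : R) (A : set V) : \bar R :=
  ereal_inf [set (\sum_(0 <= i <oo) hgauge k (F i))%E |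
    F in [set F : (set V)^nat |
      A `<=` \bigcup_i F i /\ forall i, (ediam (F i) <= e%:E)%E]].

(* Without the factor making H^k agree with k-dimensional volume: the factor
   cancels in the normalized measure, which is the only use of H^k here. *)
Definition hausdorff_measure (k : nat) (A : set V) : \bar R :=
  ereal_sup [set hausdorff_premeasure k e A | e in [set e : R | 0 < e]].

(* [hclose e A B]: A and B are at Hausdorff distance less than e (for compact
   A and B); [hopen K] are the open subsets of the family K of compact sets in
   the topology of the Hausdorff distance. *)
Definition hclose (e : R) (A B : set V) : Prop :=
  (forall x, A x -> exists2 y, B y & enorm (x - y) < e) /\
  (forall y, B y -> exists2 x, A x & enorm (x - y) < e).

Definition hopen (K : set (set V)) : set (set (set V)) :=
  [set O | O `<=` K /\
    forall A, O A -> exists2 e : R, 0 < e &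
      forall B, K B -> hclose e A B -> O B].

Definition hborel (K : set (set V)) : set (set (set V)) := <<s K, hopen K >>.

(* nonempty compact subsets of the sphere, the state space of random faces *)
Definition sphere_compacts : set (set V) :=
  [set A | [/\ A !=set0, compact A & A `<=` sphere R d]].

End Hausdorff.

Section Spherical.
Context {R : realType} {d : nat}.
Local Notation V := ('rV[R]_d.+1).

(* The set of k-dimensional great subspheres.  Its usual topology, obtained
   from the Grassmannian, is the one of the Hausdorff distance, so that its
   Borel sets are [hborel (great_subspheres k)]. *)
Definition great_subspheres (k : nat) : set (set V) :=
  [set [set` U] `&` sphere R d | U in [set U : {vspace V} | \dim U = k.+1]].

Definition great_hypersphere (u : V) : set V :=
  [set x | dot x u = 0] `&` sphere R d.

Definition direction (K : set V) : set V := lin K `&` sphere R d.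

(* interior of K relative to the great subsphere D(K) *)
Definition srelint (K : set V) : set V :=
  [set x | K x /\ \forall y \near x, direction K y -> K y].

(* the cone C such that P is the intersection of C with the sphere *)
Definition cone_over (P : set V) : set V :=
  [set t *: x | t in [set t : R | 0 <= t] & x in P].

(* The m-dimensional faces of a polyhedral cone C, as intersections with
   supporting hyperplanes; u = 0 gives C itself. *)
Definition cone_faces (m : nat) (C : set V) : set (set V) :=
  [set G | (exists2 u : V, (forall x, C x -> dot u x <= 0) &
                           G = C `&` [set x | dot u x = 0])
        /\ (exists2 U : {vspace V}, \dim U = m & lin G = [set` U])].

Definition faces (l : nat) (P : set V) : set (set V) :=
  [set G `&` sphere R d | G in cone_faces l.+1 (cone_over P)].

Definition tessellation (n : nat) (s : 'I_n -> set V) : set (set V) :=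
  let O := sphere R d `\` \bigcup_i s i in
  [set closure (connected_component O x) | x in O].

Definition tess_faces (k : nat) (T : set (set V)) : set (set V) :=
  \bigcup_(P in T) faces k P.

Definition skel (k : nat) (T : set (set V)) : set V :=
  \bigcup_(F in tess_faces k T) F.

End Spherical.

Arguments great_subspheres R d k : clear implicits.

Section Random.
Context {R : realType}.

Section Elements.
Context {dO : measure_display} {Omega : measurableType dO}.
Variable P : probability Omega R.

(* X is a random element of (E, M), where M is a sigma-algebra on E *)
Definition random_element {X : Type} (E : set X) (M : set (set X))
    (f : Omega -> X) : Prop :=
  (forall w, E (f w)) /\ forall B, M B -> measurable (f @^-1` B).

Definition independent {X : Type} (n : nat) (M : set (set X))
    (f : 'I_n -> Omega -> X) : Prop :=
  forall B : 'I_n -> set X, (forall i, M (B i)) ->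
    P (\bigcap_i (f i @^-1` B i)) = (\prod_(i < n) P (f i @^-1` B i))%E.

(* Given T, the random element f has distribution Q(T): for every event A
   determined by T, P(A, f in B) is the integral of Q(T)(B) over A. *)
Definition conditional_distribution {X Y : Type} (T : Omega -> X)
    (M : set (set Y)) (f : Omega -> Y) (Q : X -> set Y -> \bar R) : Prop :=
  forall (A : set Omega) (B : set Y),
    measurable A -> (exists D : set X, A = T @^-1` D) -> M B ->
    P (A `&` f @^-1` B) = (\int[P]_(w in A) Q (T w) B)%E.

End Elements.

Section Tessellation.
Context {d : nat}.
Local Notation V := ('rV[R]_d.+1).

(* An even Borel probability measure on the sphere, given as a Borel
   probability measure on R^(d+1) concentrated on the sphere, which vanishes
   on all great hyperspheres. *)
Definition nondegenerate_even (kappa0 : probability (borelV R d) R) : Prop :=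
  [/\ kappa0 (sphere R d) = 1%E,
      forall B : set V, @measurable _ (borelV R d) B ->
        kappa0 [set - x | x in B] = kappa0 B
    & forall S, great_subspheres R d d.-1 S -> kappa0 S = 0%E].

(* the image of kappa0 under u |-> u^perp, a measure on the Borel sets of the
   space of great hyperspheres *)
Definition directional_distribution (kappa0 : probability (borelV R d) R)
    (C : set (set V)) : \bar R :=
  kappa0 [set u | sphere R d u /\ C (great_hypersphere u)].

Context {dO : measure_display} {Omega : measurableType dO}.
Variable P : probability Omega R.

Definition iid_hyperspheres (kappa0 : probability (borelV R d) R) (n : nat)
    (S : 'I_n -> Omega -> set V) : Prop :=
  let G := great_subspheres R d d.-1 in
  [/\ forall i, random_element G (hborel G) (S i),
      independent P (hborel G) S
    & forall i C, hborel G C ->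
        P (S i @^-1` C) = directional_distribution kappa0 C].

Definition uniform_on (F : set (set V)) (B : set (set V)) : \bar R :=
  (counting (F `&` B) / counting F)%E.

Definition normalized_hausdorff (k : nat) (A B : set V) : \bar R :=
  (hausdorff_measure k (A `&` B) / hausdorff_measure k A)%E.

Definition typical_face (k : nat) (T : Omega -> set (set V))
    (Z : Omega -> set V) : Prop :=
  let K := @sphere_compacts R d in
  random_element K (hborel K) Z /\
  conditional_distribution P T (hborel K) Z
    (fun t => uniform_on (tess_faces k t)).

Definition weighted_typical_face (k : nat) (T : Omega -> set (set V))
    (v : Omega -> borelV R d) (W : Omega -> set V) : Prop :=
  let K := @sphere_compacts R d in
  [/\ measurable_fun setT v,
      conditional_distribution P T (@measurable _ (borelV R d)) v
        (fun t => normalized_hausdorff k (skel k t)),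
      random_element K (hborel K) W
    & {ae P, forall w, tess_faces k (T w) (W w) /\ srelint (W w) (v w)}].

End Tessellation.
End Random.

(* Main.v *)
(* Almost surely the normal vectors u_1, ..., u_n are in general position.  Then
   every k-face lies in the great subsphere S_I, the intersection of the S_i with
   i in I, for exactly one I with d - k elements, and its direction is S_I.  The
   other n - (d - k) hyperspheres cut S_I into a number of faces which, by
   deletion-restriction, depends only on n, d and k; and H^k(S_I) is the same for
   all I.  So, given the tessellation, the direction of both random faces is
   uniformly distributed on the S_I, and each S_I has distribution kappa_k. *)

Require Import Defs.
From HB Require Import structures.
From mathcomp Require Import all_boot all_order all_algebra finmap.
From mathcomp Require Import all_classical all_reals all_analysis.
From mathcomp Require Import measurable_realfun.
From mathcomp Require Import lra ring zify.

Set Implicit Arguments.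
Unset Strict Implicit.
Unset Printing Implicit Defensive.

Import Order.TTheory GRing.Theory Num.Theory.
Import numFieldNormedType.Exports.

Local Open Scope classical_set_scope.
Local Open Scope ring_scope.

(** * Euclidean space *)

(** Two features of conditioning shape the proof. [conditional_distribution] speaks only of events
    determined by [T], in which the hyperspheres carry no labels, and of fixed target sets, whereas
    the flat that carries [v] is random. So flats are recovered from [T] as sets, and for [W] the
    random flats are enclosed in finitely many fixed open sets, which yields an inequality. The
    conditional probabilities are not known to be measurable functions of the outcome, and their
    integrals are lower integrals. The volume of a great subsphere is never computed: that it is
    positive and finite follows from the total mass of the law of [v]. General position is obtained
    without disintegrating joint laws: compactness of the sphere replaces the integration over the
    first hyperspheres. Measurability of directions and of intersections rests on one principle: a
    set open for the Hausdorff distance is a countable union of cells, each prescribed by the small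
    balls that its members meet. *)

Section EuclideanTheory.
Context {R : realType} {d : nat}.
Local Notation V := ('rV[R]_d.+1).
Implicit Types (x y z u : V) (a : R).

Lemma dotC x y : dot x y = dot y x.
Proof. by apply: eq_bigr => i _; rewrite mulrC. Qed.

Lemma dotDl x y z : dot (x + y) z = dot x z + dot y z.
Proof. by rewrite -big_split; apply: eq_bigr => i _; rewrite mxE mulrDl. Qed.

Lemma dotZl a x z : dot (a *: x) z = a * dot x z.
Proof. by rewrite /dot mulr_sumr; apply: eq_bigr => i _; rewrite mxE mulrA. Qed.

Lemma dotNl x z : dot (- x) z = - dot x z.
Proof. by rewrite -scaleN1r dotZl mulN1r. Qed.

Lemma dotBl x y z : dot (x - y) z = dot x z - dot y z.
Proof. by rewrite dotDl dotNl. Qed.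

Lemma dot0l z : dot 0 z = 0.
Proof. by rewrite -(scale0r 0) dotZl mul0r. Qed.

Lemma dotDr x y z : dot z (x + y) = dot z x + dot z y.
Proof. by rewrite dotC dotDl !(dotC z). Qed.

Lemma dotZr a x z : dot z (a *: x) = a * dot z x.
Proof. by rewrite dotC dotZl (dotC z). Qed.

Lemma dotNr x z : dot z (- x) = - dot z x.
Proof. by rewrite dotC dotNl (dotC z). Qed.

Lemma dotBr x y z : dot z (x - y) = dot z x - dot z y.
Proof. by rewrite dotDr dotNr. Qed.

Lemma dot0r z : dot z 0 = 0.
Proof. by rewrite dotC dot0l. Qed.

Lemma dot_sumr (I : Type) (r : seq I) (Q : pred I) (F : I -> V) z :
  dot z (\sum_(i <- r | Q i) F i) = \sum_(i <- r | Q i) dot z (F i).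
Proof. exact: (big_morph (dot z) (fun x y => dotDr x y z) (dot0r z)). Qed.

Lemma dot_suml (I : Type) (r : seq I) (Q : pred I) (F : I -> V) z :
  dot (\sum_(i <- r | Q i) F i) z = \sum_(i <- r | Q i) dot (F i) z.
Proof. exact: (big_morph (dot^~ z) (fun x y => dotDl x y z) (dot0l z)). Qed.

Lemma dot_ge0 x : 0 <= dot x x.
Proof. by apply: sumr_ge0 => i _; rewrite -expr2 sqr_ge0. Qed.

Lemma dot_eq0 x : (dot x x == 0) = (x == 0).
Proof.
apply/eqP/eqP => [|->]; last exact: dot0l.
move=> /eqP; rewrite psumr_eq0 => [/allP x0|i _]; last by rewrite -expr2 sqr_ge0.
apply/rowP => i; rewrite mxE.
by have := x0 i (mem_index_enum i); rewrite mulf_eq0 orbb => /eqP.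
Qed.

Lemma dot_gt0 x : (0 < dot x x) = (x != 0).
Proof. by rewrite lt0r dot_ge0 andbT dot_eq0. Qed.

Lemma enorm_ge0 x : 0 <= enorm x.
Proof. exact: sqrtr_ge0. Qed.

Lemma sqr_enorm x : enorm x ^+ 2 = dot x x.
Proof. by rewrite sqr_sqrtr // dot_ge0. Qed.

Lemma enorm_eq0 x : (enorm x == 0) = (x == 0).
Proof. by rewrite sqrtr_eq0 -dot_eq0 eq_le dot_ge0 andbT. Qed.

Lemma enorm_gt0 x : (0 < enorm x) = (x != 0).
Proof. by rewrite lt0r enorm_ge0 andbT enorm_eq0. Qed.

Lemma enorm0 : enorm (0 : V) = 0.
Proof. by apply/eqP; rewrite enorm_eq0. Qed.

Lemma enormZ a x : enorm (a *: x) = `|a| * enorm x.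
Proof.
by rewrite /enorm dotZl dotZr mulrA sqrtrM ?sqrtr_sqr // -expr2 sqr_ge0.
Qed.

Lemma enormN x : enorm (- x) = enorm x.
Proof. by rewrite -scaleN1r enormZ normrN1 mul1r. Qed.

Lemma enormBC x y : enorm (x - y) = enorm (y - x).
Proof. by rewrite -enormN opprB. Qed.

Lemma sphereP x : sphere R d x <-> dot x x = 1.
Proof.
rewrite /sphere /= -sqr_enorm; split => [->|/eqP]; first by rewrite expr1n.
by rewrite sqrf_eq1 => /orP[/eqP//|/eqP x1]; have := enorm_ge0 x; lra.
Qed.

Lemma dot_le_enorm x y : `|dot x y| <= enorm x * enorm y.
Proof.
have [->|y0] := eqVneq y 0; first by rewrite dot0r normr0 enorm0 mulr0.
rewrite -(ler_pXn2r (n := 2)) ?nnegrE ?normr_ge0 ?mulr_ge0 ?enorm_ge0//.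
rewrite exprMn !sqr_enorm real_normK ?num_real//.
have yy : 0 < dot y y by rewrite dot_gt0.
(* The part of [x] orthogonal to [y], multiplied by [dot y y] to avoid a division. *)
have := dot_ge0 (dot y y *: x - dot x y *: y).
rewrite dotBl !dotBr !dotZl !dotZr (dotC y x) => h.
suff : 0 <= dot y y * (dot x x * dot y y - dot x y ^+ 2).
  by rewrite pmulr_rge0// subr_ge0.
by apply: le_trans h _; rewrite le_eqVlt; apply/orP; left; apply/eqP; ring.
Qed.

Lemma enormD x y : enorm (x + y) <= enorm x + enorm y.
Proof.
rewrite -(ler_pXn2r (n := 2)) ?nnegrE ?addr_ge0 ?enorm_ge0//.
rewrite sqr_enorm dotDl !dotDr (dotC y x) sqrrD !sqr_enorm.
have := le_trans (ler_norm _) (dot_le_enorm x y); lra.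
Qed.

Lemma enorm_triangle y x z : enorm (x - z) <= enorm (x - y) + enorm (y - z).
Proof. by rewrite -[X in enorm X <= _](subrKA y) enormD. Qed.

Lemma enorm_sum (I : Type) (r : seq I) (Q : pred I) (F : I -> V) :
  enorm (\sum_(i <- r | Q i) F i) <= \sum_(i <- r | Q i) enorm (F i).
Proof.
elim/big_rec2 : _ => [|i y x _ h]; first by rewrite enorm0.
by apply: le_trans (enormD _ _) _; rewrite lerD2l.
Qed.

Lemma enorm_lipschitz x y : `|enorm x - enorm y| <= enorm (x - y).
Proof.
have := enorm_triangle y x 0; have := enorm_triangle x y 0.
rewrite !subr0 (enormBC y x) ler_norml; lra.
Qed.

Lemma dot_lipschitz u x y : `|dot x u - dot y u| <= enorm (x - y) * enorm u.
Proof. by rewrite -dotBl dot_le_enorm. Qed.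

Lemma ler_norm_enorm x : `|x| <= enorm x.
Proof.
rewrite [leLHS]/Num.norm /= mx_normrE; apply/bigmax_leP; split => /=.
  exact: enorm_ge0.
move=> [i j] _ /=; rewrite ord1 /enorm -sqrtr_sqr ler_wsqrtr// /dot.
rewrite (bigD1 j)//= -expr2 lerDl; apply: sumr_ge0 => l _.
by rewrite -expr2 sqr_ge0.
Qed.

Lemma enorm_le_norm x : enorm x <= d.+1%:R * `|x|.
Proof.
have coord i : `|x ord0 i| <= `|x|.
  by rewrite [leRHS]/Num.norm /= mx_normrE; apply: (le_bigmax _ _ (ord0, i)).
rewrite -(ler_pXn2r (n := 2)) ?nnegrE ?enorm_ge0 ?mulr_ge0//.
rewrite sqr_enorm /dot exprMn.
apply: (@le_trans _ _ (\sum_(i < d.+1) `|x| ^+ 2)).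
  apply: ler_sum => i _; rewrite -expr2 -(real_normK (num_real (x ord0 i))).
  by rewrite ler_pXn2r ?nnegrE.
rewrite sumr_const card_ord -[leLHS]mulr_natl ler_wpM2r ?sqr_ge0//.
by rewrite -natrX ler_nat -{1}(expn1 d.+1) leq_pexp2l.
Qed.

Lemma nbhs_eball x e : 0 < e -> nbhs x [set y | enorm (x - y) < e].
Proof.
move=> e0; apply/nbhs_ballP; exists (e / d.+1%:R) => /=; first by rewrite divr_gt0.
move=> y; rewrite -ball_normE /ball_ /= ltr_pdivlMr// mulrC.
exact: le_lt_trans (enorm_le_norm _).
Qed.

(** The library's neighbourhoods are sup-norm balls; the two norms being equivalent, topological
    statements can be read with [enorm] from here on. *)
Lemma nbhs_eballP x (A : set V) :
  nbhs x A <-> exists2 e : R, 0 < e & forall y, enorm (x - y) < e -> A y.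
Proof.
split=> [|[e e0 xA]]; last first.
  by apply: (@filterS _ (nbhs x) (nbhs_filter x)) (nbhs_eball x e0) => y; exact: xA.
move=> /nbhs_ballP[e /= e0 xA]; exists e => // y xy; apply: xA.
by rewrite -ball_normE /ball_ /=; exact: le_lt_trans (ler_norm_enorm _) xy.
Qed.

Lemma lipschitz_continuous (f : V -> R) (M : R) :
  (forall x y, `|f x - f y| <= M * enorm (x - y)) -> continuous f.
Proof.
move=> fM x; apply/(@cvgrPdist_lt _ _ _ (nbhs x) (nbhs_filter x)) => e e0.
have M0 : 0 < 1 + `|M| by rewrite ltr_pwDl.
apply: (@filterS _ (nbhs x) (nbhs_filter x)) (nbhs_eball x (divr_gt0 e0 M0)) => y /=.
rewrite ltr_pdivlMr// mulrC; apply: le_lt_trans; apply: le_trans (fM _ _) _.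
by rewrite ler_wpM2r ?enorm_ge0//; have := ler_norm M; lra.
Qed.

Lemma enorm_continuous : continuous (@enorm R d).
Proof.
by apply: (@lipschitz_continuous _ 1) => x y; rewrite mul1r enorm_lipschitz.
Qed.

Lemma dot_continuous u : continuous (dot^~ u).
Proof.
by apply: (@lipschitz_continuous _ (enorm u)) => x y; rewrite mulrC dot_lipschitz.
Qed.

Lemma sphere_closed : closed (sphere R d).
Proof.
apply: (@preimage_closed _ _ (@enorm R d) [set x | x = 1]); last exact: closed_eq.
by move=> x _; exact: enorm_continuous.
Qed.

Lemma sphere_compact : compact (sphere R d).
Proof.
apply: bounded_closed_compact sphere_closed.
exists 1; split; first exact: num_real.
by move=> M M1 x x1; apply: le_trans (ler_norm_enorm x) _; rewrite x1 ltW.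
Qed.

Lemma sphere_neq0 x : sphere R d x -> x != 0.
Proof. by move=> x1; rewrite -enorm_gt0 x1. Qed.

Definition normalize x : V := (enorm x)^-1 *: x.

Lemma normalize_sphere x : x != 0 -> sphere R d (normalize x).
Proof.
move=> x0; rewrite /sphere /= /normalize enormZ ger0_norm ?invr_ge0 ?enorm_ge0//.
by rewrite mulVf// enorm_eq0.
Qed.

Lemma normalizeK x : enorm x *: normalize x = x.
Proof.
have [->|x0] := eqVneq x 0; first by rewrite enorm0 scale0r.
by rewrite /normalize scalerA divff ?scale1r// enorm_eq0.
Qed.

Lemma normalize_id x : sphere R d x -> normalize x = x.
Proof. by rewrite /sphere /normalize /= => ->; rewrite invr1 scale1r. Qed.

(** For nonzero [x] the radial move to [normalize x] has length | |x| - 1 |, at most |x - y| since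
    |y| = 1; the triangle inequality then gives the factor 2. At 0, [normalize] takes the value
    0. *)
Lemma dist_normalize x y : sphere R d y -> 
  enorm (normalize x - y) <= 2 * enorm (x - y).
Proof.
move=> y1; have [->|x0] := eqVneq x 0.
  by rewrite /normalize scaler0 sub0r enormN; have := enorm_ge0 y; lra.
apply: le_trans (enorm_triangle x _ _) _.
suff : enorm (normalize x - x) <= enorm (x - y) by lra.
rewrite -{2}(scale1r x) -scalerBl enormZ.
have -> : (enorm x)^-1 - 1 = (1 - enorm x) / enorm x.
  by field; rewrite enorm_eq0.
rewrite normrM [X in _ * X * _]ger0_norm ?invr_ge0 ?enorm_ge0//.
rewrite mulfVK ?enorm_eq0//.
by have := enorm_lipschitz y x; rewrite y1 enormBC.
Qed.

(** The radius varies with the centre because it will encode a local margin in [miss_open] and a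
    small measure in [containment_small]. *)
Lemma sphere_finite_cover (r : V -> R) : (forall x, sphere R d x -> 0 < r x) ->
  exists s : seq V, (forall x, x \in s -> sphere R d x) /\
    forall y, sphere R d y -> exists2 x, x \in s & enorm (x - y) < r x.
Proof.
move=> r0; have := sphere_compact; rewrite compact_cover.
move=> /(_ V (sphere R d) (fun x => [set y | enorm (x - y) < r x]^°)).
case=> [x _|x x1|D DS cov]; first exact: open_interior.
- by exists x => //; exact: nbhs_eball (r0 _ x1).
- exists (finmap.enum_fset D); split => [x xD|y /cov[x xD /interior_subset xy]].
    by apply/set_mem; exact: DS.
  by exists x.
Qed.

End EuclideanTheory.

(** * Linear hulls and great subspheres *)

Section LinearAlgebra.
Context {R : realType} {d : nat}.
Local Notation V := ('rV[R]_d.+1).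
Implicit Types (x y z u : V) (U W : {vspace V}).

(** One step size serves a finite family: [t] is 1 / M with [M] above every |b i| / |a i|. Indices
    with a i = 0 add 0 to the sum. *)
Lemma sg_perturb (I : finType) (a b : I -> R) :
  exists2 t : R, 0 < t & forall i (s : R), a i != 0 -> `|s| <= t ->
    Num.sg (a i + s * b i) = Num.sg (a i).
Proof.
pose M := 1 + \sum_i `|b i| / `|a i|.
have M0 : 0 < M by rewrite ltr_pwDl// sumr_ge0// => i _; rewrite divr_ge0.
exists M^-1; first by rewrite invr_gt0.
move=> i s ai sM.
suff lt : `|s * b i| < `|a i|.
  have [a0|a0|/eqP] := ltrgtP (a i) 0; last by rewrite (negbTE ai).
  - rewrite (ltr0_sg a0) ltr0_sg//; move: lt; rewrite (ltr0_norm a0).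
    by move=> /(le_lt_trans (ler_norm _)); lra.
  - rewrite (gtr0_sg a0) gtr0_sg//; move: lt; rewrite (gtr0_norm a0) -normrN.
    by move=> /(le_lt_trans (ler_norm _)); lra.
have ai0 : 0 < `|a i| by rewrite normr_gt0.
rewrite normrM -[ltRHS]mul1r -ltr_pdivrMr// -mulrA.
have [->|bi] := eqVneq (b i) 0; first by rewrite normr0 mul0r mulr0.
have bi0 : 0 < `|b i| / `|a i| by rewrite divr_gt0// normr_gt0.
apply: le_lt_trans (ler_wpM2r (ltW bi0) sM) _.
rewrite mulrC ltr_pdivrMr// mul1r /M (bigD1 i)//=.
have : 0 <= \sum_(j | j != i) `|b j| / `|a j| by apply: sumr_ge0 => j _; rewrite divr_ge0.
by lra.
Qed.

Definition orth u : {vspace V} := lker (linfun (mulmxr u^T : V -> 'rV[R]_1)).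

Lemma mem_orth u x : (x \in orth u) = (dot x u == 0).
Proof.
rewrite memv_ker lfunE /=; have xu : (x *m u^T) ord0 ord0 = dot x u.
  by rewrite mxE; apply: eq_bigr => i _; rewrite mxE.
apply/eqP/eqP => [x0|x0]; first by rewrite -xu x0 mxE.
by apply/matrixP => i j; rewrite !ord1 xu x0 mxE.
Qed.

Lemma mem_bigcap (I : finType) (P : pred I) (F : I -> {vspace V}) x :
  (x \in (\bigcap_(i | P i) F i)%VS) = [forall (i | P i), x \in F i].
Proof.
rewrite [LHS]memvE; apply/subv_bigcapP/forall_inP => h i Pi.
  by rewrite memvE; exact: h.
by rewrite -memvE; exact: h.
Qed.

Lemma dim_fullV : \dim (fullv : {vspace V}) = d.+1.
Proof. by rewrite dimvf /dim /= ?mul1n. Qed.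

Lemma dim_cap_orth U u : ~~ (U <= orth u)%VS ->
  \dim (U :&: orth u) = (\dim U).-1.
Proof.
move=> Uu; have := limg_ker_dim (linfun (mulmxr u^T : V -> 'rV[R]_1)) U.
rewrite -/(orth u); set r := \dim (_ @: U) => <-.
suff -> : r = 1%N by rewrite addn1.
apply/eqP; rewrite eqn_leq; apply/andP; split.
  by apply: leq_trans (dimvS (subvf _)) _; rewrite dimvf /dim /= ?muln1.
by rewrite lt0n dimv_eq0 -lkerE.
Qed.

Lemma dim_orth u : u != 0 -> \dim (orth u) = d.
Proof.
move=> u0; rewrite -(capfv (orth u)) dim_cap_orth; first by rewrite dim_fullV.
apply/subvPn; exists u; first exact: memvf.
by rewrite mem_orth dot_eq0.
Qed.

Lemma dim_cap_orth_ge U u : (\dim U <= (\dim (U :&: orth u)).+1)%N.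
Proof.
have [Uu|Uu] := boolP (U <= orth u)%VS; last by rewrite dim_cap_orth// leqSpred.
by move/capv_idPl : Uu => ->; rewrite leqnSn.
Qed.

(** Pairing with a basis of [W] maps [U] into a space of dimension \dim W < \dim U, so it has a
    nonzero kernel on [U]. *)
Lemma exists_orthogonal U W : (\dim W < \dim U)%N ->
  exists2 x, x \in U /\ sphere R d x & (W <= orth x)%VS.
Proof.
move=> WU; pose B := \matrix_(i < d.+1, j < \dim W) (vbasis W)`_j ord0 i.
pose f := linfun (mulmxr B : V -> 'rV[R]_(\dim W)).
have : vpick (U :&: lker f) != 0.
  rewrite vpick0 -dimv_eq0; have := limg_ker_dim f U.
  have := dimvS (subvf (f @: U)).
  rewrite [X in (_ <= X)%N]dimvf /dim /= ?mul1n => h1 h2; apply/eqP => h3.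
  by move: h1 h2 WU; rewrite h3 add0n => le <-; rewrite ltnNge le.
set u := vpick _ => u0.
have := memv_pick (U :&: lker f); rewrite -/u memv_cap => /andP[uU uf].
exists (normalize u); first by split; [exact: memvZ|exact: normalize_sphere].
have bu j : (j < \dim W)%N -> dot (vbasis W)`_j u = 0.
  move=> jW; move: uf; rewrite memv_ker lfunE /= => /eqP.
  move=> /matrixP/(_ ord0 (Ordinal jW)); rewrite !mxE => <-.
  by apply: eq_bigr => i _; rewrite mxE mulrC.
apply/subvP => x /coord_vbasis ->; rewrite mem_orth dot_suml big1// => i _.
by rewrite dotZl dotZr bu ?mulr0.
Qed.

Lemma hyperplane_orth U : \dim U = d -> exists2 u, sphere R d u & U = orth u.
Proof.
move=> Ud; have [|u [_ u1] Uu] := @exists_orthogonal fullv U; first by rewrite Ud dim_fullV.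
by exists u => //; apply/eqP; rewrite eqEdim Uu (dim_orth (sphere_neq0 u1)) Ud /=.
Qed.

Lemma normalize_mem U x : x \in U -> normalize x \in U.
Proof. exact: memvZ. Qed.

Lemma vspace_set_inj U W : [set` U] = [set` W] -> U = W.
Proof.
move=> UW; apply/vspaceP => x; apply/idP/idP => xU.
  by have : [set` W] x by rewrite -UW.
by have : [set` U] x by rewrite UW.
Qed.

Lemma sphere_subv U W :
  [set` U] `&` sphere R d `<=` [set` W] -> (U <= W)%VS.
Proof.
move=> UW; apply/subvP => x xU; have [->|x0] := eqVneq x 0; first exact: mem0v.
rewrite -(normalizeK x).
by apply/memvZ/UW; split; [exact: normalize_mem|exact: normalize_sphere].
Qed.

Lemma sphere_inj U W :
  [set` U] `&` sphere R d = [set` W] `&` sphere R d -> U = W.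
Proof.
move=> UW; apply/eqP; rewrite eqEsubv !sphere_subv//.
  by rewrite -UW; exact: subIsetl.
by rewrite UW; exact: subIsetl.
Qed.

Lemma sphere_cap0 U W : (U :&: W == 0)%VS <->
  ([set` U] `&` sphere R d) `&` ([set` W] `&` sphere R d) = set0.
Proof.
split=> [/eqP UW|UW].
  rewrite -subset0 => x [[/= xU x1] [/= xW _]].
  have : x \in (U :&: W)%VS by rewrite memv_cap xU.
  by rewrite UW memv0 (negbTE (sphere_neq0 x1)).
rewrite -subv0; apply: sphere_subv => x [/= ]; rewrite memv_cap => /andP[xU xW] x1.
by have : set0 x by rewrite -UW.
Qed.

Lemma exists_subspace U m : (m <= \dim U)%N -> exists2 W, (W <= U)%VS & \dim W = m.
Proof.
move=> mU; exists <<take m (vbasis U)>>%VS.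
  by apply/span_subvP => x /mem_take; exact: vbasis_mem.
have : free (take m (vbasis U) ++ drop m (vbasis U)).
  by rewrite cat_take_drop; exact: (basis_free (vbasisP _)).
by move=> /catl_free; rewrite /free => /eqP ->; rewrite size_takel// size_tuple.
Qed.

(** An upper bound on a dimension becomes disjointness from one fixed subspace. On the sphere this
    is a condition on compact sets, stable under small perturbations; [bigcap_great_open] uses it
    so. *)
Lemma dim_le_complement U m : (m <= d.+1)%N ->
  (\dim U <= m)%N <-> exists2 W, \dim W = (d.+1 - m)%N & (U :&: W == 0)%VS.
Proof.
move=> md; split=> [Um|[W Wd /eqP UW]].
  have dimC : \dim U^C = (d.+1 - \dim U)%N by rewrite dimv_compl dim_fullV.
  have : (d.+1 - m <= \dim U^C)%N by rewrite dimC leq_sub2l.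
  move=> /exists_subspace[W WU Wm]; exists W => //.
  by rewrite -subv0 -(capv_compl U) capvS.
have := dimv_disjoint_sum UW; rewrite Wd.
have := dimvS (subvf (U + W)); rewrite dim_fullV; lia.
Qed.

(** [lin A] is an intersection of subspaces and not a [{vspace V}] by construction. A finite family
    in [A] whose span has maximal dimension absorbs every point of [A]. *)
Lemma lin_span (A : set V) : exists t : seq V,
  [/\ forall x, x \in t -> A x, A `<=` [set` <<t>>%VS] & lin A = [set` <<t>>%VS]].
Proof.
pose Q m := `[< exists2 t : seq V, (forall x, x \in t -> A x) & \dim <<t>> = m >].
have exQ : exists m, Q m by exists 0%N; apply/asboolP; exists [::]; rewrite // span_nil dimv0.
have bQ m : Q m -> (m <= d.+1)%N.
  by move=> /asboolP[t _ <-]; have := dimvS (subvf <<t>>%VS); rewrite dim_fullV.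
case: (ex_maxnP exQ bQ) => m /asboolP[t tA tm] maxm.
have At : A `<=` [set` <<t>>%VS].
  move=> x Ax /=; have : Q (\dim <<x :: t>>).
    apply/asboolP; exists (x :: t) => // y; rewrite inE => /predU1P[->//|]; exact: tA.
  move=> /maxm; rewrite -tm => le.
  have : (<<t>> == <<x :: t>>)%VS by rewrite eqEdim le andbT span_cons addvSr.
  by move=> /eqP ->; rewrite memv_span ?mem_head.
exists t; split => //; apply/seteqP; split => x /=; first by apply.
by move=> xs U AU; move: xs; apply/subvP/span_subvP => y /tA/AU.
Qed.

Lemma lin_mono (A B : set V) : A `<=` B -> lin A `<=` lin B.
Proof. by move=> AB x Ax U BU; apply: Ax => y /AB/BU. Qed.

Lemma direction_great (k : nat) (K : set V) U :
  lin K = [set` U] -> great_subspheres R d k (direction K) <-> \dim U = k.+1.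
Proof.
rewrite /direction => ->; split=> [[W /= Wk /sphere_inj <-]//|Uk]; by exists U.
Qed.

(** Indexing by [nat] avoids casts in the induction, which splits off a unit vector of [U] and
    continues in its orthogonal complement within [U]. *)
Lemma orthonormal_basis U : exists q : nat -> V,
  [/\ forall i, (i < \dim U)%N -> q i \in U,
      forall i j, (i < \dim U)%N -> (j < \dim U)%N -> dot (q i) (q j) = (i == j)%:R &
      forall x, x \in U -> x = \sum_(i < \dim U) dot x (q i) *: q i].
Proof.
move m : (\dim U) => m'; elim: m' U m => [|m IH] U Um.
  exists (fun=> 0); split => // x; move/eqP : Um; rewrite dimv_eq0 => /eqP ->.
  by rewrite memv0 => /eqP ->; rewrite big_ord0.
have U0 : vpick U != 0 by rewrite vpick0 -dimv_eq0 Um.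
set v := normalize (vpick U).
have vU : v \in U by apply/normalize_mem/memv_pick.
have v1 : dot v v = 1 by apply/sphereP/normalize_sphere.
have [|q [qU qq qx]] := IH (U :&: orth v)%VS.
  rewrite dim_cap_orth ?Um//; apply/subvPn; exists v => //.
  by rewrite mem_orth v1 oner_eq0.
have qv i : (i < m)%N -> dot (q i) v = 0.
  by move=> /qU; rewrite memv_cap mem_orth => /andP[_ /eqP].
exists (fun i => if i is j.+1 then q j else v); split.
- by move=> [//|i]; rewrite ltnS => /qU; rewrite memv_cap => /andP[].
- move=> [|i] [|j]; rewrite ?ltnS => im jm //=; first by rewrite dotC qv.
  + exact: qv.
  + exact: qq.
- move=> x xU; rewrite big_ord_recl /=.
  have : x - dot x v *: v \in (U :&: orth v)%VS.
    rewrite memv_cap (memvB xU (memvZ _ vU)) mem_orth dotBl dotZl v1 mulr1.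
    by rewrite subrr /=.
  move=> /qx; move/(canRL (subrK _)) => {1}->; rewrite addrC; congr (_ + _).
  by apply: eq_bigr => i _; rewrite /bump /= dotBl dotZl (dotC v) qv// mulr0 subr0.
Qed.

(** [f] is the distance to the orthogonal projection onto [U], with a crude Lipschitz constant. A
    zero sublevel set of a Lipschitz function is the form that [caratheodory_sublevel] treats. *)
Lemma vspace_sublevel U : exists (f : V -> R) (M : R), [/\ 0 < M,
  forall x y, `|f x - f y| <= M * enorm (x - y) & [set` U] = [set x | f x <= 0]].
Proof.
have [q [qU _ qx]] := orthonormal_basis U.
pose p x := \sum_(i < \dim U) dot x (q i) *: q i.
pose M := 1 + \sum_(i < \dim U) enorm (q i) * enorm (q i).
have pU x : p x \in U by apply: memv_suml => i _; rewrite memvZ// qU.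
exists (fun x => enorm (x - p x)), M; split.
- by rewrite ltr_pwDl// sumr_ge0// => i _; rewrite mulr_ge0 ?enorm_ge0.
- move=> x y; apply: le_trans (enorm_lipschitz _ _) _.
  have -> : x - p x - (y - p y) = (x - y) - p (x - y).
    have -> : p (x - y) = p x - p y.
      by rewrite /p -sumrB; apply: eq_bigr => i _; rewrite dotBl scalerBl.
    by move: (p x) (p y) => v w; apply/rowP => i; rewrite !mxE; ring.
  apply: le_trans (enormD _ _) _; rewrite enormN mulrDl mul1r lerD2l.
  apply: le_trans (enorm_sum _ _ _) _; rewrite mulr_suml; apply: ler_sum => i _.
  rewrite enormZ.
  apply: le_trans (ler_wpM2r (enorm_ge0 _) (dot_le_enorm _ _)) _.
  by rewrite le_eqVlt; apply/orP; left; apply/eqP; ring.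
- apply/seteqP; split => x /=; first by move=> /qx xx; rewrite /p -xx subrr enorm0.
  by rewrite le_eqVlt ltNge enorm_ge0 orbF enorm_eq0 subr_eq0 => /eqP ->; exact: pU.
Qed.

Lemma vspace_closed U : closed [set` U].
Proof.
have [f [M [M0 fM ->]]] := vspace_sublevel U.
apply: (@preimage_closed _ _ f [set x | x <= 0]); last exact: closed_le.
by move=> x _; exact: lipschitz_continuous fM x.
Qed.

Lemma linear_isometry U W : \dim U = \dim W -> exists f : V -> V,
  [/\ forall x y, f (x - y) = f x - f y,
      forall x, x \in U -> dot (f x) (f x) = dot x x &
      forall y, y \in W -> exists2 x, x \in U & f x = y].
Proof.
move=> UW; have [p [pU pp px]] := orthonormal_basis U.
have [q [qW qq qx]] := orthonormal_basis W.
rewrite -UW in qW qq qx.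
pose f x := \sum_(i < \dim U) dot x (p i) *: q i.
have f_p x (i : 'I_(\dim U)) : dot (f x) (q i) = dot x (p i).
  rewrite dot_suml (bigD1 i)//= dotZl qq// eqxx mulr1 big1 ?addr0// => j ji.
  by rewrite dotZl qq// (negbTE (ji : nat_of_ord j != i)) mulr0.
exists f; split.
- by move=> x y; rewrite /f -sumrB; apply: eq_bigr => i _; rewrite dotBl scalerBl.
- move=> z /px zz.
  have -> : dot z z = dot (\sum_(i < \dim U) dot z (p i) *: p i) z by rewrite -zz.
  rewrite {1}/f !dot_suml; apply: eq_bigr => i _.
  by rewrite !dotZl (dotC (q i)) f_p (dotC (p i)).
- move=> y yW; exists (\sum_(i < \dim U) dot y (q i) *: p i).
    by apply: memv_suml => i _; rewrite memvZ// pU.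
  rewrite [RHS]qx//; apply: eq_bigr => i _; congr (_ *: _).
  rewrite dot_suml (bigD1 i)//= dotZl pp// eqxx mulr1 big1 ?addr0// => j ji.
  by rewrite dotZl pp// (negbTE (ji : nat_of_ord j != i)) mulr0.
Qed.

End LinearAlgebra.

(** * Sign vectors of arrangements in general position *)

Section Arrangement.
Context {R : realType} {d n : nat}.
Local Notation V := ('rV[R]_d.+1).
Variable u : 'I_n -> V.
Implicit Types (x y z : V) (U W : {vspace V}) (I A E : {set 'I_n}).

Definition flat I : {vspace V} := (\bigcap_(i in I) orth (u i))%VS.

Lemma mem_flat I x : (x \in flat I) <-> forall i, i \in I -> dot x (u i) = 0.
Proof.
rewrite mem_bigcap; split=> [/forall_inP h i /h|h].
  by rewrite mem_orth => /eqP.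
by apply/forall_inP => i /h; rewrite mem_orth => ->.
Qed.

Lemma flat0 : flat finset.set0 = fullv.
Proof. by rewrite /flat big_set0. Qed.

Lemma flatU1 i I : flat (i |: I) = (flat I :&: orth (u i))%VS.
Proof.
apply/vspaceP => x; apply/idP/idP => [/mem_flat h|].
  rewrite memv_cap mem_orth h ?setU11// eqxx andbT.
  by apply/mem_flat => j jI; apply: h; rewrite setU1r.
rewrite memv_cap mem_orth => /andP[/mem_flat h /eqP xi].
by apply/mem_flat => j; rewrite !inE => /predU1P[->//|]; exact: h.
Qed.

Lemma dim_flat_ge I : (d.+1 - #|I| <= \dim (flat I))%N.
Proof.
move m : #|I| => m'; elim: m' I m => [|m IH] I Im.
  by move/eqP : Im; rewrite cards_eq0 => /eqP ->; rewrite flat0 dim_fullV.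
have /set0Pn[i iI] : I != finset.set0 by rewrite -card_gt0 Im.
rewrite -(finset.setD1K iI) flatU1.
have := IH (I :\ i); rewrite (cardsD1 i) iI add1n in Im => /(_ (succn_inj Im)).
have := dim_cap_orth_ge (flat (I :\ i)) (u i); lia.
Qed.

(** Linear independence of any at most d + 1 of the normals, written as one condition for each pair
    (I, i): this is the shape in which [containment_negligible] excludes its failure almost
    surely. *)
Definition general_position := forall I i, i \notin I -> flat I != 0%VS ->
  ~~ (flat I <= orth (u i))%VS.

Lemma dim_flat I : general_position -> \dim (flat I) = (d.+1 - #|I|)%N.
Proof.
move=> gp; move m : #|I| => m'; elim: m' I m => [|m IH] I Im.
  by move/eqP : Im; rewrite cards_eq0 => /eqP ->; rewrite flat0 dim_fullV.
have /set0Pn[i iI] : I != finset.set0 by rewrite -card_gt0 Im.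
rewrite -(finset.setD1K iI) flatU1.
have := IH (I :\ i); rewrite (cardsD1 i) iI add1n in Im => /(_ (succn_inj Im)).
have [->|F0 dF] := eqVneq (flat (I :\ i)) 0%VS; first by rewrite cap0v dimv0; lia.
by rewrite dim_cap_orth ?gp ?setD11// dF; lia.
Qed.

Lemma flat_inj I J : general_position -> flat I != 0%VS -> flat I = flat J -> I = J.
Proof.
move=> gp F0 IJ; have sub I' J' : flat I' != 0%VS -> flat I' = flat J' -> J' \subset I'.
  move=> F IJ'; apply/fintype.subsetP => j jJ; apply/negPn/negP => jI.
  have := gp _ _ jI F; rewrite IJ' => /negP; apply.
  by apply/subvP => x /mem_flat/(_ j jJ); rewrite mem_orth => ->.
by apply/eqP; rewrite finset.eqEsubset !sub// -IJ.
Qed.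

Definition sgn_of E (j : 'I_n) : R := if j \in E then 1 else -1.

(** A nowhere zero sign vector on [A] is encoded by the set of its positive entries; [E \subset A]
    makes the encoding unique. *)
Definition sign_vectors U A : {set {set 'I_n}} :=
  [set E : {set 'I_n} | (E \subset A) && `[< exists2 x, x \in U &
     forall j, j \in A -> Num.sg (dot x (u j)) = sgn_of E j >]].

Lemma sign_vectorsP U A E : reflect (E \subset A /\ exists2 x, x \in U &
    forall j, j \in A -> Num.sg (dot x (u j)) = sgn_of E j)
  (E \in sign_vectors U A).
Proof.
by rewrite inE; apply: (iffP andP) => [[EA /asboolP]|[EA /asboolP]].
Qed.

Lemma sgn_of_neq0 E j : sgn_of E j != 0.
Proof. by rewrite /sgn_of; case: ifP => _; rewrite ?oppr_eq0 oner_eq0. Qed.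

Lemma sgn_ofD1 E a j : j != a -> sgn_of (E :\ a) j = sgn_of E j.
Proof. by move=> ja; rewrite /sgn_of !inE ja. Qed.

Lemma sgn_ofU1 E a j : j != a -> sgn_of (a |: E) j = sgn_of E j.
Proof. by move=> ja; rewrite /sgn_of !inE (negbTE ja). Qed.

(* Deletion-restriction: a sign vector on [A :\ a] extends to [a] in both ways
   exactly when it is realized on the hyperplane orthogonal to [u a]. *)
Lemma card_sign_vectorsD1 U A a : a \in A -> ~~ (U <= orth (u a))%VS ->
  #|sign_vectors U A| =
  (#|sign_vectors U (A :\ a)| + #|sign_vectors (U :&: orth (u a)) (A :\ a)|)%N.
Proof.
move=> aA /subvPn[y yU]; rewrite mem_orth => ya.
pose S := sign_vectors U A.
(* [P] and [N] collect the restrictions to [A :\ a] of the sign vectors positive, respectively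
   negative, at [a]. Their union is the deletion and their intersection the restriction, so the
   claim is inclusion-exclusion for |P| + |N|. *)
pose P := (fun E => E :\ a) @: finset (fun E => (E \in S) && (a \in E)).
pose N := finset (fun E => (E \in S) && (a \notin E)).
have cardS : #|S| = (#|P| + #|N|)%N.
  rewrite card_in_imset; last first.
    move=> E F; rewrite !inE => /andP[_ aE] /andP[_ aF] EF.
    by rewrite -(finset.setD1K aE) EF finset.setD1K.
  rewrite -(cardsID (finset (fun E : {set 'I_n} => a \in E)) S); congr (_ + _)%N; apply: eq_card => E.
    by rewrite !inE andbC.
  by rewrite !inE andbC.
have sgy E x : (forall j, j \in A :\ a -> Num.sg (dot x (u j)) = sgn_of E j) ->
    exists2 e : R, 0 < e & forall s, `|s| <= e -> forall j, j \in A :\ a ->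
      Num.sg (dot (x + s *: y) (u j)) = sgn_of E j.
  move=> xE; have [e e0 he] := sg_perturb (fun j => dot x (u j)) (fun j => dot y (u j)).
  exists e => // s se j jA; rewrite dotDl dotZl he ?xE//.
  by rewrite -sgr_eq0 xE ?sgn_of_neq0.
have PE E : (E \in P) <-> E \subset A :\ a /\ exists2 x, x \in U & 0 < dot x (u a) /\
    forall j, j \in A :\ a -> Num.sg (dot x (u j)) = sgn_of E j.
  split.
    move=> /imsetP[F]; rewrite inE => /andP[/sign_vectorsP[FA [x xU xF]] aF] ->.
    split; first exact: finset.setSD.
    exists x => //; split.
      by rewrite -sgr_gt0 xF// /sgn_of aF.
    by move=> j; rewrite !inE => /andP[ja jA]; rewrite sgn_ofD1// xF.
  case=> EA [x xU [xa xE]].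
  have aE : a \notin E by apply/negP => /(fintype.subsetP EA); rewrite !inE eqxx.
  apply/imsetP; exists (a |: E); last by rewrite setU1K.
  rewrite inE finset.setU11 andbT; apply/sign_vectorsP; split.
    by rewrite finset.subUset finset.sub1set aA (fintype.subset_trans EA)// subD1set.
  exists x => // j jA; have [->|ja] := eqVneq j a.
    by rewrite /sgn_of !inE eqxx /= gtr0_sg.
  by rewrite sgn_ofU1// xE// !inE ja.
have NE E : (E \in N) <-> E \subset A :\ a /\ exists2 x, x \in U & dot x (u a) < 0 /\
    forall j, j \in A :\ a -> Num.sg (dot x (u j)) = sgn_of E j.
  split.
    rewrite inE => /andP[/sign_vectorsP[FA [x xU xF]] aF].
    split; first by rewrite subsetD1 FA.
    exists x => //; split.
      by rewrite -sgr_lt0 xF// /sgn_of (negbTE aF) ltrN10.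
    by move=> j; rewrite !inE => /andP[ja jA]; rewrite xF.
  case=> EA [x xU [xa xE]].
  have aE : a \notin E by apply/negP => /(fintype.subsetP EA); rewrite !inE eqxx.
  rewrite inE aE andbT; apply/sign_vectorsP; split.
    by rewrite (fintype.subset_trans EA)// subD1set.
  exists x => // j jA; have [->|ja] := eqVneq j a.
    by rewrite /sgn_of (negbTE aE) /= ltr0_sg.
  by rewrite xE// !inE ja.
rewrite -/S cardS -cardsUI; congr (_ + _)%N; apply: eq_card => E; apply/idP/idP.
- rewrite inE => /orP[/PE|/NE] [EA [x xU [_ xE]]]; apply/sign_vectorsP;
    by split=> //; exists x.
- move=> /sign_vectorsP[EA [x xU xE]].
  rewrite inE; have [x0|x0|x0] := ltrgtP (dot x (u a)) 0.
  + by apply/orP; right; apply/NE; split => //; exists x.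
  + by apply/orP; left; apply/PE; split => //; exists x.
  + have [e e0 he] := sgy _ _ xE.
    pose s := e * Num.sg (dot y (u a)).
    apply/orP; left; apply/PE; split => //; exists (x + s *: y).
      by rewrite memvD// memvZ.
    split; first by rewrite dotDl dotZl x0 add0r -mulrA -normrEsg mulr_gt0// normr_gt0.
    by apply: he; rewrite normrM normr_sg ya mulr1 gtr0_norm.
- rewrite inE => /andP[/PE[EA [x xU [xa xE]]] /NE[_ [z zU [za zE]]]].
  apply/sign_vectorsP; split => //.
  (* The point where the segment from [x] to [z] crosses the hyperplane, up to a positive factor;
     both coefficients are positive, so common signs persist. *)
  exists (- dot z (u a) *: x + dot x (u a) *: z).
    by rewrite memv_cap memvD ?memvZ//= mem_orth dotDl !dotZl; apply/eqP; ring.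
  move=> j jA; rewrite dotDl !dotZl.
  have := xE j jA; have := zE j jA; rewrite /sgn_of; case: ifP => _ z1 x1.
    have : 0 < dot z (u j) by rewrite -sgr_gt0 z1.
    have : 0 < dot x (u j) by rewrite -sgr_gt0 x1.
    by move=> px pz; rewrite gtr0_sg// addr_gt0// mulr_gt0// oppr_gt0.
  have : dot z (u j) < 0 by rewrite -sgr_lt0 z1 ltrN10.
  have : dot x (u j) < 0 by rewrite -sgr_lt0 x1 ltrN10.
  by move=> px pz; rewrite ltr0_sg//; nra.
- move=> /sign_vectorsP[EA [x xU xE]].
  move: xU; rewrite memv_cap mem_orth => /andP[xU /eqP xa].
  have [e e0 he] := sgy _ _ xE.
  pose s := e * Num.sg (dot y (u a)).
  have se : `|s| <= e by rewrite normrM normr_sg ya mulr1 gtr0_norm.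
  have sy : 0 < s * dot y (u a) by rewrite -mulrA -normrEsg mulr_gt0// normr_gt0.
  rewrite inE; apply/andP; split.
    apply/PE; split => //; exists (x + s *: y); first by rewrite memvD// memvZ.
    by split; [rewrite dotDl dotZl xa add0r|apply: he].
  apply/NE; split => //; exists (x + (- s) *: y); first by rewrite memvD// memvZ.
  split; first by rewrite dotDl dotZl xa add0r mulNr oppr_lt0.
  by apply: he; rewrite ?normrN.
Qed.

(** The number of regions cut out of R^p by m hyperplanes through 0 in general position; for m > 0
    it is twice the sum over i < p of the binomial coefficients of m - 1 over i. *)
Fixpoint chambers (m p : nat) : nat :=
  if m is m'.+1 then
    if p is p'.+1 then (chambers m' p + chambers m' p')%N else 0
  else 1.

Lemma chambers_gt0 m p : (0 < chambers m p.+1)%N.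
Proof. by elim: m => //= m; case: chambers => // c _; rewrite addSn. Qed.

Lemma card_sign_vectors I A : general_position -> A \subset ~: I ->
  #|sign_vectors (flat I) A| = chambers #|A| (d.+1 - #|I|).
Proof.
move=> gp; move m : #|A| => m'; elim: m' I A m => [|m IH] I A Am IA.
  move/eqP : Am; rewrite cards_eq0 => /eqP ->.
  apply/eqP/cards1P; exists finset.set0; apply/setP => E; rewrite !inE finset.subset0.
  have [->/=|//] := eqVneq E finset.set0; apply/asboolP.
  by exists 0; [exact: mem0v|move=> j; rewrite inE].
have /set0Pn[a aA] : A != finset.set0 by rewrite -card_gt0 Am.
have aI : a \notin I by move/fintype.subsetP : IA => /(_ a aA); rewrite inE.
have Aa : #|A :\ a| = m by move: Am; rewrite (cardsD1 a) aA add1n => -[].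
have IA' : A :\ a \subset ~: (a |: I).
  apply/fintype.subsetP => j; rewrite !inE negb_or => /andP[-> jA] /=.
  by move/fintype.subsetP : IA => /(_ j jA); rewrite inE.
have dI := dim_flat I gp.
(* On the zero flat all signs vanish, so nothing is realized once [A] is nonempty; this is the value
   [chambers m.+1 0 = 0]. *)
have [I0|I0] := eqVneq (flat I) 0%VS.
  rewrite I0 dimv0 in dI; rewrite -dI /=.
  apply/eqP; rewrite cards_eq0 -finset.subset0; apply/fintype.subsetP => E /sign_vectorsP[EA [x]].
  rewrite I0 memv0 => /eqP -> /(_ a aA); rewrite dot0l sgr0 => /esym/eqP.
  by rewrite (negbTE (sgn_of_neq0 _ _)).
rewrite (card_sign_vectorsD1 aA (gp _ _ aI I0)) -flatU1 !IH//; last first.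
  by rewrite (fintype.subset_trans _ IA)// subD1set.
rewrite cardsU1 aI add1n.
case E : (d.+1 - #|I|)%N => [|p] /=; first by move: I0; rewrite -dimv_eq0 dI E.
by congr (_ + chambers m _)%N; rewrite subnS E.
Qed.

End Arrangement.

(** * Cells and faces of the tessellation *)

Section Cells.
Context {R : realType} {d n : nat}.
Local Notation V := ('rV[R]_d.+1).
Variable u : 'I_n -> V.
Hypothesis u0 : forall i, u i != 0.
Hypothesis n0 : (0 < n)%N.
Implicit Types (x y z : V).

Let T := tessellation (fun i => great_hypersphere (u i)).
Let O := sphere R d `\` \bigcup_i great_hypersphere (u i).

Lemma regionP x : O x <-> sphere R d x /\ forall i, dot x (u i) != 0.
Proof.
split=> [[x1 xO]|[x1 xO]]; split => //.
  by move=> i; apply/eqP => xi; apply: xO; exists i.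
by case=> i _ [/= xi _]; have := xO i; rewrite xi eqxx.
Qed.

Definition open_cell x : set V :=
  [set y | sphere R d y /\ forall i, Num.sg (dot y (u i)) = Num.sg (dot x (u i))].

Definition cell_cone x : set V :=
  [set y | forall i, 0 <= Num.sg (dot x (u i)) * dot y (u i)].

Lemma sg_mul_ge0 (a b : R) : Num.sg a = Num.sg b -> 0 <= Num.sg a * b.
Proof. by move=> ->; rewrite -normrEsg. Qed.

Lemma sg_mul_gt0 (a b : R) : a != 0 -> 0 < Num.sg a * b -> Num.sg b = Num.sg a.
Proof.
move=> a0; case: (ltrgtP a 0) a0 => // a0 _.
  by rewrite (ltr0_sg a0) mulN1r oppr_gt0 => /ltr0_sg.
by rewrite (gtr0_sg a0) mul1r => /gtr0_sg.
Qed.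

Lemma dist_normalize_at x z : x != 0 ->
  enorm (normalize z - normalize x) <= 2 / enorm x * enorm (z - x).
Proof.
move=> x0; have xpos : 0 < enorm x by rewrite enorm_gt0.
have -> : normalize z = normalize ((enorm x)^-1 *: z).
  rewrite /normalize enormZ scalerA gtr0_norm ?invr_gt0// invfM invrK.
  by rewrite mulrAC divff ?mul1r// gt_eqF.
apply: le_trans (dist_normalize _ (normalize_sphere x0)) _.
rewrite /normalize -scalerBr enormZ gtr0_norm ?invr_gt0//.
by rewrite mulrA.
Qed.

Lemma sg_convex (a b t : R) : Num.sg a = Num.sg b -> 0 <= t <= 1 ->
  Num.sg ((1 - t) * a + t * b) = Num.sg a.
Proof.
move=> ab /andP[t0 t1]; have [a0|a0|a0] := ltrgtP a 0.
- have b0 : b < 0 by rewrite -sgr_lt0 -ab sgr_lt0.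
  by rewrite !ltr0_sg//; nra.
- have b0 : 0 < b by rewrite -sgr_gt0 -ab sgr_gt0.
  by rewrite !gtr0_sg//; nra.
- move: ab; rewrite a0 sgr0 => /esym/eqP; rewrite sgr_eq0 => /eqP ->.
  by rewrite !mulr0 addr0 sgr0.
Qed.

(** On a connected subset of the complement each dot product keeps its sign, its image being an
    interval without 0. Conversely, the normalized segment joins two points with the same signs. *)
Lemma connected_component_cell x : O x -> connected_component O x = open_cell x.
Proof.
move=> Ox; have [x1 xg] := (regionP x).1 Ox; apply/seteqP; split => y.
  case=> B [Bx BO cB] By; have /BO/regionP[y1 yg] := By; split => // i.
  have : connected (dot^~ (u i) @` B).
    apply: connected_continuous_connected cB _; apply: continuous_subspaceT.
    exact: dot_continuous.
  move=> /connected_intervalP itv.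
  have no0 : ~ (dot^~ (u i) @` B) 0.
    by case=> z /BO/regionP[_ /(_ i)] /[swap] -> /eqP.
  have [xi yi] : (dot^~ (u i) @` B) (dot x (u i)) /\ (dot^~ (u i) @` B) (dot y (u i)).
    by split; [exists x|exists y].
  have := xg i; have := yg i.
  case: (ltrgtP (dot y (u i)) 0) => // yi0 _; case: (ltrgtP (dot x (u i)) 0) => // xi0 _.
  - by rewrite !ltr0_sg.
  - by exfalso; apply/no0/(itv _ _ yi xi); rewrite !ltW.
  - by exfalso; apply/no0/(itv _ _ xi yi); rewrite !ltW.
  - by rewrite !gtr0_sg.
move=> [y1 yx].
pose f (t : R) := normalize ((1 - t) *: x + t *: y).
have fdot t i : dot ((1 - t) *: x + t *: y) (u i) = (1 - t) * dot x (u i) + t * dot y (u i).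
  by rewrite dotDl !dotZl.
(* The segment misses the origin because its product with the first normal keeps a nonzero sign;
   hence [n0]. *)
have p0 t : 0 <= t <= 1 -> (1 - t) *: x + t *: y != 0.
  move=> t01; apply/eqP => p0; have := fdot t (Ordinal n0); rewrite p0 dot0l.
  move=> /(congr1 Num.sg); rewrite sgr0 sg_convex// => /esym/eqP.
  by rewrite sgr_eq0 (negbTE (xg _)).
have f0 : f 0 = x by rewrite /f subr0 scale0r addr0 scale1r normalize_id.
have f1 : f 1 = y by rewrite /f subrr scale0r add0r scale1r normalize_id.
exists (f @` `[0, 1]); last by exists 1; rewrite //= in_itv /= ler01 lexx.
split.
- by exists 0; rewrite //= in_itv /= ler01 lexx.
- move=> _ [t /= + <-]; rewrite in_itv /= => t01; apply/regionP; split.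
    exact/normalize_sphere/p0.
  move=> i; rewrite dotZl mulf_neq0 ?invr_neq0 ?enorm_eq0 ?p0// fdot.
  by rewrite -sgr_eq0 sg_convex// sgr_eq0.
- apply: connected_continuous_connected; first exact: segment_connected.
  apply: continuous_in_subspaceT => t; rewrite inE /= in_itv /= => t01.
  move=> A /nbhs_eballP[e e0 eA].
  set p := (1 - t) *: x + t *: y in p0 *.
  have e'0 : 0 < e / (2 / enorm p * (1 + enorm (y - x))).
    by rewrite divr_gt0// mulr_gt0 ?divr_gt0 ?enorm_gt0 ?p0 ?ltr_pwDl ?enorm_ge0.
  have : nbhs t (ball t (e / (2 / enorm p * (1 + enorm (y - x))))) by exact: nbhsx_ballx.
  apply: filterS => s /= ts; apply: eA; rewrite enormBC.
  apply: le_lt_trans (dist_normalize_at _ (p0 _ t01)) _.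
  have -> : (1 - s) *: x + s *: y - p = (s - t) *: (y - x).
    by apply/rowP => i; rewrite !mxE; ring.
  rewrite enormZ distrC; move: ts; rewrite -ball_normE /ball_ /= => ts.
  move: ts; rewrite ltr_pdivlMr; last first.
    by rewrite mulr_gt0 ?divr_gt0 ?enorm_gt0 ?p0 ?ltr_pwDl ?enorm_ge0.
  apply: le_lt_trans; rewrite mulrCA ler_wpM2l//.
  by rewrite ler_wpM2l ?divr_ge0 ?enorm_ge0// lerDr.
Qed.

Lemma closure_open_cell x : O x -> closure (open_cell x) = cell_cone x `&` sphere R d.
Proof.
move=> /regionP[x1 xg]; apply/seteqP; split => y.
  move=> yc; split; last first.
    by apply: sphere_closed; apply: closure_subset yc => z [].
  move=> i; rewrite leNgt; apply/negP => yi.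
  have := yc _ (nbhs_eball y (_ : 0 < - (Num.sg (dot x (u i)) * dot y (u i)) / (1 + enorm (u i)))).
  case=> [|z [[_ /(_ i) zi] /=]].
    by rewrite divr_gt0 ?oppr_gt0// ltr_pwDl ?enorm_ge0.
  rewrite ltr_pdivlMr ?ltr_pwDl ?enorm_ge0// mulrDr mulr1 => yz.
  have := dot_lipschitz (u i) z y; rewrite enormBC => le1.
  have le2 : Num.sg (dot x (u i)) * (dot z (u i) - dot y (u i)) <= `|dot z (u i) - dot y (u i)|.
    apply: le_trans (ler_norm _) _; rewrite normrM normr_sg ler_piMl//.
    by case: (_ == _).
  have : 0 <= Num.sg (dot x (u i)) * dot z (u i) by rewrite -zi sg_mul_ge0.
  have := enorm_ge0 (y - z); lra.
move=> [yc y1] A /nbhs_eballP[e e0 eA].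
(* Pushing [y] towards [x] by [t] makes every sign strict; normalizing at most doubles the distance,
   which stays within e / 2. *)
pose t := e / 4; have t0 : 0 < t by rewrite divr_gt0.
have tn i : Num.sg (dot (y + t *: x) (u i)) = Num.sg (dot x (u i)).
  apply: sg_mul_gt0 => //; rewrite dotDl dotZl mulrDr ltr_wpDl//.
  by rewrite mulrCA mulr_gt0// -normrEsg normr_gt0.
have q0 : y + t *: x != 0.
  apply/eqP => q0; have := tn (Ordinal n0); rewrite q0 dot0l sgr0 => /esym/eqP.
  by rewrite sgr_eq0 (negbTE (xg _)).
exists (normalize (y + t *: x)); split.
  split; first exact: normalize_sphere.
  by move=> i; rewrite dotZl sgrM tn gtr0_sg ?mul1r// invr_gt0 enorm_gt0.
apply: eA; rewrite enormBC; apply: le_lt_trans (dist_normalize _ y1) _.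
rewrite addrAC subrr add0r enormZ x1 mulr1 gtr0_norm// /t; lra.
Qed.

Lemma tessellationE : T = [set cell_cone x `&` sphere R d | x in O].
Proof.
by apply: eq_imagel => x Ox; rewrite connected_component_cell// closure_open_cell.
Qed.

Lemma cell_cone_scale x y (a : R) : 0 <= a -> cell_cone x y -> cell_cone x (a *: y).
Proof. by move=> a0 xy i; rewrite dotZl mulrCA mulr_ge0. Qed.

Lemma cone_over_cell x : O x -> cone_over (cell_cone x `&` sphere R d) = cell_cone x.
Proof.
move=> /regionP[x1 _]; apply/seteqP; split => y.
  by move=> [t /= t0 [z [zc _] <-]]; exact: cell_cone_scale.
move=> yc; have [->|y0] := eqVneq y 0.
  exists 0; rewrite /= ?lexx//; exists x; last by rewrite scale0r.
  by split => // i; rewrite -normrEsg.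
exists (enorm y); first exact: enorm_ge0.
exists (normalize y); last exact: normalizeK.
split; last exact: normalize_sphere.
by apply: cell_cone_scale => //; rewrite invr_ge0 enorm_ge0.
Qed.

(** This describes the complement of the hyperspheres by the set of cells alone, so that it can be
    transported along an equality of tessellations. Near a point of a hypersphere both of its sides
    occur, whereas a single cell lies on one side. *)
Lemma region_tessellation y : O y <-> sphere R d y /\ exists2 P, T P &
  exists2 e : R, 0 < e & forall z, sphere R d z -> enorm (y - z) < e -> P z.
Proof.
split=> [Oy|[y1 [P]]].
  have /regionP[y1 yg] := Oy; split => //.
  exists (cell_cone y `&` sphere R d); first by rewrite tessellationE; exists y.
  have [t t0 ht] := sg_perturb (fun i => dot y (u i)) (fun i => enorm (u i)).
  exists t => // z z1 yz; split => // i.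
  have ui : 0 < enorm (u i) by rewrite enorm_gt0.
  have := ht i ((dot z (u i) - dot y (u i)) / enorm (u i)) (yg i).
  rewrite divfK ?gt_eqF// [_ + (_ - _)]addrC subrK => yz_sg.
  apply/sg_mul_ge0/esym/yz_sg.
  rewrite normrM [X in _ * X]gtr0_norm ?invr_gt0// ler_pdivrMr//.
  apply: le_trans (dot_lipschitz _ _ _) _.
  by rewrite ler_wpM2r ?enorm_ge0// enormBC ltW.
rewrite tessellationE => -[x /regionP[x1 xg] <-] [e e0 yP].
apply/regionP; split => // i; apply/eqP => yi.
(* A move of length e / 4 along the normal, away from the cell; at most e / 2 after
   normalization. *)
pose t := e / (4 * enorm (u i)).
have ui : 0 < enorm (u i) by rewrite enorm_gt0.
have t0 : 0 < t by rewrite divr_gt0 ?mulr_gt0.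
pose s := Num.sg (dot x (u i)).
pose q := y - (t * s) *: u i.
have s2 : s * s = 1 by rewrite /s -expr2 sqr_sg xg.
have qi : s * dot q (u i) < 0.
  rewrite dotBl yi sub0r dotZl mulrN oppr_lt0 mulrA mulrCA mulrA -mulrA s2 mulr1.
  by rewrite mulr_gt0// dot_gt0.
have q0 : q != 0 by apply/eqP => q0; move: qi; rewrite q0 dot0l mulr0 ltxx.
have [|c _] := yP (normalize q) (normalize_sphere q0).
  rewrite enormBC; apply: le_lt_trans (dist_normalize _ y1) _.
  rewrite /q addrAC subrr sub0r enormN enormZ normrM normr_sg xg mulr1 (gtr0_norm t0).
  have -> : t * enorm (u i) = e / 4 by rewrite /t; field; rewrite gt_eqF.
  lra.
have := c i; rewrite dotZl mulrCA pmulr_rge0 ?invr_gt0 ?enorm_gt0//.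
by rewrite -/s leNgt qi.
Qed.

End Cells.

(** * Faces, labelled by flats and sign vectors *)

Section Faces.
Context {R : realType} {d n : nat}.
Local Notation V := ('rV[R]_d.+1).
Variable u : 'I_n -> V.
Hypothesis u0 : forall i, u i != 0.
Hypothesis gp : general_position u.
Variable k : nat.
Hypothesis kd : (k < d)%N.
Hypothesis kn : (d - k <= n)%N.
Implicit Types (x y z : V) (I E : {set 'I_n}).

Let T := tessellation (fun i => great_hypersphere (u i)).
Let O := sphere R d `\` \bigcup_i great_hypersphere (u i).

Let n_gt0 : (0 < n)%N. Proof. by lia. Qed.

Definition face_cone I E : set V :=
  [set y | y \in flat u I /\ forall j, j \notin I -> 0 <= sgn_of E j * dot y (u j)].

Definition face_of I E : set V := face_cone I E `&` sphere R d.

(** [I] lists the hyperplanes that contain the face, [E] the others on whose positive side it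
    lies. *)
Definition face_index : {set {set 'I_n} * {set 'I_n}} :=
  finset (fun p : {set 'I_n} * {set 'I_n} =>
    (#|p.1| == (d - k)%N) && (p.2 \in sign_vectors u (flat u p.1) (~: p.1))).

Lemma sgn_of_sgr I E j (a : R) : Num.sg a = sgn_of E j -> 0 < sgn_of E j * a.
Proof.
move=> aE; rewrite -aE -normrEsg normr_gt0 -sgr_eq0 aE; exact: sgn_of_neq0.
Qed.

(** A witness of the sign vector is interior to the cone relative to its flat. Hence the cone spans
    the flat, and a supporting functional that vanishes at the witness vanishes on the flat. *)
Lemma face_cone_perturb I E x z :
    x \in flat u I -> (forall j, j \in ~: I -> Num.sg (dot x (u j)) = sgn_of E j) ->
    z \in flat u I ->
  exists2 e : R, 0 < e & forall s, `|s| <= e -> face_cone I E (x + s *: z).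
Proof.
move=> xI xE zI.
have [e e0 he] := sg_perturb (fun j => dot x (u j)) (fun j => dot z (u j)).
exists e => // s se; split; first by rewrite memvD ?memvZ.
move=> j jI; have xj := xE j; rewrite inE jI in xj.
apply/ltW/sgn_of_sgr => //; rewrite dotDl dotZl he ?xj//.
by rewrite -sgr_eq0 xj// sgn_of_neq0.
Qed.

Lemma face_cone_self I E x : x \in flat u I ->
  (forall j, j \in ~: I -> Num.sg (dot x (u j)) = sgn_of E j) -> face_cone I E x.
Proof.
move=> xI xE; have [e e0 /(_ 0)] := face_cone_perturb xI xE (mem0v _).
by rewrite normr0 scaler0 addr0 => /(_ (ltW e0)).
Qed.

Lemma lin_face_cone I E : E \in sign_vectors u (flat u I) (~: I) ->
  lin (face_cone I E) = [set` flat u I].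
Proof.
move=> /sign_vectorsP[_ [x xI xE]]; apply/seteqP; split => z /=.
  by apply=> y [].
move=> zI U FU; have [e e0 he] := face_cone_perturb xI xE zI.
have xU : x \in U by apply/FU/face_cone_self.
have xzU : x + e *: z \in U by apply/FU/he; rewrite gtr0_norm.
have -> : z = e^-1 *: (x + e *: z - x).
  by rewrite addrAC subrr add0r scalerA mulVf ?scale1r// gt_eqF.
by rewrite memvZ// memvB.
Qed.

Lemma face_cone_scale I E y (a : R) : 0 <= a -> face_cone I E y -> face_cone I E (a *: y).
Proof.
move=> a0 [yI yE]; split; first exact: memvZ.
by move=> j jI; rewrite dotZl mulrCA mulr_ge0// yE.
Qed.

Lemma lin_face_of I E : E \in sign_vectors u (flat u I) (~: I) ->
  lin (face_of I E) = [set` flat u I].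
Proof.
move=> IE; rewrite -(lin_face_cone IE); apply/seteqP; split; first exact: (lin_mono (@subIsetl _ _ _)).
move=> x xF U FU; apply: xF => y yF; have [->|y0] := eqVneq y 0; first exact: mem0v.
rewrite -(normalizeK y); apply/memvZ/FU; split; last exact: normalize_sphere.
by apply: face_cone_scale yF; rewrite invr_ge0 enorm_ge0.
Qed.

Lemma dim_flat_k I : #|I| = (d - k)%N -> \dim (flat u I) = k.+1.
Proof. by move=> Ik; rewrite dim_flat// Ik; lia. Qed.

Lemma flat_neq0 I : #|I| = (d - k)%N -> flat u I != 0%VS.
Proof. by move=> Ik; rewrite -dimv_eq0 dim_flat_k. Qed.

Lemma bigcap_hyperspheres I : I != finset.set0 ->
  \bigcap_(i in [set` I]) great_hypersphere (u i) = [set` flat u I] `&` sphere R d.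
Proof.
move=> /set0Pn[i0 i0I]; apply/seteqP; split => x /=.
  move=> h; have [_ x1] := h i0 i0I; split => //.
  by apply/mem_flat => i /h[].
by move=> [/mem_flat h x1] i /= iI; split => //=; exact: h.
Qed.

(** Let [I] be the hyperplanes containing [G]. The sum [y0] of a spanning family of [G] is off all
    others, so it is a relative interior point. The supporting functional [v] is nonpositive on both
    sides of [y0] along the flat, hence zero on the flat, and [G] is all of the cell cone in the
    flat. *)
Lemma face_in_cell x G : O x -> cone_faces k.+1 (cell_cone u x) G ->
  exists2 p, p \in face_index & G `&` sphere R d = face_of p.1 p.2.
Proof.
move=> /regionP[x1 xg] [[v vC GE] [U Uk linG]].
have [t [tG Gt lint]] := lin_span G.
have Ut : U = <<t>>%VS by apply: vspace_set_inj; rewrite -linG.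
pose I : {set 'I_n} := finset (fun i => U <= orth (u i))%VS.
have UI : (U <= flat u I)%VS.
  by apply/subv_bigcapP => i; rewrite inE.
pose y0 := \sum_(y <- t) y.
have tC y : y \in t -> cell_cone u x y by move=> /tG; rewrite GE => -[].
have y0C j : 0 <= Num.sg (dot x (u j)) * dot y0 (u j).
  rewrite dot_suml mulr_sumr big_seq sumr_ge0// => y /tC; exact.
have y0v : dot v y0 = 0.
  by rewrite dot_sumr big_seq big1// => y /tG; rewrite GE => -[].
have y0I j : j \notin I -> Num.sg (dot y0 (u j)) = Num.sg (dot x (u j)).
  move=> jI; apply: sg_mul_gt0 => //.
  rewrite lt_neqAle y0C andbT eq_sym; apply: contra jI => /eqP y0j.
  rewrite inE Ut; apply/span_subvP => y yt.
  move: y0j; rewrite dot_suml mulr_sumr big_seq => /eqP.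
  rewrite psumr_eq0 => [/allP/(_ _ yt)|z /tC]; last exact.
  by rewrite yt /= mulf_eq0 sgr_eq0 (negbTE (xg j)) mem_orth.
have y0U : y0 \in U by rewrite Ut /y0 big_seq memv_suml// => y; exact: memv_span.
have y0F : y0 \in flat u I by apply/(subvP UI).
pose E : {set 'I_n} := finset (fun j => (j \notin I) && (0 < dot x (u j))).
have sgE j : j \notin I -> Num.sg (dot x (u j)) = sgn_of E j.
  move=> jI; rewrite /sgn_of inE jI /=; case: (ltrgtP (dot x (u j)) 0) (xg j) => // xj _.
    by rewrite ltr0_sg.
  by rewrite gtr0_sg.
have y0E j : j \in ~: I -> Num.sg (dot y0 (u j)) = sgn_of E j.
  by rewrite inE => jI; rewrite y0I// sgE.
have fC y : face_cone I E y -> cell_cone u x y.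
  move=> [/mem_flat yI yE] j; have [jI|jI] := boolP (j \in I).
    by rewrite yI// mulr0.
  by rewrite sgE// yE.
have vI z : z \in flat u I -> dot v z = 0.
  move=> zI; have [e e0 he] := face_cone_perturb y0F y0E zI.
  have := vC _ (fC _ (he e _)); have := vC _ (fC _ (he (- e) _)).
  rewrite normrN gtr0_norm// !dotDr !dotZr y0v !add0r => /(_ (lexx _)) h1 /(_ (lexx _)) h2.
  by apply/eqP; rewrite eq_le; apply/andP; split; nra.
have GF : G = face_cone I E.
  rewrite GE; apply/seteqP; split => y.
    move=> [yC yv]; have yU : y \in U.
      by rewrite Ut; apply: Gt; rewrite GE.
    split; first exact: (subvP UI).
    by move=> j jI; rewrite -sgE//; exact: yC.
  by move=> yF; split; [exact: fC|case: yF => /vI].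
have IE : E \in sign_vectors u (flat u I) (~: I).
  apply/sign_vectorsP; split; last by exists y0.
  by apply/fintype.subsetP => j; rewrite !inE => /andP[].
exists (I, E); last by rewrite GF.
rewrite inE /= IE andbT.
have UF : U = flat u I.
  by apply: vspace_set_inj; rewrite -linG GF lin_face_cone.
have := dim_flat I gp; rewrite -UF Uk => h; apply/eqP.
have aux (c : nat) : k.+1 = (d.+1 - c)%N -> c = (d - k)%N by lia.
exact: aux h.
Qed.

Lemma sign_vectors_nonempty I : (#|I| <= d)%N ->
  exists E, E \in sign_vectors u (flat u I) (~: I).
Proof.
move=> Id; apply/set0Pn; rewrite -card_gt0 card_sign_vectors//.
by case E : (d.+1 - #|I|)%N => [|p]; [lia|exact: chambers_gt0].
Qed.

(** Leaving the flat from an interior point of the face in a generic direction enters a cell. The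
    functional exposing the face is minus the sum over [I] of the normals turned towards that cell:
    its terms have one sign on the cell, so it vanishes only where all of them do. *)
Lemma face_of_cell I E : #|I| = (d - k)%N -> E \in sign_vectors u (flat u I) (~: I) ->
  exists2 x, O x & cone_faces k.+1 (cell_cone u x) (face_cone I E).
Proof.
move=> Ik IE; have /sign_vectorsP[EI [x xI xE]] := IE.
have [E' /sign_vectorsP[_ [w _ wE]]] : exists E', E' \in sign_vectors u (flat u finset.set0) (~: finset.set0).
  by apply: sign_vectors_nonempty; rewrite cards0.
have [e e0 he] := sg_perturb (fun j => dot x (u j)) (fun j => dot w (u j)).
pose q := x + e *: w.
have qI j : j \notin I -> Num.sg (dot q (u j)) = sgn_of E j.
  move=> jI; have xj := xE j; rewrite inE jI in xj.
  rewrite dotDl dotZl he ?xj//; last by rewrite gtr0_norm.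
  by rewrite -sgr_eq0 xj// sgn_of_neq0.
have qn j : dot q (u j) != 0.
  have [jI|jI] := boolP (j \in I); last by rewrite -sgr_eq0 qI// sgn_of_neq0.
  move/mem_flat : xI => /(_ j jI) xj; rewrite dotDl xj add0r dotZl mulf_neq0 ?(gt_eqF e0)//.
  by rewrite -sgr_eq0 wE ?sgn_of_neq0// !inE.
have q0 : q != 0.
  by apply/eqP => q0; have := qn (Ordinal n_gt0); rewrite q0 dot0l eqxx.
pose x' := normalize q.
have x'q j : Num.sg (dot x' (u j)) = Num.sg (dot q (u j)).
  by rewrite dotZl sgrM gtr0_sg ?mul1r// invr_gt0 enorm_gt0.
exists x'.
  apply/regionP; split; first exact: (normalize_sphere q0).
  by move=> j; rewrite -sgr_eq0 x'q sgr_eq0.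
have dotv y : dot (- \sum_(i in I) Num.sg (dot x' (u i)) *: u i) y
    = - \sum_(i in I) Num.sg (dot x' (u i)) * dot y (u i).
  rewrite dotNl dot_suml; congr (- _); apply: eq_bigr => i _.
  by rewrite dotZl (dotC (u i)).
split.
  exists (- \sum_(i in I) Num.sg (dot x' (u i)) *: u i) => [y yC|].
    by rewrite dotv oppr_le0 sumr_ge0.
  apply/seteqP; split => y.
    move=> [yI yE]; split; last first.
      by rewrite /= dotv big1 ?oppr0// => i iI; move/mem_flat : yI => ->; rewrite ?mulr0.
    move=> j; have [jI|jI] := boolP (j \in I).
      by move/mem_flat : yI => ->//; rewrite mulr0.
    by rewrite x'q qI//; exact: yE.
  move=> [yC /= /eqP]; rewrite dotv oppr_eq0 psumr_eq0// => /allP h; split.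
    apply/mem_flat => i iI; have := h i (mem_index_enum i); rewrite iI /=.
    by rewrite mulf_eq0 x'q sgr_eq0 (negbTE (qn i)) => /eqP.
  by move=> j jI; rewrite -qI// -x'q.
by exists (flat u I); [exact: dim_flat_k|exact: lin_face_cone].
Qed.

Lemma tess_facesE : tess_faces k T = [set face_of p.1 p.2 | p in [set` face_index]].
Proof.
apply/seteqP; split => F.
  move=> [P]; rewrite /T tessellationE// => -[x Ox <-] [G].
  rewrite cone_over_cell// => /(face_in_cell Ox)[p pI GF] <-.
  by exists p => //; rewrite -GF.
move=> [[I E] /= + <-]; rewrite inE => /andP[/= /eqP Ik IE].
have [x Ox xF] := face_of_cell Ik IE.
exists (cell_cone u x `&` sphere R d); first by rewrite /T tessellationE//; exists x.
by exists (face_cone I E) => //; rewrite cone_over_cell.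
Qed.

Lemma face_indexP I E :
  (I, E) \in face_index -> #|I| = (d - k)%N /\ E \in sign_vectors u (flat u I) (~: I).
Proof. by rewrite inE => /andP[/eqP]. Qed.

(** The linear hull recovers [I], and a relative interior point has strict signs that recover
    [E]. *)
Lemma face_of_inj (p q : {set 'I_n} * {set 'I_n}) : p \in face_index -> q \in face_index ->
  face_of p.1 p.2 = face_of q.1 q.2 -> p = q.
Proof.
case: p => I E; case: q => I' E' /face_indexP[Ik IE] /face_indexP[Ik' IE'] /= FF.
have II : I = I'.
  apply: (flat_inj gp (flat_neq0 Ik)); apply: vspace_set_inj.
  by rewrite -(lin_face_of IE) FF lin_face_of.
move: Ik' IE' FF; rewrite -II => Ik' IE' FF; congr (_, _).
have /sign_vectorsP[EI [x xI xE]] := IE; have /sign_vectorsP[EI' _] := IE'.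
apply/setP => j; have [jI|jI] := boolP (j \in I).
  have nE (F : {set 'I_n}) : F \subset ~: I -> (j \in F) = false.
    by move=> FI; apply/negP => /(fintype.subsetP FI); rewrite inE jI.
  by rewrite !nE.
have xj := xE j; rewrite inE jI in xj.
have x0 : x != 0.
  by apply/eqP => x0; move: (xj isT) => /esym/eqP; rewrite x0 dot0l sgr0 (negbTE (sgn_of_neq0 _ _)).
have : face_of I E (normalize x).
  split; last exact: normalize_sphere.
  by apply: face_cone_scale (face_cone_self xI xE); rewrite invr_ge0 enorm_ge0.
rewrite FF => -[[_ /(_ j jI)] + _].
rewrite dotZl mulrCA pmulr_rge0 ?invr_gt0 ?enorm_gt0//.
have := sgn_of_sgr I (xj isT); rewrite /sgn_of.
by case: (j \in E); case: (j \in E') => // h1 h2; exfalso; move: h1 h2; lra.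
Qed.

Lemma direction_face_of I E : #|I| = (d - k)%N -> E \in sign_vectors u (flat u I) (~: I) ->
  direction (face_of I E) = \bigcap_(i in [set` I]) great_hypersphere (u i).
Proof.
move=> Ik IE; rewrite bigcap_hyperspheres; last by rewrite -card_gt0 Ik subn_gt0.
by rewrite /direction lin_face_of.
Qed.

Lemma face_of_compact I E : #|I| = (d - k)%N -> E \in sign_vectors u (flat u I) (~: I) ->
  sphere_compacts (face_of I E).
Proof.
move=> Ik IE; split; last exact: subIsetr.
- have [y yF y0] : exists2 y, face_cone I E y & y != 0.
    apply: contrapT => nF; have := flat_neq0 Ik; rewrite -subv0 => /negP; apply.
    apply/subvP => x; rewrite -/([set` flat u I] x) -(lin_face_cone IE) => /(_ 0%VS); apply.
    move=> y yF /=; rewrite memv0; apply/negPn/negP => y0; by apply: nF; exists y.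
  exists (normalize y); split; last exact: normalize_sphere.
  by apply: face_cone_scale yF; rewrite invr_ge0 enorm_ge0.
apply: subclosed_compact sphere_compact _; last exact: subIsetr.
apply: closedI; last exact: sphere_closed.
have -> : face_cone I E = (\bigcap_(i in [set` I]) ((dot^~ (u i)) @^-1` [set z | z = 0])) `&`
  (\bigcap_(j in [set` ~: I]) ((fun y => dot y (sgn_of E j *: u j)) @^-1` [set z | 0 <= z])).
  apply/seteqP; split => y.
    move=> [/mem_flat yI yE]; split => j /=; first exact: yI.
    by rewrite dotZr inE => /yE.
  move=> [yI yE]; split; first by apply/mem_flat => i /yI.
  by move=> j jI; have := yE j; rewrite /= inE dotZr; exact.
apply: closedI; apply: closed_bigI => i _.
  apply: preimage_closed; last exact: closed_eq.
  by move=> x _; exact: dot_continuous.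
apply: preimage_closed; last exact: closed_ge.
by move=> x _; exact: dot_continuous.
Qed.

(** A point of the flat may lie on further hyperplanes. A generic perturbation inside the flat
    removes these zeros without changing the nonzero signs, and selects a closed face containing the
    point. *)
Lemma skelE : skel k T = \bigcup_(I in [set I : {set 'I_n} | #|I| = (d - k)%N])
  \bigcap_(i in [set` I]) great_hypersphere (u i).
Proof.
rewrite /skel tess_facesE; apply/seteqP; split => x.
  move=> [_ [[I E] /= + <-]]; rewrite inE => /andP[/= /eqP Ik IE] [[xI _] x1].
  exists I => //; rewrite bigcap_hyperspheres//.
  by rewrite -card_gt0 Ik subn_gt0.
move=> [I /= Ik]; rewrite bigcap_hyperspheres; last by rewrite -card_gt0 Ik subn_gt0.
move=> [xI x1].
have [|E0 /sign_vectorsP[_ [w wI wE]]] := @sign_vectors_nonempty I; first by rewrite Ik leq_subr.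
have [e e0 he] := sg_perturb (fun j => dot x (u j)) (fun j => dot w (u j)).
pose y := x + e *: w.
have yn j : j \notin I -> dot y (u j) != 0 /\ 0 <= Num.sg (dot y (u j)) * dot x (u j).
  move=> jI; rewrite dotDl dotZl; have [xj|xj] := eqVneq (dot x (u j)) 0.
    rewrite xj mulr0 add0r mulf_neq0 ?(gt_eqF e0)//.
    by rewrite -sgr_eq0 wE ?sgn_of_neq0// inE.
  by rewrite -sgr_eq0 he ?sgr_eq0// ?gtr0_norm// -normrEsg.
pose E : {set 'I_n} := finset (fun j => (j \notin I) && (0 < dot y (u j))).
have yE j : j \notin I -> Num.sg (dot y (u j)) = sgn_of E j.
  move=> jI; have [yj _] := yn j jI; rewrite /sgn_of inE jI /=.
  by case: (ltrgtP (dot y (u j)) 0) yj => // h _; [rewrite ltr0_sg|rewrite gtr0_sg].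
exists (face_of I E).
  exists (I, E) => //=; rewrite inE /= Ik eqxx /=; apply/sign_vectorsP; split.
    by apply/fintype.subsetP => j; rewrite !inE => /andP[].
  exists y; first by rewrite memvD// memvZ.
  by move=> j; rewrite inE; exact: yE.
split => //; split => // j jI; rewrite -yE//; exact: (yn j jI).2.
Qed.

End Faces.

(** * Counting the faces with direction in a given set *)

Section CountingFaces.
Context {R : realType} {d n : nat}.
Local Notation V := ('rV[R]_d.+1).
Variable u : 'I_n -> V.
Hypothesis u0 : forall i, u i != 0.
Hypothesis gp : general_position u.
Variable k : nat.
Hypothesis kd : (k < d)%N.
Hypothesis kn : (d - k <= n)%N.
Implicit Types (I E : {set 'I_n}).

Let T := tessellation (fun i => great_hypersphere (u i)).

Lemma counting_image (I : finType) (X : choiceType) (f : I -> X) (Y : {set I}) :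
  {in Y &, injective f} -> counting (f @` [set` Y]) = #|Y|%:R%:E :> \bar R.
Proof.
move=> finj; pose s := [seq f x | x <- enum Y].
have us : uniq s.
  rewrite map_inj_in_uniq ?enum_uniq// => x y; rewrite !mem_enum; exact: finj.
have -> : f @` [set` Y] = [set` [fset x in s]%fset].
  apply/seteqP; split => y /=.
    by move=> [x xY <-]; rewrite inE map_f// mem_enum.
  by rewrite inE => /mapP[x]; rewrite mem_enum => xY ->; exists x.
rewrite /counting asboolT; last exact: finite_fset.
by rewrite set_fsetK card_fseq undup_id// size_map -cardE.
Qed.

(** The fibre over [I] has the same size for every [I]: n - (d - k) hyperplanes remain, in a flat of
    dimension k + 1. *)
Lemma card_face_index (Q : pred {set 'I_n}) :
  #|finset (fun p => (p \in face_index u k) && Q p.1)| =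
  (chambers (n - (d - k)) k.+1 * #|finset (fun I : {set 'I_n} => (#|I| == (d - k)%N) && Q I)|)%N.
Proof.
rewrite -sum1_card mulnC -sum_nat_const.
rewrite [RHS](eq_bigr (fun I => \sum_(E in sign_vectors u (flat u I) (~: I)) 1)%N); last first.
  move=> I; rewrite inE => /andP[/eqP Ik _].
  rewrite sum1_card card_sign_vectors//.
  rewrite cardsCs finset.setCK card_ord Ik.
  by congr chambers; lia.
rewrite pair_big_dep /=; apply: eq_bigl => -[I E].
by rewrite [in LHS]inE [X in X && _]inE [in RHS]inE /= andbAC.
Qed.

(** [sphere_compacts F] is part of the event because the Borel sets of random faces are subfamilies
    of [sphere_compacts]. *)
Lemma counting_faces (C : set (set V)) :
  counting (tess_faces k T `&` [set F | sphere_compacts F /\ C (direction F)]) =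
  (chambers (n - (d - k)) k.+1 * #|finset (fun I : {set 'I_n} => (#|I| == (d - k)%N) &&
    `[< C (\bigcap_(i in [set` I]) great_hypersphere (u i)) >])|)%:R%:E :> \bar R.
Proof.
rewrite -(card_face_index (fun I => `[< C (\bigcap_(i in [set` I]) great_hypersphere (u i)) >])).
rewrite -(counting_image (f := fun p : {set 'I_n} * {set 'I_n} => face_of u p.1 p.2)).
  congr counting; rewrite /T tess_facesE//; apply/seteqP; split => F.
    move=> [[[I E] /= IE <-] [_ CF]]; exists (I, E) => //=; rewrite inE IE /=.
    have [Ik sE] := face_indexP IE.
    by apply/asboolP; rewrite -(direction_face_of kd Ik sE).
  move=> [[I E] /=]; rewrite inE => /andP[IE /asboolP /= CI] <-.
  have [Ik sE] := face_indexP IE.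
  split; first by exists (I, E).
  by split; [exact: (face_of_compact gp kd kn Ik sE)|rewrite (direction_face_of kd Ik sE)].
by move=> p q; rewrite inE => /andP[pI _]; rewrite inE => /andP[qI _]; exact: (face_of_inj gp kd kn pI qI).
Qed.

End CountingFaces.

(** * Recovering hyperspheres and flats from the tessellation *)

Section Determination.
Context {R : realType} {d n : nat}.
Local Notation V := ('rV[R]_d.+1).
Implicit Types (x y z v : V) (I : {set 'I_n}) (U : {vspace V}).

(** A subspace is not a finite union of proper subspaces: zeros are removed one hyperplane at a
    time, by steps too small to create new ones. *)
Lemma avoid_hyperplanes (u : 'I_n -> V) U :
  (forall i, ~~ (U <= orth (u i))%VS) ->
  exists2 x, x \in U & forall i, dot x (u i) != 0.
Proof.
move=> Uu; suff [x xU xs] : exists2 x, x \in U & forall i, i \in enum 'I_n -> dot x (u i) != 0.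
  by exists x => // i; apply: xs; rewrite mem_enum.
elim: (enum 'I_n) => [|i s [x xU xs]]; first by exists 0; rewrite ?mem0v.
have /subvPn[y yU] := Uu i; rewrite mem_orth => yi.
have [e e0 he] := sg_perturb (fun i => dot x (u i)) (fun i => dot y (u i)).
have [xi|xi] := eqVneq (dot x (u i)) 0; last first.
  by exists x => // j; rewrite inE => /predU1P[->//|]; exact: xs.
exists (x + e *: y); first by rewrite memvD// memvZ.
move=> j; rewrite inE => /predU1P[->|js]; rewrite dotDl dotZl.
  by rewrite xi add0r mulf_neq0// (gt_eqF e0).
by rewrite -sgr_eq0 he ?sgr_eq0 ?xs// gtr0_norm.
Qed.

Lemma hypersphere_sub_bigcup (u : 'I_n -> V) v : v != 0 -> (forall i, u i != 0) ->
  great_hypersphere v `<=` \bigcup_i great_hypersphere (u i) ->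
  (0 < n)%N ->
  exists i, great_hypersphere v = great_hypersphere (u i).
Proof.
move=> v0 u0 vu n0; apply: contrapT => nv.
have [|x xv xu] := @avoid_hyperplanes u (orth v).
  move=> i; apply/negP => vi; apply: nv; exists i.
  have vui : orth v = orth (u i) by apply/eqP; rewrite eqEdim vi (dim_orth v0) (dim_orth (u0 i)) leqnn.
  by apply/seteqP; split => x [/= /eqP xv x1]; split => //; apply/eqP;
    move: xv; rewrite -!mem_orth vui.
have x0 : x != 0 by apply/eqP => x0; have := xu (Ordinal n0); rewrite x0 dot0l eqxx.
have [|i _ [/= + _]] := vu (normalize x).
  split; last exact: normalize_sphere.
  by move: xv; rewrite mem_orth => /eqP xv; rewrite /mkset dotZl xv mulr0.
by apply/eqP; rewrite dotZl mulf_neq0// invr_neq0// enorm_eq0.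
Qed.

Lemma tessellation_determines_union (u v : 'I_n -> V) :
  (forall i, u i != 0) -> (forall i, v i != 0) -> (0 < n)%N ->
  tessellation (fun i => great_hypersphere (u i)) =
    tessellation (fun i => great_hypersphere (v i)) ->
  \bigcup_i great_hypersphere (u i) = \bigcup_i great_hypersphere (v i).
Proof.
have sub (a b : 'I_n -> V) : (forall i, a i != 0) -> (forall i, b i != 0) -> (0 < n)%N ->
  tessellation (fun i => great_hypersphere (a i)) =
    tessellation (fun i => great_hypersphere (b i)) ->
  \bigcup_i great_hypersphere (a i) `<=` \bigcup_i great_hypersphere (b i).
  move=> a0 b0 n0 ab x [i _ ax]; apply: contrapT => bx; have [_ x1] := ax.
  have : (sphere R d `\` \bigcup_i great_hypersphere (b i)) x by [].
  move/(region_tessellation b0 n0); rewrite -ab => /(region_tessellation a0 n0)[_].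
  by apply; exists i.
by move=> u0 v0 n0 uv; apply/seteqP; split; apply: sub.
Qed.

(** Events of this form are thus determined by [T], as [conditional_distribution] demands. Passing
    from [u] to [v] may identify indices and make the index set too small; but fewer than d - k
    hyperspheres meet in dimension greater than k, which [N] excludes. *)
Lemma tessellation_determines_flats (k : nat) (N : set (set V)) (u v : 'I_n -> V) :
  (k < d)%N -> (0 < n)%N -> N `<=` great_subspheres R d k ->
  (forall i, u i != 0) -> (forall i, v i != 0) ->
  tessellation (fun i => great_hypersphere (u i)) =
    tessellation (fun i => great_hypersphere (v i)) ->
  (exists2 I : {set 'I_n}, #|I| = (d - k)%N & N (\bigcap_(i in [set` I]) great_hypersphere (u i))) ->
  exists2 I : {set 'I_n}, #|I| = (d - k)%N & N (\bigcap_(i in [set` I]) great_hypersphere (v i)).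
Proof.
move=> kd n0 NG u0 v0 uv [I Ik NI].
have fP i : exists j, great_hypersphere (u i) = great_hypersphere (v j).
  apply: hypersphere_sub_bigcup => //.
  rewrite -(tessellation_determines_union u0 v0 n0 uv); by move=> x ux; exists i.
pose f i := projT1 (cid (fP i)).
have fE i : great_hypersphere (u i) = great_hypersphere (v (f i)) by exact: projT2 (cid (fP i)).
have IE : \bigcap_(i in [set` I]) great_hypersphere (u i) =
          \bigcap_(i in [set` f @: I]) great_hypersphere (v i).
  apply/seteqP; split => x h i /=.
    by move=> /imsetP[j jI ->]; rewrite -fE; exact: h.
  by move=> iI; rewrite fE; apply: h => /=; exact: imset_f.
exists (f @: I); last by rewrite -IE.
have I0 : f @: I != finset.set0.
  by rewrite imset_eq0 -card_gt0 Ik subn_gt0.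
apply/eqP; rewrite eqn_leq -{1}Ik leq_imset_card /=.
have := NG _ NI; rewrite IE bigcap_hyperspheres// => -[U /= Uk /sphere_inj UF].
have aux (c : nat) : (d.+1 - c <= k.+1)%N -> (d - k <= c)%N by lia.
by apply: aux; rewrite -Uk UF; exact: dim_flat_ge.
Qed.

End Determination.

(** * Hausdorff measure of the skeleton *)

Section Hausdorff.
Context {R : realType} {d : nat}.
Local Notation V := ('rV[R]_d.+1).
Variable k : nat.
Local Open Scope ereal_scope.
Implicit Types (A B : set V) (x y : V).

Local Notation H := (@hausdorff_measure R d k).
Local Notation PM := (@hausdorff_premeasure R d k).

Lemma ediam_ge A x y : A x -> A y -> (enorm (x - y))%:E <= ediam A.
Proof. by move=> Ax Ay; apply: ereal_sup_ubound; exists (x, y). Qed.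

Lemma ediam_le A (M : \bar R) :
  (forall x y, A x -> A y -> (enorm (x - y))%:E <= M) -> ediam A <= M.
Proof. by move=> AM; apply: ge_ereal_sup => _ [[x y] [/= Ax Ay] <-]; exact: AM. Qed.

Lemma ediam_ge0 A : A !=set0 -> 0 <= ediam A.
Proof.
by move=> [x Ax]; apply: le_trans (ediam_ge Ax Ax); rewrite lee_fin enorm_ge0.
Qed.

Lemma expe_le (a b : \bar R) m : 0 <= a -> a <= b -> a ^+ m <= b ^+ m.
Proof.
move=> a0 ab; elim: m => [|m IH]; first by rewrite !expe0.
by rewrite !expeS lee_pmul// expe_ge0.
Qed.

Lemma hgauge_ge0 A : 0 <= hgauge k A.
Proof.
rewrite /hgauge; case: eqVneq => // /set0P A0.
by rewrite expe_ge0// ediam_ge0.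
Qed.

Lemma hgauge0 : hgauge k (set0 : set V) = 0.
Proof. by rewrite /hgauge eqxx. Qed.

Lemma hgauge_le A B : (B = set0 -> A = set0) -> ediam A <= ediam B ->
  hgauge k A <= hgauge k B.
Proof.
move=> BA AB; rewrite /hgauge; case: (eqVneq A set0) => [_|A0].
  exact: hgauge_ge0.
case: (eqVneq B set0) => [/BA A00|_]; first by rewrite A00 eqxx in A0.
by apply: expe_le => //; apply/ediam_ge0/set0P.
Qed.

Lemma ediam_sub A B : A `<=` B -> ediam A <= ediam B.
Proof. by move=> AB; apply: ediam_le => x y /AB Ax /AB; exact: ediam_ge. Qed.

Lemma hgauge_sub A B : A `<=` B -> hgauge k A <= hgauge k B.
Proof.
move=> AB; apply: hgauge_le; last exact: ediam_sub.
by move=> B0; apply/seteqP; split => // x /AB; rewrite B0.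
Qed.

Let allsets := g_sigma_algebraType [set: set V].

(** Infinite values on large sets turn the restriction on diameters into a gauge, so that the
    premeasure is an outer measure [mu_ext]; [allsets] makes arbitrary sets admissible in covers. *)
Definition cut_gauge (e : R) (A : set allsets) : \bar R :=
  if ediam (A : set V) <= e%:E then hgauge k (A : set V) else +oo.

Let measurable_all (A : set allsets) : measurable A.
Proof. exact: sub_sigma_algebra. Qed.

Lemma cut_gauge_ge0 e A : 0 <= cut_gauge e A.
Proof. by rewrite /cut_gauge; case: ifP => // _; exact: hgauge_ge0. Qed.

Lemma premeasureE e : PM e = mu_ext (cut_gauge e).
Proof.
apply/funext => A; apply/eqP; rewrite eq_le; apply/andP; split.
  apply: le_ereal_inf_tmp => _ [F [_ AF] <-].
  have [Fe|] := pselect (forall i, ediam (F i : set V) <= e%:E).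
    apply: ereal_inf_lbound; exists F => //.
    by apply: eq_eseriesr => i _; rewrite /cut_gauge Fe.
  move=> /existsNP[i Fi].
  have ioo : cut_gauge e (F i) = +oo by rewrite /cut_gauge; case: ifPn.
  rewrite (eseries_pinfty _ _ ioo) ?leey// => j _.
  by rewrite -ltNye (lt_le_trans _ (cut_gauge_ge0 _ _)).
apply: le_ereal_inf_tmp => _ [F [AF Fe] <-].
apply: ereal_inf_lbound; exists F; first by split.
by apply: eq_eseriesr => i _; rewrite /cut_gauge Fe.
Qed.

Lemma premeasure_antitone e f A : (e <= f)%R -> PM f A <= PM e A.
Proof.
move=> ef; apply: le_ereal_inf_tmp => _ [F [AF Fe] <-].
apply: ereal_inf_lbound; exists F => //; split => // i.
by apply: le_trans (Fe i) _; rewrite lee_fin.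
Qed.

Lemma premeasure_le_hausdorff e A : (0 < e)%R -> PM e A <= H A.
Proof. by move=> e0; apply: ereal_sup_ubound; exists e. Qed.

Lemma hausdorff_le A (M : \bar R) : (forall e, (0 < e)%R -> PM e A <= M) -> H A <= M.
Proof. by move=> AM; apply: ge_ereal_sup => _ [e /= e0 <-]; exact: AM. Qed.

Lemma premeasure_ge0 e A : 0 <= PM e A.
Proof. by rewrite premeasureE; apply: mu_ext_ge0 => B; exact: cut_gauge_ge0. Qed.

Lemma hausdorff_ge0 A : 0 <= H A.
Proof. exact: le_trans (premeasure_ge0 1 A) (premeasure_le_hausdorff _ ltr01). Qed.

Lemma cut_gauge0 e : cut_gauge e set0 = 0.
Proof.
rewrite /cut_gauge hgauge0; case: ifPn => // /negP[].
by apply: ediam_le => x y.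
Qed.

Lemma hausdorff0 : H set0 = 0.
Proof.
apply/eqP; rewrite eq_le hausdorff_ge0 andbT; apply: hausdorff_le => e _.
by rewrite premeasureE mu_ext0//; [exact: cut_gauge0|move=> B; exact: cut_gauge_ge0].
Qed.

Lemma hausdorff_sub : {homo H : A B / A `<=` B >-> A <= B}.
Proof.
move=> A B AB; apply: hausdorff_le => e e0.
apply: le_trans (premeasure_le_hausdorff B e0).
by rewrite premeasureE; exact: le_mu_ext.
Qed.

Lemma hausdorff_sigma_subadditive : sigma_subadditive H.
Proof.
move=> F; apply: hausdorff_le => e e0.
rewrite premeasureE; apply: le_trans (mu_ext_sigma_subadditive _ _) _.
  by move=> B; exact: cut_gauge_ge0.
rewrite -premeasureE; apply: lee_nneseries => i *; first exact: premeasure_ge0.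
exact: premeasure_le_hausdorff.
Qed.

HB.instance Definition _ := isOuterMeasure.Build R V (hausdorff_measure k)
  hausdorff0 hausdorff_ge0 hausdorff_sub hausdorff_sigma_subadditive.

Lemma hausdorff_lipschitz (f : V -> V) A :
  (forall x y, A x -> A y -> (enorm (f x - f y) <= enorm (x - y))%R) ->
  H (f @` A) <= H A.
Proof.
move=> fA; apply: hausdorff_le => e e0.
apply: le_trans (premeasure_le_hausdorff A e0).
apply: le_ereal_inf_tmp => _ [F [AF Fe] <-].
have FE i : ediam (f @` (F i `&` A)) <= ediam (F i).
  apply: ediam_le => _ _ [x [Fx Ax] <-] [y [Fy Ay] <-].
  by apply: le_trans (ediam_ge Fx Fy); rewrite lee_fin fA.
apply: le_trans (_ : \sum_(0 <= i <oo) hgauge k (f @` (F i `&` A)) <= _).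
  apply: ereal_inf_lbound; exists (fun i => f @` (F i `&` A)) => //; split.
    by move=> _ [x Ax <-]; have [i _ Fx] := AF _ Ax; exists i => //; exists x.
  by move=> i; exact: le_trans (FE i) (Fe i).
apply: lee_nneseries => i *; first exact: hgauge_ge0.
by apply: hgauge_le (FE i) => ->; rewrite set0I image_set0.
Qed.

(** A set of diameter below [r] cannot meet both [A] and [B], so a fine cover of the union splits in
    two. Refining both meshes to a common one lets the two suprema be taken separately. *)
Lemma hausdorff_separated A B (r : R) : (0 < r)%R ->
  (forall x y, A x -> B y -> (r <= enorm (x - y))%R) ->
  H A + H B <= H (A `|` B).
Proof.
move=> r0 AB.
have sep e : (0 < e)%R -> (e < r)%R -> PM e A + PM e B <= PM e (A `|` B).
  move=> e0 er; apply: le_ereal_inf_tmp => _ [F [ABF Fe] <-].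
  apply: (@le_trans _ _ (\sum_(0 <= i <oo) hgauge k (F i `&` A) +
                         \sum_(0 <= i <oo) hgauge k (F i `&` B))).
    apply: leeD; apply: ereal_inf_lbound; (eexists; last reflexivity); split.
    - by move=> x Ax; have [i _ Fx] := ABF x (or_introl Ax); exists i.
    - by move=> i; apply: le_trans (Fe i); apply: ediam_sub; exact: subIsetl.
    - by move=> x Bx; have [i _ Fx] := ABF x (or_intror Bx); exists i.
    - by move=> i; apply: le_trans (Fe i); apply: ediam_sub; exact: subIsetl.
  rewrite -nneseriesD; [|by move=> i *; exact: hgauge_ge0..].
  apply: lee_nneseries => i *; first by rewrite adde_ge0// hgauge_ge0.
  have [[x [Fx Ax]]|] := pselect (F i `&` A !=set0).
    suff -> : F i `&` B = set0.
      by rewrite hgauge0 adde0; apply: hgauge_sub; exact: subIsetl.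
    rewrite -subset0 => y [Fy By]; have := AB _ _ Ax By; rewrite leNgt => /negP; apply.
    by rewrite -lte_fin; apply: le_lt_trans (ediam_ge Fx Fy) (le_lt_trans (Fe i) _).
  move=> /set0P/negP/negPn/eqP ->.
  by rewrite hgauge0 add0e; apply: hgauge_sub; exact: subIsetl.
have main e f : (0 < e)%R -> (0 < f)%R -> PM e A + PM f B <= H (A `|` B).
  move=> e0 f0; pose m := (Num.min (Num.min e f) (r / 2))%R.
  have m0 : (0 < m)%R by rewrite !lt_min e0 f0 divr_gt0.
  apply: le_trans (premeasure_le_hausdorff _ m0).
  apply: le_trans (sep _ m0 _); last by rewrite gt_min; apply/orP; right; lra.
  by apply: leeD; apply: premeasure_antitone; rewrite !ge_min lexx ?orbT.
have [->|Hoo] := eqVneq (H (A `|` B)) +oo; first by rewrite leey.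
have fin (X : \bar R) : 0 <= X -> X <= H (A `|` B) -> X \is a fin_num.
  move=> X0 XH; rewrite ge0_fin_numE//; apply: le_lt_trans XH _; by rewrite ltey.
have HA : H A \is a fin_num.
  by apply: fin; [exact: hausdorff_ge0|exact/hausdorff_sub/subsetUl].
have HA' f : (0 < f)%R -> H A + PM f B <= H (A `|` B).
  move=> f0; have Bf : PM f B \is a fin_num.
    apply: fin; first exact: premeasure_ge0.
    apply: le_trans (premeasure_le_hausdorff _ f0) _.
    exact/hausdorff_sub/subsetUr.
  rewrite -leeBrDr//; apply: hausdorff_le => e e0; rewrite leeBrDr//; exact: main.
rewrite addeC -leeBrDr//; apply: hausdorff_le => f f0.
by rewrite leeBrDr// addeC; exact: HA'.
Qed.

(* The standard annuli argument, in telescoped form: the annulus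
   [1/(j+3) <= f < 1/(j+2)] is separated from [1/(j+1) <= f], so that its
   measure is at most [b (j+2) - b j] with [b j] the measure of
   [1/(j+1) <= f]. *)
Lemma caratheodory_sublevel (f : V -> R) (M : R) : (0 < M)%R ->
  (forall x y, (`|f x - f y| <= M * enorm (x - y))%R) ->
  H.-caratheodory [set x | (f x <= 0)%R].
Proof.
move=> M0 fM; apply: le_caratheodory_measurable => X.
set F := [set x | (f x <= 0)%R].
have [Xoo|Xoo] := eqVneq (H X) +oo; first by move: (leey (H (X `&` F) + H (X `&` ~` F))); rewrite -Xoo.
have fin A : A `<=` X -> H A \is a fin_num.
  move=> AX; rewrite ge0_fin_numE ?hausdorff_ge0//.
  by apply: le_lt_trans (hausdorff_sub AX) _; rewrite ltey.
have sep A B (a b : R) : (b < a)%R -> (forall x, A x -> (a <= f x)%R) ->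
    (forall x, B x -> (f x <= b)%R) -> H A + H B <= H (A `|` B).
  move=> ba Aa Bb; apply: (@hausdorff_separated _ _ ((a - b) / M)).
    by rewrite divr_gt0// subr_gt0.
  move=> x y /Aa ax /Bb yb; rewrite ler_pdivrMr// mulrC.
  by apply: le_trans (fM x y); apply: le_trans (ler_norm _); lra.
pose r (j : nat) : R := (j.+1%:R^-1)%R.
have r_lt j : (r j.+1 < r j)%R by rewrite ltf_pV2 ?posrE// ltr_nat.
have r_gt0 j : (0 < r j)%R by rewrite invr_gt0.
pose B j := X `&` [set x | (r j <= f x)%R].
pose A j := X `&` [set x | (r j.+1 <= f x < r j)%R].
pose b j := fine (H (B j)).
have BX j : B j `<=` X by exact: subIsetl.
have AX j : A j `<=` X by exact: subIsetl.
have bE j : H (B j) = (b j)%:E by rewrite fineK// fin.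
have FB j : H (X `&` F) + H (B j) <= H X.
  rewrite addeC; apply: le_trans (sep _ _ (r j) 0%R _ _ _) _ => //.
  - by move=> x [].
  - by move=> x [].
  - by apply: hausdorff_sub => x [[]|[]].
pose beta := (fine (H X) - fine (H (X `&` F)))%R.
have b_le j : (b j <= beta)%R.
  rewrite /beta lerBrDl -lee_fin EFinD -bE !fineK ?fin//; exact: subIsetl.
have b_mono j : (b j <= b j.+1)%R.
  rewrite -lee_fin -!bE; apply: hausdorff_sub => x [Xx /= rx]; split => //=.
  exact: le_trans (ltW (r_lt j)) rx.
have A_le j : H (A j.+1) <= (b j.+2 - b j)%:E.
  rewrite EFinB leeBrDr// -!bE addeC.
  apply: le_trans (sep _ _ (r j) (r j.+1) _ _ _) _ => //.
  - by move=> x [].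
  - by move=> x [_ /andP[_ /ltW]].
  - apply: hausdorff_sub => x [[Xx /= rx]|[Xx /andP[rx _]]]; split => //=.
    by apply: le_trans rx; apply/ltW; apply: lt_trans (r_lt j).
have supb : has_sup (range b).
  by split; [exists (b 0%N), 0%N|exists beta => _ [j _ <-]].
pose s := sup (range b).
have b_sup j : (b j <= s)%R by apply: sup_upper_bound => //; exists j.
have key : H (X `&` ~` F) <= s%:E.
  apply/lee_addgt0Pr => e e0.
  have e2 : (0 < e / 2)%R by rewrite divr_gt0.
  have [_ [m _ <-] bm] := sup_adherent e2 supb; rewrite -/s in bm.
  have sub : X `&` ~` F `<=` B m.+1 `|` \bigcup_j A (m.+1 + j)%N.
    move=> x [Xx /= /negP]; rewrite -ltNge => fx.
    have [rx|rx] := lerP (r m.+1) (f x); first by left.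
    right; have [N fN] : exists N, (r (m.+1 + N)%N <= f x)%R.
      have [N] := ltr_add_invr (y := 0%R) (x := f x) fx.
      rewrite add0r => Nf; exists N; apply/ltW; apply: le_lt_trans Nf.
      by rewrite lef_pV2 ?posrE// ler_nat ltnS leq_addl.
    elim: N fN => [|N IH] fN; first by rewrite addn0 leNgt rx in fN.
    have [fN'|fN'] := lerP (r (m.+1 + N)%N) (f x); first exact: IH.
    by exists N => //; split => //=; rewrite -addnS fN.
  apply: le_trans (hausdorff_sub sub) _.
  apply: (@le_trans _ _ (H (B m.+1) + H (\bigcup_j A (m.+1 + j)%N))).
    exact: outer_measureU2.
  rewrite bE leeD ?lee_fin//.
  apply: le_trans (hausdorff_sigma_subadditive _) _.
  apply: lime_le; first by apply: is_cvg_nneseries => *; exact: hausdorff_ge0.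
  apply: nearW => N.
  (* Telescoping leaves the two last values of [b] minus the two first, at most 2 (s - b m) < e;
     this is why [b m] was taken within e / 2 of [s]. *)
  suff : \sum_(0 <= i < N) H (A (m.+1 + i)%N) <=
         (b (m + N).+1 + b (m + N)%N - b m.+1 - b m)%:E.
    move=> /le_trans; apply; rewrite lee_fin.
    have := b_sup (m + N).+1; have := b_sup (m + N)%N; have := b_mono m; lra.
  elim: N => [|N IH]; first by rewrite big_nil addn0 lee_fin; lra.
  rewrite (big_nat_recr _ _ _ (leq0n N)).
  apply: (@le_trans _ _ (_ + (b (m + N).+2 - b (m + N)%N)%:E)).
    apply: leeD; first exact: IH.
    rewrite addSn; exact: A_le.
  by rewrite -EFinD lee_fin addnS; lra.
suff : H (X `&` F) + s%:E <= H X by exact: le_trans (leeD2l _ key).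
have HXF : H (X `&` F) \is a fin_num by apply: fin; exact: subIsetl.
rewrite -(fineK HXF) -[leRHS]fineK ?fin// -EFinD lee_fin -lerBrDl.
by apply: ge_sup => [|_ [j _ <-]]; [exists (b 0%N), 0%N|exact: b_le].
Qed.

End Hausdorff.

(** * Hausdorff measure of great subspheres *)

Section HausdorffGreat.
Context {R : realType} {d : nat}.
Local Notation V := ('rV[R]_d.+1).
Variable k : nat.
Local Open Scope ereal_scope.
Implicit Types (A B L : set V) (x y u : V) (U W : {vspace V}).

Local Notation H := (@hausdorff_measure R d k).

Lemma hausdorff_great_le j L L' : great_subspheres R d j L -> great_subspheres R d j L' ->
  H L <= H L'.
Proof.
move=> [W /= Wj <-] [U /= Uj <-].
have [|f [fB fn fW]] := @linear_isometry _ _ U W; first by rewrite Uj Wj.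
apply: (@le_trans _ _ (H (f @` ([set` U] `&` sphere R d)))); last first.
  apply: hausdorff_lipschitz => x y [/= xU _] [/= yU _].
  by rewrite -fB /enorm fn// memvB.
apply: hausdorff_sub => y [/= /fW[x xU <-]] /sphereP fx.
by exists x => //; split => //; apply/sphereP; rewrite -fn.
Qed.

Lemma hausdorff_great_eq j L L' : great_subspheres R d j L -> great_subspheres R d j L' ->
  H L = H L'.
Proof.
by move=> jL jL'; apply/eqP; rewrite eq_le !(@hausdorff_great_le j).
Qed.

Lemma caratheodory_slab u (e : R) : H.-caratheodory [set x | (`|dot x u| <= e)%R].
Proof.
have -> : [set x | (`|dot x u| <= e)%R] = [set x | (`|dot x u| - e <= 0)%R].
  by apply/seteqP; split => x /=; rewrite subr_le0.
apply: (@caratheodory_sublevel _ _ _ _ (enorm u + 1)).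
  by rewrite ltr_wpDl ?enorm_ge0.
move=> x y; rewrite opprB addrA subrK; apply: le_trans (ler_dist_dist _ _) _.
apply: le_trans (dot_lipschitz u x y) _.
by rewrite mulrC ler_wpM2r ?enorm_ge0// lerDl.
Qed.

Lemma caratheodory_sphere : H.-caratheodory (sphere R d).
Proof.
have -> : sphere R d = [set x | (`|enorm x - 1| <= 0)%R].
  by apply/seteqP; split => x /=; rewrite normr_le0 subr_eq0 => /eqP.
apply: (@caratheodory_sublevel _ _ _ _ 1) => // x y.
apply: le_trans (ler_dist_dist _ _) _; rewrite opprB addrA subrK mul1r.
exact: enorm_lipschitz.
Qed.

Lemma caratheodory_vspace U : H.-caratheodory [set` U].
Proof.
have [f [M [M0 fM ->]]] := vspace_sublevel U; exact: caratheodory_sublevel fM.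
Qed.

Lemma caratheodoryI A B : H.-caratheodory A -> H.-caratheodory B ->
  H.-caratheodory (A `&` B).
Proof. exact: caratheodory_measurable_setI. Qed.

Lemma hausdorff_bigcup (I : finType) (P : pred I) (A : I -> set V) :
  (forall i, P i -> H.-caratheodory (A i)) ->
  (forall i j, P i -> P j -> i != j -> H (A i `&` A j) = 0) ->
  H (\bigcup_(i in [set i | P i]) A i) = \sum_(i | P i) H (A i).
Proof.
move=> cA A0; rewrite -big_filter -[index_enum I]enumT.
have -> : [set i | P i] = [set` [seq i <- enum I | P i]].
  by apply/seteqP; split => i /=; rewrite mem_filter mem_enum andbT.
have : uniq [seq i <- enum I | P i] by rewrite filter_uniq// enum_uniq.
have : {in [seq i <- enum I | P i], forall i, P i} by move=> i; rewrite mem_filter => /andP[].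
elim: [seq i <- enum I | P i] => [_ _|a s IH sP /=].
  rewrite big_nil (_ : \bigcup_(i in _) _ = set0) ?hausdorff0// -subset0.
  by move=> x [].
move=> /andP[as_ us]; rewrite big_cons -IH//; last by move=> i si; apply: sP; rewrite inE si orbT.
have Pa : P a by apply: sP; rewrite mem_head.
set B := \bigcup_(i in [set` s]) A i.
have -> : \bigcup_(i in [set` a :: s]) A i = A a `|` B.
  apply/seteqP; split => x.
    move=> [i /=]; rewrite inE => /predU1P[->|si] Ax; [by left|right; by exists i].
  by move=> [Ax|[i /= si Ax]]; [exists a|exists i] => //=; rewrite inE ?eqxx ?si ?orbT.
have AB0 : H (A a `&` B) = 0.
  apply/eqP; rewrite eq_le hausdorff_ge0 andbT.
  rewrite setI_bigcupr bigcup_seq.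
  apply: (@le_trans _ _ (\sum_(i <- s) H (A a `&` A i))).
    elim/big_ind2 : _ => [|X x Y y Xx Yy|i _]; rewrite ?hausdorff0//.
    apply: le_trans (leeD Xx Yy); exact: outer_measureU2.
  rewrite big_seq big1// => i si; apply: A0 => //.
    by apply: sP; rewrite inE si orbT.
  by apply: contraNneq as_ => ->.
have BE : H B = H (B `&` ~` A a).
  have := cA a Pa B; rewrite setIC => ->.
  have -> : (H : set V -> \bar R) (A a `&` B) = 0 by exact: AB0.
  by rewrite add0e.
rewrite BE; have := cA a Pa (A a `|` B) => ->.
congr (_ + _); last by rewrite setIUl setICr set0U.
by rewrite setIC setIUr setIid; apply: congr1; apply/setUidl; exact: subIsetl.
Qed.

(* Inside a subsphere of dimension [k] there are infinitely many isometric copies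
   of the given lower-dimensional one, and by induction their pairwise
   intersections are negligible. *)
Lemma hausdorff_null L U : great_subspheres R d k L -> (k <= d)%N -> H L < +oo ->
  (\dim U <= k)%N -> H ([set` U] `&` sphere R d) = 0.
Proof.
move=> kL kd Loo; move p : (\dim U) => p'; elim: p' U p => [|j IH] U Uj jk.
  move/eqP : Uj; rewrite dimv_eq0 => /eqP ->.
  rewrite (_ : _ `&` _ = set0) ?hausdorff0// -subset0 => x [/=].
  by rewrite memv0 => /eqP -> /sphere_neq0/eqP.
have [|W0 _ W0k] := @exists_subspace _ _ (fullv : {vspace V}) k.+1; first by rewrite dim_fullV.
have [|W WW0 Wj] := @exists_subspace _ _ W0 j.+2; first by rewrite W0k.
have [q [qW qq _]] := orthonormal_basis W; rewrite Wj in qW qq.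
have q00 : dot (q 0%N) (q 0%N) = 1%R by rewrite qq.
have q11 : dot (q 1%N) (q 1%N) = 1%R by rewrite qq.
have q01 : dot (q 0%N) (q 1%N) = 0%R by rewrite qq.
(* Pairwise non-parallel vectors; their orthogonal complements in [W] are the infinitely many copies
   of [U]. *)
pose v (t : nat) := (q 0%N + t%:R *: q 1%N)%R.
pose F t := (W :&: orth (v t))%VS.
have vW t : v t \in W by rewrite memvD ?memvZ ?qW.
have Fj t : \dim (F t) = j.+1.
  rewrite dim_cap_orth ?Wj//; apply/subvPn; exists (v t) => //.
  rewrite mem_orth /v dotDl !dotDr !dotZl !dotZr q00 q11 q01 (dotC (q 1%N)) q01.
  by apply/eqP; have := sqr_ge0 (t%:R : R); rewrite expr2; lra.
have FF s t : s != t -> \dim (F s :&: F t) = j.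
  move=> st; have -> : (F s :&: F t)%VS = (F s :&: orth (v t))%VS.
    by rewrite /F capvA; congr (_ :&: _)%VS; apply/capv_idPl; exact: capvSl.
  rewrite dim_cap_orth ?Fj//; apply/subvPn; exists (s%:R *: q 0%N - q 1%N)%R.
    rewrite memv_cap memvB ?memvZ ?qW//= mem_orth /v.
    rewrite dotBl !dotDr !dotZl !dotZr q00 q11 q01 (dotC (q 1%N)) q01.
    by apply/eqP; ring.
  rewrite mem_orth /v dotBl !dotDr !dotZl !dotZr q00 q11 q01 (dotC (q 1%N)) q01.
  rewrite !mulr0 !mulr1 addr0 add0r subr_eq0 eqr_nat; exact: st.
set a := H _; have Fa t : H ([set` F t] `&` sphere R d) = a.
  by apply: (@hausdorff_great_eq j); [exists (F t)|exists U].
have le m : m%:R%:E * a <= H L.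
  have <- : H ([set` W0] `&` sphere R d) = H L by apply: (@hausdorff_great_eq k) => //; exists W0.
  have <- : \sum_(t < m) H ([set` F t] `&` sphere R d) = m%:R%:E * a.
    rewrite (eq_bigr (fun=> a)); last by move=> t _; exact: Fa.
    by rewrite sumr_const card_ord mule_natl.
  rewrite -hausdorff_bigcup => [|t _|s t _ _ st].
  - apply: hausdorff_sub => x [t _ [/= xF x1]]; split => //=.
    by apply/(subvP WW0)/(subvP _ _ xF); exact: capvSl.
  - by apply: caratheodoryI; [exact: caratheodory_vspace|exact: caratheodory_sphere].
  - have -> : ([set` F s] `&` sphere R d) `&` ([set` F t] `&` sphere R d) =
             [set` (F s :&: F t)%VS] `&` sphere R d.
      apply/seteqP; split => x; rewrite /setI /mkset [(x \in (F s :&: F t)%VS)]memv_cap.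
        by move=> [[xs x1] [xt _]]; split => //; apply/andP.
      by move=> [/andP[xs xt] x1].
    by apply: IH; [exact: FF|exact: ltnW].
have a0 : 0 <= a by exact: hausdorff_ge0.
have aoo : a \is a fin_num.
  rewrite ge0_fin_numE//; apply: le_lt_trans Loo.
  by have := le 1%N; rewrite mul1e.
have Lfin : H L \is a fin_num by rewrite ge0_fin_numE// hausdorff_ge0.
move: a0 le; rewrite -(fineK aoo); move: (fine a) => r; rewrite lee_fin => r0 le.
congr (_%:E); apply/eqP; rewrite eq_le r0 andbT leNgt; apply/negP => rp.
have := le (Num.truncn (fine (H L) / r)).+1.
rewrite -EFinM -(fineK Lfin) lee_fin leNgt => /negP; apply.
by rewrite -ltr_pdivrMr// truncnS_gt.
Qed.

End HausdorffGreat.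

(** * Measure of the skeleton, in total and near one flat *)

Section SkeletonMeasure.
Context {R : realType} {d n : nat}.
Local Notation V := ('rV[R]_d.+1).
Variable u : 'I_n -> V.
Hypothesis gp : general_position u.
Variable k : nat.
Hypothesis kd : (k < d)%N.
Local Open Scope ereal_scope.
Implicit Types (I J : {set 'I_n}).

Local Notation H := (@hausdorff_measure R d k).

Definition flat_sphere I : set V := [set` flat u I] `&` sphere R d.

Definition flats_union : set V :=
  \bigcup_(I in [set I : {set 'I_n} | #|I| == (d - k)%N]) flat_sphere I.

Definition slab I (e : R) : set V :=
  [set x | forall i, i \in I -> (`|dot x (u i)| <= e)%R].

Lemma caratheodory_slabs I e : H.-caratheodory (slab I e).
Proof.
have -> : slab I e = \bigcap_(i in [set` I]) [set x | (`|dot x (u i)| <= e)%R].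
  by apply/seteqP; split.
rewrite bigcap_fset_set; last exact: finite_finset.
elim/big_ind : _ => [|A B|i _]; [|exact: caratheodoryI|exact: caratheodory_slab].
by rewrite -setC0; apply: caratheodory_measurable_setC; exact: caratheodory_measurable_set0.
Qed.

Lemma flat_sphere_great I : #|I| = (d - k)%N -> great_subspheres R d k (flat_sphere I).
Proof. by move=> Ik; exists (flat u I) => //=; rewrite dim_flat// Ik; lia. Qed.

Lemma flat_sphereI I J : flat_sphere I `&` flat_sphere J = flat_sphere (I :|: J).
Proof.
apply/seteqP; split => x.
  move=> [[/= /mem_flat xI x1] [/= /mem_flat xJ _]]; split => //=.
  by apply/mem_flat => i; rewrite inE => /orP[]; [exact: xI|exact: xJ].
move=> [/= /mem_flat h x1]; split; split => //=; apply/mem_flat => i iI;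
  by apply: h; rewrite inE iI ?orbT.
Qed.

Lemma caratheodory_flat_sphere I : H.-caratheodory (flat_sphere I).
Proof. by apply: caratheodoryI; [exact: caratheodory_vspace|exact: caratheodory_sphere]. Qed.

(** One subsphere of finite measure stands for all, since they are isometric. Its finiteness is
    supplied by [hausdorff_great_pos]. *)
Variable L : set V.
Hypothesis kL : great_subspheres R d k L.
Hypothesis Loo : H L < +oo.

Lemma flat_sphere_null I J : #|I| = (d - k)%N -> #|J| = (d - k)%N -> I != J ->
  H (flat_sphere I `&` flat_sphere J) = 0.
Proof.
move=> Ik Jk IJ; rewrite flat_sphereI; apply: hausdorff_null kL (ltnW kd) Loo _.
rewrite dim_flat//.
have lt : (#|I| < #|I :|: J|)%N.
  rewrite proper_card// finset.properEneq finset.subsetUl andbT.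
  apply: contra IJ => /eqP IE; rewrite eq_sym eqEcard Ik Jk leqnn andbT.
  by rewrite IE finset.subsetUr.
have aux (a b : nat) : (a < b)%N -> a = (d - k)%N -> (d.+1 - b <= k)%N by lia.
exact: aux lt Ik.
Qed.

Lemma hausdorff_flats_union :
  H flats_union = #|finset (fun I : {set 'I_n} => #|I| == (d - k)%N)|%:R%:E * H L.
Proof.
rewrite /flats_union hausdorff_bigcup => [|I _|I J /eqP Ik /eqP Jk]; last exact: flat_sphere_null.
  rewrite (eq_bigr (fun=> H L)) => [|I /eqP Ik]; last first.
    by apply: hausdorff_great_eq kL; exact: flat_sphere_great.
  by rewrite sumr_const mule_natl; congr (_ *+ _); apply: eq_card => I; rewrite !inE.
exact: caratheodory_flat_sphere.
Qed.

(** The slabs shrink to [flat_sphere I]. All sets concerned are Caratheodory measurable, and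
    [hausdorff_flats_union] gives finiteness, so the limit is continuity from above. *)
Lemma flats_union_slab_cvg I : #|I| = (d - k)%N ->
  H (flats_union `&` slab I (m.+1%:R^-1)) @[m --> \oo] --> H L.
Proof.
move=> Ik; pose mo : {outer_measure set V -> \bar R} := H.
pose mu : {measure set (caratheodory_type mo) -> \bar R} := mo.
have FE : flat_sphere I = \bigcap_m (flats_union `&` slab I (m.+1%:R^-1)).
  apply/seteqP; split => x.
    move=> [xI x1] m _; split; first by exists I; [exact/eqP|split].
    by move=> i iI; move/mem_flat : xI => ->//; rewrite normr0 invr_ge0.
  move=> h; have [[J _ [_ x1]] _] := h 0%N Logic.I; split => //.
  apply/mem_flat => i iI; apply/eqP; rewrite -normr_le0; apply/ler_addgt0Pl => e e0.
  rewrite addr0; have [m me] := ltr_add_invr (y := 0%R) (x := e) e0.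
  rewrite add0r in me; apply: le_trans (ltW me); exact: (h m Logic.I).2.
have -> : H L = mu (\bigcap_m (flats_union `&` slab I (m.+1%:R^-1))).
  by rewrite -FE; apply: hausdorff_great_eq kL _; exact: flat_sphere_great.
have cU : H.-caratheodory flats_union.
  rewrite /flats_union bigcup_fset_set//; last exact: finite_finset.
  elim/big_ind : _ => [|A B|J _].
  - exact: caratheodory_measurable_set0.
  - exact: caratheodory_measurable_setU.
  - exact: caratheodory_flat_sphere.
apply: (@nonincreasing_cvg_mu _ _ _ mu).
- apply: (@le_lt_trans _ _ (H flats_union)); first by apply: hausdorff_sub; exact: subIsetl.
  rewrite hausdorff_flats_union lte_mul_pinfty ?lee_fin//.
- by move=> m; apply: caratheodoryI => //; exact: caratheodory_slabs.
- by rewrite -FE; exact: caratheodory_flat_sphere.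
- move=> m p mp; apply/subsetPset; apply: setIS => x h i iI.
  by apply: le_trans (h i iI) _; rewrite lef_pV2 ?posrE// ler_nat ltnS.
Qed.

End SkeletonMeasure.

(** * Sigma-algebras generated by the Hausdorff distance *)

Section BorelCells.
Context {R : realType} {d : nat}.
Local Notation V := ('rV[R]_d.+1).
Implicit Types (x y z : V) (A B L : set V).

Lemma sigma_algebra_bigcapI (X : Type) (E : set X) (M : set (set X)) (A : (set X)^nat) :
  sigma_algebra E M -> (forall i, M (A i)) -> M (E `&` \bigcap_i A i).
Proof.
move=> [M0 MD MU] MA; have -> : E `&` \bigcap_i A i = E `\` \bigcup_i (E `\` A i).
  apply/seteqP; split => x.
    by move=> [Ex h]; split => // -[i _ [_ nA]]; apply/nA/h.
  move=> [Ex h]; split => // i _; apply: contrapT => nA; apply: h; by exists i.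
by apply: (MD _); apply: (MU _) => i; exact: MD.
Qed.

Lemma sigma_algebra_bigcup_count (X : Type) (E : set X) (M : set (set X))
    (I : countType) (A : I -> set X) :
  sigma_algebra E M -> (forall i, M (A i)) -> M (\bigcup_i A i).
Proof.
move=> [M0 _ MU] MA.
have -> : \bigcup_i A i = \bigcup_j (if choice.unpickle j is Some i then A i else set0).
  apply/seteqP; split => x; first by move=> [i _ Ai]; exists (choice.pickle i) => //; rewrite choice.pickleK.
  by move=> [j _]; case: (choice.unpickle j) => [i Ai|//]; exists i.
by apply: MU => j; case: (choice.unpickle j).
Qed.

Definition hits A : set (set V) := [set L | L `&` A !=set0].

(* A countable base for the Hausdorff distance: the cells of sets that meet the
   same members of a finite cover of the sphere by small balls. *)
Lemma open_measurable (X : Type) (I : finType) (E : set X) (M : set (set X))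
    (g : X -> I -> set V) (b : V -> R -> set V) (O : set X) :
  sigma_algebra E M ->
  (forall w i, E w -> g w i `<=` sphere R d) ->
  (forall x e y, enorm (x - y) < e -> b x e y) ->
  (forall x e y, b x e y -> enorm (x - y) <= e) ->
  (forall i x e, 0 < e -> M [set w | E w /\ hits (b x e) (g w i)]) ->
  O `<=` E ->
  (forall w, O w -> exists2 e : R, 0 < e & forall w', E w' ->
     (forall i, hclose e (g w i) (g w' i)) -> O w') ->
  M O.
Proof.
move=> sM gS bin bout Mhit OE Oopen.
have [M0 MD MU] := sM.
pose r (m : nat) : R := m.+1%:R^-1.
have r0 m : 0 < r m by rewrite invr_gt0.
have /choice[s sP] m : exists s : seq V, (forall x, x \in s -> sphere R d x) /\
    forall y, sphere R d y -> exists2 x, x \in s & enorm (x - y) < r m.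
  exact: (@sphere_finite_cover _ _ (fun=> r m)).
pose hitb m w := [ffun p : 'I_(size (s m)) * I =>
  `[< hits (b (s m)`_(p.1) (r m)) (g w p.2) >]].
pose cell m c := [set w | E w /\ hitb m w = c].
have Mcell m c : M (cell m c).
  have ME : M E by rewrite -[E]setD0; exact: (MD _).
  have -> : cell m c = E `&` \bigcap_j (if choice.unpickle j is Some p then
      (if c p then [set w | E w /\ hits (b (s m)`_(p.1) (r m)) (g w p.2)]
       else E `\` [set w | E w /\ hits (b (s m)`_(p.1) (r m)) (g w p.2)]) else E).
    apply/seteqP; split => w.
      move=> [Ew <-]; split => // j _; case: (choice.unpickle j) => // p.
      by rewrite ffunE; case: asboolP => h; split => // -[].
    move=> [Ew h]; split => //; apply/ffunP => p; rewrite ffunE.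
    have := h (choice.pickle p) Logic.I; rewrite choice.pickleK; case: (c p) => -[h1 h2].
      exact/asboolP.
    by apply/asboolP => hp; apply: h2.
  apply: (sigma_algebra_bigcapI sM) => j; case: (choice.unpickle j) => [p|//].
  by case: (c p); [exact: Mhit|apply: MD; exact: Mhit].
have -> : O = \bigcup_m \bigcup_c (if `[< cell m c `<=` O >] then cell m c else set0).
  apply/seteqP; split => w; last first.
    by move=> [m _ [c _]]; case: asboolP => // h; exact: h.
  move=> Ow; have [e e0 he] := Oopen w Ow.
  have [m mr] := ltr_add_invr (y := 0) (x := e / 2) (divr_gt0 e0 (ltr0Sn _ 1)).
  rewrite add0r -/(r m) in mr.
  exists m => //; exists (hitb m w) => //.
  case: asboolP => [_|nO]; first by split => //; exact: OE.
  exfalso; apply: nO => w' [Ew' ww']; apply: he => // i.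
  (* Equal patterns force distance below [e]: each point of one set shares a ball of radius r m < e
     / 2 with a point of the other. *)
  have close a a' : E a -> hitb m a = hitb m a' -> forall y, g a i y ->
      exists2 z, g a' i z & enorm (y - z) < e.
    move=> Ea aa y ay; have [_ /(_ y (gS _ _ Ea _ ay))[x xs xy]] := sP m.
    have xi : (index x (s m) < size (s m))%N by rewrite index_mem.
    move: aa => /ffunP/(_ (Ordinal xi, i)); rewrite !ffunE /= nth_index//.
    move=> aa'; have /asboolP[z [a'z /bout xz]] : `[< hits (b x (r m)) (g a' i) >].
      by rewrite -aa'; apply/asboolP; exists y; split => //; exact: bin.
    exists z => //.
    apply: le_lt_trans (enorm_triangle x _ _) _; rewrite (enormBC y); lra.
  have Ew := OE _ Ow; split => [y|y wy]; first exact: close.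
  by have [z] := close w' w Ew' ww' y wy; exists z => //; rewrite enormBC.
apply: MU => m; apply: (sigma_algebra_bigcup_count sM) => c.
by case: asboolP.
Qed.

(** Hitting an open ball is an open condition on a set. For intersections it is missing a closed
    ball that is open; [open_measurable] therefore accepts any [b] between the two. *)
Definition oball x (e : R) : set V := [set y | enorm (x - y) < e].
Definition cball x (e : R) : set V := [set y | enorm (x - y) <= e].

Lemma hborel_sigma_algebra (K : set (set V)) : sigma_algebra K (hborel K).
Proof. exact: smallest_sigma_algebra. Qed.

Lemma hborel_hopen (K O : set (set V)) : hopen K O -> hborel K O.
Proof. exact: sub_sigma_algebra. Qed.

Lemma hborel_sub (K : set (set V)) (C : set (set V)) : hborel K C -> C `<=` K.
Proof.
move=> KC; have : [set C | C `<=` K] C; last by [].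
apply: KC; split; last by move=> O [].
by split => //= F FK x [i _]; exact: FK.
Qed.

Lemma hborel_K (K : set (set V)) : hborel K K.
Proof. by apply: hborel_hopen; split => // A KA; exists 1. Qed.

Lemma hborel_hits_oball (K : set (set V)) x e :
  hborel K [set L | K L /\ hits (oball x e) L].
Proof.
apply: hborel_hopen; split=> [L []//|L [KL [y [Ly xy]]]].
exists (e - enorm (x - y)); first by rewrite subr_gt0.
move=> L' KL' [/(_ y Ly)[z L'z yz] _]; split => //; exists z; split => //=.
by apply: le_lt_trans (enorm_triangle y _ _) _; lra.
Qed.

(** The sets with measurable preimage form a sigma-algebra on [K], and [open_measurable] puts the
    open sets in it once the hitting events are. So measurability of a set-valued map is checked on
    balls. *)
Lemma preimage_hborel (X : Type) (E D : set X) (M : set (set X)) (K : set (set V))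
    (f : X -> set V) (b : V -> R -> set V) (C : set (set V)) :
  sigma_algebra E M -> D `<=` E -> M D -> (forall w, D w -> K (f w)) ->
  (forall L, K L -> L `<=` sphere R d) ->
  (forall x e y, enorm (x - y) < e -> b x e y) ->
  (forall x e y, b x e y -> enorm (x - y) <= e) ->
  (forall x e, 0 < e -> M [set w | D w /\ hits (b x e) (f w)]) ->
  hborel K C -> M [set w | D w /\ C (f w)].
Proof.
move=> sM DE MD_ fK KS bin bout Mhit; have [M0 MD MU] := sM.
pose Sg := [set C : set (set V) | M [set w | D w /\ C (f w)]].
have MDD (A : set X) : M A -> A `<=` D -> M (D `\` A).
  move=> MA AD; have -> : D `\` A = E `\` ((E `\` D) `|` A).
    apply/seteqP; split => w [].
      by move=> Dw nA; split; [exact: DE|move=> [[]|]].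
    move=> Ew h; split; last by move=> Aw; apply: h; right.
    by apply: contrapT => nD; apply: h; left.
  apply: (MD _); have := @sigma_algebra_bigcup_count _ E M bool (fun i => if i then E `\` D else A) sM.
  have -> : \bigcup_i (if i then E `\` D else A) = (E `\` D) `|` A.
    apply/seteqP; split => w; first by move=> [[] _]; [left|right].
    by move=> [h|h]; [exists true|exists false].
  by apply; case => //; exact: MD.
have sSg : sigma_algebra K Sg.
  split.
  - by rewrite /Sg /= (_ : [set w | _] = set0)// -subset0 => w [].
  - move=> A; rewrite /Sg /= => MA.
    have -> : [set w | D w /\ (K `\` A) (f w)] = D `\` [set w | D w /\ A (f w)].
      apply/seteqP; split => w; first by move=> [Dw [Kw nA]]; split => // -[].
      by move=> [Dw nA]; split => //; split; [exact: fK|move=> Aw; apply: nA].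
    by apply: MDD => // w [].
  - move=> F MF; rewrite /Sg /=.
    have -> : [set w | D w /\ (\bigcup_i F i) (f w)] = \bigcup_i [set w | D w /\ F i (f w)].
      apply/seteqP; split => w; first by move=> [Dw [i _ Fw]]; exists i.
      by move=> [i _ [Dw Fw]]; split => //; exists i.
    exact: MU.
move=> KC; apply: (KC Sg); split => // O [OK Oopen].
apply: (@open_measurable _ unit _ _ (fun w _ => w) b _ (sSg)) => //.
- by move=> L _ KL; exact: KS.
- move=> _ x e e0; rewrite /Sg /=.
  rewrite (_ : [set w | _] = [set w | D w /\ hits (b x e) (f w)]); first exact: Mhit.
  apply/seteqP; split => w; first by move=> [Dw []].
  by move=> [Dw fw]; split => //; split => //; exact: fK.
- move=> L OL; have [e e0 he] := Oopen L OL; exists e => // L' KL' LL'.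
  by apply: he => //; exact: (LL' tt).
Qed.

End BorelCells.

(** * Measurability of the direction *)

Section DirectionMeasurable.
Context {R : realType} {d : nat}.
Local Notation V := ('rV[R]_d.+1).
Implicit Types (x y z : V) (A K L : set V).

(** Lower semicontinuity of the linear hull: a vector of [lin K] combines finitely many points of
    [K], and each has a close neighbour in [K']. *)
Lemma lin_approx K z (t : R) : lin K z -> 0 < t ->
  exists2 e : R, 0 < e & forall K', hclose e K K' ->
    exists2 z', lin K' z' & enorm (z - z') < t.
Proof.
have [s [sK _ ->]] := lin_span K; move=> /= zs t0.
have [c zE] : exists c : 'I_(size s) -> R, z = \sum_(i < size s) c i *: s`_i.
  exists (fun i => coord (in_tuple s) i z); exact: coord_span.
pose M := 1 + \sum_(i < size s) `|c i|.
have M0 : 0 < M by rewrite ltr_pwDl// sumr_ge0.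
exists (t / M); first by rewrite divr_gt0.
move=> K' [KK' _].
have /choice[p pP] (i : 'I_(size s)) : exists y, K' y /\ enorm (s`_i - y) < t / M.
  by have [|y K'y sy] := KK' s`_i; [apply/sK/mem_nth|exists y].
exists (\sum_(i < size s) c i *: p i).
  move=> U K'U; apply: memv_suml => i _; apply: memvZ; apply: K'U; exact: (pP i).1.
rewrite zE -sumrB; apply: le_lt_trans (enorm_sum _ _ _) _.
apply: (@le_lt_trans _ _ (\sum_(i < size s) `|c i| * (t / M))).
  apply: ler_sum => i _; rewrite -scalerBr enormZ ler_wpM2l//.
  exact: ltW (pP i).2.
rewrite -mulr_suml mulrA -mulrA mulrCA gtr_pMr// ltr_pdivrMr// mul1r.
by rewrite /M ltrDr.
Qed.

Lemma hclose_le (e e' : R) A B : e <= e' -> hclose e A B -> hclose e' A B.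
Proof.
move=> ee [AB BA]; split => x.
  by move=> /AB[y By xy]; exists y => //; exact: lt_le_trans ee.
by move=> /BA[y Ay yx]; exists y => //; exact: lt_le_trans ee.
Qed.

Lemma common_radius (I : finType) (P : I -> R -> Prop) :
  (forall i e e', e' <= e -> P i e -> P i e') ->
  (forall i, exists2 e, 0 < e & P i e) -> exists2 e, 0 < e & forall i, P i e.
Proof.
move=> Pmono /(_ _)/cid2-/all_sig2[e e0 eP].
have : exists2 f, 0 < f & forall i, i \in enum I -> f <= e i.
  elim: (enum I) => [|i s [f f0 fs]]; first by exists 1.
  exists (Num.min f (e i)); first by rewrite lt_min f0 e0.
  by move=> j; rewrite inE => /predU1P[->|/fs]; rewrite ge_min ?lexx ?orbT// => ->.
move=> [f f0 fe]; exists f => // i; apply: Pmono (eP i).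
by apply: fe; rewrite mem_enum.
Qed.

(* If [lin K'] had smaller dimension, some unit vector of [lin K] would be
   orthogonal to it, although [K'] nearly spans [lin K]. *)
Lemma dim_lin_open K (U : {vspace V}) : lin K = [set` U] ->
  exists2 e : R, 0 < e & forall K' (U' : {vspace V}), lin K' = [set` U'] ->
    hclose e K K' -> (\dim U <= \dim U')%N.
Proof.
move=> KU; have [q [qU qq qx]] := orthonormal_basis U.
(* With this [t], the errors in the \dim U basis directions add up to less than 1. *)
pose t : R := (\dim U).+1%:R^-1.
have t0 : 0 < t by rewrite invr_gt0.
have [|i|e e0 he] := @common_radius 'I_(\dim U) (fun i e => forall K', hclose e K K' ->
    exists2 z', lin K' z' & enorm (q i - z') < t).
- by move=> i e e' ee he K' /(hclose_le ee); exact: he.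
- by apply: lin_approx t0; rewrite KU /=; exact: qU.
exists e => // K' U' K'U' KK'; rewrite leqNgt; apply/negP => lt.
have [x [xU x1] /subvP U'x] := exists_orthogonal lt.
have /choice[p pP] (i : 'I_(\dim U)) : exists z', lin K' z' /\ enorm (q i - z') < t.
  by have [z] := he i K' KK'; exists z.
pose x' := \sum_(i < \dim U) dot x (q i) *: p i.
have xx' : dot x' x = 0.
  apply/eqP; rewrite -mem_orth U'x//; apply: memv_suml => i _; apply: memvZ.
  by have := (pP i).1; rewrite K'U'.
have : 1 <= enorm (x - x').
  have -> : (1 : R) = dot (x - x') x by rewrite dotBl xx' subr0; exact/esym/sphereP.
  by apply: le_trans (ler_norm _) (le_trans (dot_le_enorm _ _) _); rewrite x1 mulr1.
rewrite leNgt => /negP; apply; rewrite {1}(qx x xU) -sumrB.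
apply: le_lt_trans (enorm_sum _ _ _) _.
apply: (@le_lt_trans _ _ (\sum_(i < \dim U) t)).
  apply: ler_sum => i _; rewrite -scalerBr enormZ -[leRHS]mul1r.
  apply: ler_pM; rewrite ?enorm_ge0//; last exact: ltW (pP i).2.
  apply: le_trans (dot_le_enorm _ _) _; rewrite x1 mul1r.
  by have -> : enorm (q i) = 1 by apply/sphereP; rewrite qq ?eqxx.
rewrite sumr_const card_ord -[ltLHS]mulr_natl ltr_pdivrMr ?mul1r ?ltr_nat//.
Qed.

Lemma direction_hits_open K x (e : R) : hits (oball x e) (direction K) ->
  exists2 f : R, 0 < f & forall K', hclose f K K' -> hits (oball x e) (direction K').
Proof.
move=> [z [[zK z1] /= xz]].
(* The first bound absorbs the factor 2 of [dist_normalize]; the second keeps [z'] away from 0. *)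
pose t := Num.min ((e - enorm (x - z)) / 2) (1 / 2).
have t0 : 0 < t by rewrite lt_min !divr_gt0// subr_gt0.
have [f f0 hf] := lin_approx zK t0.
exists f => // K' /hf[z' z'K]; rewrite lt_min => /andP[zz zz1].
have z'0 : z' != 0.
  by apply/eqP => z'0; move: zz1; rewrite z'0 subr0 z1; lra.
exists (normalize z'); split; first split.
- by move=> U K'U; apply/normalize_mem/z'K.
- exact: normalize_sphere.
- apply: le_lt_trans (enorm_triangle z _ _) _.
  have := dist_normalize z' z1; rewrite enormBC (enormBC z' z); lra.
Qed.

Lemma great_subspheres_sphere k L : great_subspheres R d k L -> L `<=` sphere R d.
Proof. by move=> [U _ <-]; exact: subIsetr. Qed.

(** The dimension of the hull is only lower semicontinuous, but having dimension exactly k + 1 is a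
    difference of two open conditions. On that set the direction is a great subsphere, and its
    hitting an open ball is an open condition. *)
Lemma direction_measurable k C : hborel (great_subspheres R d k) C ->
  hborel (@sphere_compacts R d) [set K | sphere_compacts K /\ C (direction K)].
Proof.
move=> kC; pose Kc := @sphere_compacts R d.
have sM := hborel_sigma_algebra Kc; have [M0 MD MU] := sM.
pose Dm m := [set K | Kc K /\ exists2 U : {vspace V}, lin K = [set` U] & (m <= \dim U)%N].
have MDm m : hborel Kc (Dm m).
  apply: hborel_hopen; split=> [K []//|K [KK [U KU mU]]].
  have [e e0 he] := dim_lin_open KU; exists e => // K' KK' KK'c; split => //.
  have [s [_ _ K's]] := lin_span K'; exists (span s) => //.
  exact: leq_trans mU (he _ _ K's KK'c).
pose D := Dm k.+1 `\` Dm k.+2.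
have DE : D = [set K | Kc K /\ great_subspheres R d k (direction K)].
  apply/seteqP; split => K.
    move=> [[KK [U KU kU]] nK]; split => //; apply/(direction_great _ KU).
    apply/eqP; rewrite eqn_leq kU andbT leqNgt; apply/negP => lt; apply: nK.
    by split => //; exists U.
  move=> [KK]; have [s [_ _ Ks]] := lin_span K => /(direction_great _ Ks) sk.
  split; first by split => //; exists (span s); rewrite ?sk.
  by move=> [_ [U]]; rewrite Ks => /vspace_set_inj <-; rewrite sk ltnn.
have MDD : hborel Kc D.
  have -> : D = Kc `&` \bigcap_i (if i is 0%N then Dm k.+1 else Kc `\` Dm k.+2).
    apply/seteqP; split => K.
      by move=> [[KK DK] nK]; split => // -[|i] _; split.
    by move=> [KK h]; split; [exact: (h 0%N)|exact: (h 1%N Logic.I).2].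
  by apply: (sigma_algebra_bigcapI sM) => -[|i]; [exact: MDm|apply: (MD _); exact: MDm].
have -> : [set K | Kc K /\ C (direction K)] = [set K | D K /\ C (direction K)].
  apply/seteqP; split => K; rewrite DE; last by move=> [[]].
  by move=> [KK CK]; split => //; split => //; exact: hborel_sub CK.
apply: (@preimage_hborel _ _ _ _ _ _ (great_subspheres R d k) direction oball _ sM) => //.
- by rewrite DE => K [].
- by rewrite DE => K [].
- exact: great_subspheres_sphere.
- by move=> x e y /ltW.
move=> x e e0; have -> : [set K | D K /\ hits (oball x e) (direction K)] =
  Kc `&` \bigcap_i (if i is 0%N then D else [set K | Kc K /\ hits (oball x e) (direction K)]).
  apply/seteqP; split => K.
    by move=> [DK hK]; have [[KK _] _] := DK; split => // -[|i] _.
  by move=> [KK h]; split; [exact: (h 0%N)|exact: (h 1%N Logic.I).2].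
apply: (sigma_algebra_bigcapI sM) => -[|i] //.
apply: hborel_hopen; split=> [K []//|K [KK /direction_hits_open[f f0 hf]]].
by exists f => // K' KK' /hf.
Qed.


End DirectionMeasurable.

(** * Measurability of intersections of great hyperspheres *)

Section IntersectionMeasurable.
Context {R : realType} {d : nat}.
Local Notation V := ('rV[R]_d.+1).
Hypothesis d0 : (0 < d)%N.
Implicit Types (x y z : V) (A K L : set V).

Local Notation G := (great_subspheres R d d.-1).

Lemma great_hypersphereP L : G L <-> exists2 u, sphere R d u & L = great_hypersphere u.
Proof.
split=> [[U /= Ud <-]|[u u1 ->]].
  rewrite prednK// in Ud; have [u u1 ->] := hyperplane_orth Ud.
  exists u => //; apply/seteqP; split => x [/= xu x1]; split => //=.
    by apply/eqP; rewrite -mem_orth.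
  by rewrite mem_orth xu.
exists (orth u); first by rewrite /= dim_orth ?prednK//; exact: sphere_neq0.
apply/seteqP; split => x [/= xu x1]; split => //=.
  by apply/eqP; rewrite -mem_orth.
by rewrite mem_orth xu.
Qed.

Lemma great_hypersphere_closed u : closed (great_hypersphere u : set V).
Proof.
apply: closedI; last exact: sphere_closed.
apply: (@preimage_closed _ _ (dot^~ u) [set x | x = 0]); last exact: closed_eq.
by move=> x _; exact: dot_continuous.
Qed.

Lemma closed_miss A x : closed A -> ~ A x ->
  exists2 r : R, 0 < r & forall y, enorm (x - y) < r -> ~ A y.
Proof.
move=> cA Ax; have : open (~` A) by rewrite openC.
by rewrite openE => /(_ x Ax) /nbhs_eballP.
Qed.

(** Around each point of the sphere a ball of radius 2 r is free of some [g i] or of [Q]. Half of it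
    serves a finite cover, the other half absorbs the displacement of the sets. *)
Lemma miss_open (I : finType) (g : I -> set V) (Q : set V) :
  (forall i, closed (g i)) -> closed Q -> Q `<=` sphere R d ->
  (forall x, Q x -> exists i, ~ g i x) ->
  exists2 e : R, 0 < e & forall g' : I -> set V, (forall i, hclose e (g i) (g' i)) ->
    forall x, Q x -> exists i, ~ g' i x.
Proof.
move=> cg cQ QS miss.
have /choice[r rP] x : exists r : R, 0 < r /\ (sphere R d x ->
    (exists i, forall y, enorm (x - y) < 2 * r -> ~ g i y) \/
    (forall y, enorm (x - y) < 2 * r -> ~ Q y)).
  have [Qx|nQx] := pselect (Q x).
    have [i gi] := miss x Qx; have [r r0 rx] := closed_miss (cg i) gi.
    exists (r / 2); split; first by rewrite divr_gt0.
    by move=> _; left; exists i => y; rewrite mulrC divfK//; exact: rx.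
  have [r r0 rx] := closed_miss cQ nQx.
  exists (r / 2); split; first by rewrite divr_gt0.
  by move=> _; right => y; rewrite mulrC divfK//; exact: rx.
have [s [sS cov]] := @sphere_finite_cover _ _ r (fun x _ => (rP x).1).
have [e e0 es] : exists2 e : R, 0 < e & forall x, x \in s -> e <= r x.
  elim: s {sS cov} => [|a s [f f0 fs]]; first by exists 1.
  exists (Num.min f (r a)); first by rewrite lt_min f0 (rP a).1.
  by move=> j; rewrite inE => /predU1P[->|/fs]; rewrite ge_min ?lexx ?orbT// => ->.
exists e => // g' gg' y Qy; have y1 := QS _ Qy.
have [x xs xy] := cov y y1.
have rx := (rP x).1.
case: ((rP x).2 (sS x xs)) => [[i gi]|nQ]; last by exfalso; apply: nQ Qy; lra.
exists i => g'y; have [_ /(_ y g'y)[z gz zy]] := gg' i.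
apply: gi gz; apply: le_lt_trans (enorm_triangle y _ _) _.
by rewrite (enormBC y); have := es x xs; lra.
Qed.

Definition hyperspheres_tuple m : set ('I_m -> set V) :=
  [set g | forall i, G (g i)].
Arguments hyperspheres_tuple m _ : clear implicits.

Definition rectangles m : set (set ('I_m -> set V)) :=
  [set D | exists2 B : 'I_m -> set (set V), (forall i, hborel G (B i)) &
           D = [set g | forall i, B i (g i)]].
Arguments rectangles m _ : clear implicits.

Definition tuple_borel m : set (set ('I_m -> set V)) :=
  <<s hyperspheres_tuple m, rectangles m >>.
Arguments tuple_borel m _ : clear implicits.

Lemma tuple_borel_sigma_algebra m : sigma_algebra (hyperspheres_tuple m) (tuple_borel m).
Proof. exact: smallest_sigma_algebra. Qed.

(** Second countability: product-open sets lie in the sigma-algebra of rectangles, on which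
    independence determines the laws. *)
Lemma tuple_borel_open m (O : set ('I_m -> set V)) : O `<=` hyperspheres_tuple m ->
  (forall g, O g -> exists2 e : R, 0 < e & forall g', hyperspheres_tuple m g' ->
     (forall i, hclose e (g i) (g' i)) -> O g') ->
  tuple_borel m O.
Proof.
move=> OG Oopen.
apply: (@open_measurable _ _ _ _ _ _ (fun g i => g i) oball _ (tuple_borel_sigma_algebra m)) => //.
- by move=> g i /(_ i)/great_subspheres_sphere.
- by move=> x e y /ltW.
- move=> i x e e0; apply: sub_sigma_algebra.
  exists (fun j => if j == i then [set L | G L /\ hits (oball x e) L] else G).
    by move=> j; case: ifP => _; [exact: hborel_hits_oball|exact: hborel_K].
  apply/seteqP; split => g.
    by move=> [gG gi] j; case: ifPn => [/eqP ->|_] //; exact: gG.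
  move=> h; split; last by have := h i; rewrite eqxx => -[].
  by move=> j; have := h j; case: ifP => // _ [].
Qed.

Lemma hyperspheres_tuple_normals m (g : 'I_m -> set V) : hyperspheres_tuple m g ->
  exists u : 'I_m -> V, forall i, sphere R d (u i) /\ g i = great_hypersphere (u i).
Proof.
move=> gG; have /choice[u uP] i : exists v, sphere R d v /\ g i = great_hypersphere v.
  by have /great_hypersphereP[v] := gG i; exists v.
by exists u.
Qed.

Lemma bigcap_flat m (u : 'I_m -> V) : (0 < m)%N ->
  \bigcap_i great_hypersphere (u i) = [set` flat u (finset.setTfor 'I_m)] `&` sphere R d.
Proof.
move=> m0; rewrite -bigcap_hyperspheres; last first.
  by apply/set0Pn; exists (Ordinal m0); rewrite inE.
by apply/seteqP; split => x h i _; apply: h => //=; rewrite inE.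
Qed.

Lemma bigcap_miss_open m (Q : set V) : closed Q -> Q `<=` sphere R d ->
  tuple_borel m [set g | hyperspheres_tuple m g /\ (\bigcap_i g i) `&` Q = set0].
Proof.
move=> cQ QS; apply: tuple_borel_open => [g []//|g [gG gQ]].
have [i|x Qx|e e0 he] := @miss_open _ g Q _ cQ QS.
- by have /great_hypersphereP[v _ ->] := gG i; exact: great_hypersphere_closed.
- apply: contrapT => h; have : set0 x; last by [].
  rewrite -gQ; split => // i _; apply: contrapT => gx; apply: h; by exists i.
exists e => // g' g'G gg'; split => //; rewrite -subset0 => x [g'x Qx].
by have [i] := he g' gg' x Qx; apply; exact: g'x.
Qed.

Variable k : nat.
Hypothesis kd : (k < d)%N.
Local Notation m := (d - k)%N.

Let m0 : (0 < m)%N. Proof. by rewrite subn_gt0. Qed.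

(** The linear intersection of d - k hyperplanes has dimension at least k + 1. Equality means
    disjointness from some complementary great subsphere, which is stable by [miss_open]. *)
Lemma bigcap_great_open :
  tuple_borel m [set g | hyperspheres_tuple m g /\ great_subspheres R d k (\bigcap_i g i)].
Proof.
apply: tuple_borel_open => [g []//|g [gG [U /= Uk gU]]].
have kd1 : (k.+1 <= d.+1)%N by rewrite ltnS ltnW.
have /(dim_le_complement U kd1)[W Wd /sphere_cap0 UW] : (\dim U <= k.+1)%N by rewrite Uk.
have cW : closed ([set` W] `&` sphere R d).
  by apply: closedI; [exact: vspace_closed|exact: sphere_closed].
have [i|x [xW x1]|e e0 he] := @miss_open _ g _ _ cW (@subIsetr _ _ _).
- by have /great_hypersphereP[v _ ->] := gG i; exact: great_hypersphere_closed.
- apply: contrapT => h; have : set0 x; last by [].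
  rewrite -UW; split; last by split.
  rewrite -[_ `&` _]/([set` U] `&` sphere R d) gU => i _.
  by apply: contrapT => gx; apply: h; exists i.
exists e => // g' g'G gg'; split => //.
have [u uP] := hyperspheres_tuple_normals g'G.
have g'E : \bigcap_i g' i = [set` flat u (finset.setTfor 'I_m)] `&` sphere R d.
  by rewrite -bigcap_flat//; apply: eq_bigcapr => i _; exact: (uP i).2.
rewrite g'E; exists (flat u (finset.setTfor 'I_m)) => //=.
apply/eqP; rewrite eqn_leq; apply/andP; split; last first.
  have := dim_flat_ge u (finset.setTfor 'I_m); rewrite cardsT card_ord; apply: leq_trans.
  by rewrite subSn ?leq_subr// subKn// ltnW.
apply/(dim_le_complement _ kd1); exists W => //; apply/sphere_cap0.
rewrite -g'E -subset0 => x [g'x Wx].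
by have [i] := he g' gg' x Wx; apply; exact: g'x.
Qed.

(** Intersections are only upper semicontinuous: missing a compact set is stable, hitting an open
    one is not. Hence the closed balls, whose hitting event is the complement of an open one. *)
Lemma bigcap_great_measurable C : hborel (great_subspheres R d k) C ->
  tuple_borel m [set g | hyperspheres_tuple m g /\ C (\bigcap_i g i)].
Proof.
move=> kC; have sM := tuple_borel_sigma_algebra m; have [M0 MD MU] := sM.
have -> : [set g | hyperspheres_tuple m g /\ C (\bigcap_i g i)] =
  [set g | (hyperspheres_tuple m g /\ great_subspheres R d k (\bigcap_i g i)) /\
           C (\bigcap_i g i)].
  apply/seteqP; split => g; last by move=> [[]].
  by move=> [gG gC]; split => //; split => //; exact: hborel_sub gC.
apply: (@preimage_hborel _ _ _ _ [set g | hyperspheres_tuple m g /\ great_subspheres R d k (\bigcap_i g i)]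
  _ (great_subspheres R d k) (fun g => \bigcap_i g i) cball _ sM) => //.
- by move=> g [].
- exact: bigcap_great_open.
- by move=> g [].
- exact: great_subspheres_sphere.
- by move=> x e y /ltW.
move=> x e e0.
pose D1 := [set g : 'I_m -> set V | hyperspheres_tuple m g /\ great_subspheres R d k (\bigcap_i g i)].
pose D2 := [set g : 'I_m -> set V | hyperspheres_tuple m g /\
  (\bigcap_i g i) `&` (cball x e `&` sphere R d) = set0].
have -> : [set w | (hyperspheres_tuple m w /\ great_subspheres R d k (\bigcap_i w i)) /\
    hits (cball x e) (\bigcap_i w i)] =
  hyperspheres_tuple m `&` \bigcap_i (if i is 0%N then D1 else hyperspheres_tuple m `\` D2).
  apply/seteqP; split => g.
    move=> [[gG gk] [y [gy xy]]]; split => // -[|i] _; split => //.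
    move=> [_ /seteqP[+ _]]; apply; split; first exact: gy.
    by split => //; exact: (great_subspheres_sphere gk).
  move=> [gG h]; have [_ gk] := h 0%N Logic.I; split => //.
  have [_ nD2] := h 1%N Logic.I; apply: contrapT => nh; apply: nD2; split => //.
  by rewrite -subset0 => y [gy [xy _]]; apply: nh; exists y.
apply: (sigma_algebra_bigcapI sM) => -[|i]; first exact: bigcap_great_open.
apply: (MD _); apply: bigcap_miss_open; last exact: subIsetr.
apply: closedI; last exact: sphere_closed.
have -> : cball x e = (fun y => enorm (x - y)) @^-1` [set r | r <= e] by [].
apply: preimage_closed; last exact: closed_le.
move=> y _; apply: (@lipschitz_continuous _ _ _ 1) => {}y z; rewrite mul1r.
by apply: le_trans (enorm_lipschitz _ _) _; rewrite opprB addrC addrA subrK enormBC.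
Qed.

End IntersectionMeasurable.

Arguments hyperspheres_tuple {R d} m _.
Arguments rectangles {R d} m _.
Arguments tuple_borel {R d} m _.

(** * Uniqueness of laws *)

Section PiLambda.
Context {R : realType} {dO dO' : measure_display} {Omega : measurableType dO}
  {Omega' : measurableType dO'}.
Local Open Scope ereal_scope.

(** The preimages may live on two spaces, and measurability is carried through the lambda-system
    along with equality; taking both sides equal yields measurability alone. *)
Lemma pi_lambda_unique (X : Type) (D : set X) (Q : set (set X))
    (mu : {measure set Omega -> \bar R}) (nu : {measure set Omega' -> \bar R})
    (f : Omega -> X) (g : Omega' -> X) :
  mu setT < +oo -> (forall w, D (f w)) -> (forall w, D (g w)) ->
  setI_closed Q -> Q D -> (forall A, Q A -> A `<=` D) ->
  (forall A, Q A -> [/\ measurable (f @^-1` A), measurable (g @^-1` A) &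
                        mu (f @^-1` A) = nu (g @^-1` A)]) ->
  forall A, <<s D, Q >> A -> [/\ measurable (f @^-1` A), measurable (g @^-1` A) &
                        mu (f @^-1` A) = nu (g @^-1` A)].
Proof.
move=> muoo fD gD QI QD QsD Qeq.
pose H := [set A : set X | A `<=` D /\ [/\ measurable (f @^-1` A), measurable (g @^-1` A) &
                        mu (f @^-1` A) = nu (g @^-1` A)]].
have fT : f @^-1` D = setT by apply/seteqP; split => // w _; exact: fD.
have gT : g @^-1` D = setT by apply/seteqP; split => // w _; exact: gD.
have munu : mu setT = nu setT by have [_ _] := Qeq D QD; rewrite fT gT.
have fin A : measurable A -> mu A < +oo.
  by move=> mA; apply: le_lt_trans muoo; apply: le_measure; rewrite ?inE.
have fin' A : measurable A -> nu A < +oo.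
  by move=> mA; rewrite (le_lt_trans _ muoo)// munu; apply: le_measure; rewrite ?inE.
suff : <<s D, Q >> `<=` H by move=> sub A /sub[].
apply: lambda_system_subset => //.
- split.
  + by move=> A [].
  + by split => //; exact: Qeq.
  + move=> A B BA [AD [mA mA' AE]] [BD [mB mB' BE]]; split.
      by move=> x [/AD].
    have DE (Y : Type) (h : Y -> X) : h @^-1` (A `\` B) = h @^-1` A `\` h @^-1` B by [].
    have IE (Y : Type) (h : Y -> X) : h @^-1` A `&` h @^-1` B = h @^-1` B.
      by apply/setIidPr => y; exact: BA.
    rewrite !DE; split; [exact: measurableD|exact: measurableD|].
    have -> : mu (f @^-1` A `\` f @^-1` B) = mu (f @^-1` A) - mu (f @^-1` B).
      by rewrite measureD ?IE//; exact: fin.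
    have -> : nu (g @^-1` A `\` g @^-1` B) = nu (g @^-1` A) - nu (g @^-1` B).
      by rewrite measureD ?IE//; exact: fin'.
    by rewrite AE BE.
  + move=> F Fnd FH; split; first by move=> x [i _ /(FH i).1].
    have mF i : measurable (f @^-1` F i) by have [_ []] := FH i.
    have mF' i : measurable (g @^-1` F i) by have [_ []] := FH i.
    rewrite !preimage_bigcup; split; [exact: bigcup_measurable|exact: bigcup_measurable|].
    have c1 : mu (f @^-1` F i) @[i --> \oo] --> mu (\bigcup_i f @^-1` F i).
      apply: nondecreasing_cvg_mu => //; first exact: bigcup_measurable.
      by move=> i j /Fnd/subsetPset ij; apply/subsetPset => w; exact: ij.
    have c2 : nu (g @^-1` F i) @[i --> \oo] --> nu (\bigcup_i g @^-1` F i).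
      apply: nondecreasing_cvg_mu => //; first exact: bigcup_measurable.
      by move=> i j /Fnd/subsetPset ij; apply/subsetPset => w; exact: ij.
    have E : (fun i => mu (f @^-1` F i)) = (fun i => nu (g @^-1` F i)).
      by apply/funext => i; have [_ []] := FH i.
    rewrite E in c1; exact: cvg_unique c1 c2.
- by move=> A QA; split; [exact: QsD|exact: Qeq].
- move=> A QA; have : [set B | B `<=` D] A; last by [].
  apply: (QA [set B | B `<=` D]); split => //.
  by split => //= F FK x [i _]; exact: FK.
Qed.

End PiLambda.

(** * Joint laws of subfamilies of hyperspheres *)

Section Laws.
Context {R : realType} {d : nat}.
Local Notation V := ('rV[R]_d.+1).
Hypothesis d0 : (0 < d)%N.
Local Notation G := (great_subspheres R d d.-1).
Local Open Scope ereal_scope.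

Lemma hborel_setI (K : set (set V)) : setI_closed (hborel K).
Proof.
move=> A B KA KB; have -> : A `&` B = K `&` \bigcap_i (if i is 0%N then A else B).
  apply/seteqP; split => L.
    by move=> [AL BL]; split; [exact: hborel_sub AL|move=> [|i]].
  by move=> [_ h]; split; [exact: (h 0%N)|exact: (h 1%N)].
by apply: (sigma_algebra_bigcapI (hborel_sigma_algebra K)) => -[].
Qed.

Lemma rectangles_setI m : setI_closed (@rectangles R d m).
Proof.
move=> _ _ [A KA ->] [B KB ->]; exists (fun i => A i `&` B i).
  by move=> i; exact: hborel_setI.
apply/seteqP; split => g; first by move=> [gA gB] i; split.
by move=> h; split => i; have [] := h i.
Qed.

Lemma rectangles_all m : rectangles m (hyperspheres_tuple m : set ('I_m -> set V)).
Proof. by exists (fun=> G) => // i; exact: hborel_K. Qed.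

Lemma rectangles_sub m (A : set ('I_m -> set V)) : rectangles m A -> A `<=` hyperspheres_tuple m.
Proof. by move=> [B KB ->] g gB i; exact: hborel_sub (gB i). Qed.

Section Family.
Context {dO : measure_display} {Omega : measurableType dO}.
Variables (P : probability Omega R) (kappa0 : probability (borelV R d) R).
Variables (n : nat) (S : 'I_n -> Omega -> set V).
Hypothesis hS : iid_hyperspheres P kappa0 S.

Definition subfamily m (f : 'I_m -> 'I_n) (w : Omega) (i : 'I_m) : set V := S (f i) w.

Lemma subfamily_hyperspheres m (f : 'I_m -> 'I_n) w : hyperspheres_tuple m (subfamily f w).
Proof. by move=> i; have [hG _ _] := hS; exact: (hG (f i)).1. Qed.

Lemma preimage_rectangle m (f : 'I_m -> 'I_n) (B : 'I_m -> set (set V)) :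
  subfamily f @^-1` [set g | forall i, B i (g i)] = \bigcap_i (S (f i) @^-1` B i).
Proof. by apply/seteqP; split => w h i; [move=> _; exact: h|exact: h]. Qed.

Lemma measurable_rectangle m (f : 'I_m -> 'I_n) (A : set ('I_m -> set V)) : rectangles m A ->
  measurable (subfamily f @^-1` A).
Proof.
move=> [B KB ->]; rewrite preimage_rectangle.
apply: fin_bigcap_measurable => // i _; have [hG _ _] := hS; exact: (hG (f i)).2.
Qed.

Lemma measurable_subfamily m (f : 'I_m -> 'I_n) D : injective f -> tuple_borel m D ->
  measurable (subfamily f @^-1` D).
Proof.
move=> finj; have PT : P setT < +oo by rewrite probability_setT ltry.
have fD := @subfamily_hyperspheres m f.
have main A : rectangles m A -> [/\ measurable (subfamily f @^-1` A),
    measurable (subfamily f @^-1` A) & P (subfamily f @^-1` A) = P (subfamily f @^-1` A)].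
  by move=> RA; have mA := measurable_rectangle f RA.
by move=> mD; have [] := pi_lambda_unique PT fD fD (@rectangles_setI m)
    (rectangles_all m) (@rectangles_sub m) main mD.
Qed.

(** [independent] speaks of all n hyperspheres at once; those outside the range of [f] get the sure
    event [G]. *)
Lemma rectangle_probability m (f : 'I_m -> 'I_n) (B : 'I_m -> set (set V)) :
  injective f -> (forall i, hborel G (B i)) ->
  P (subfamily f @^-1` [set g | forall i, B i (g i)]) =
  \prod_(i < m) directional_distribution kappa0 (B i).
Proof.
move=> finj KB; rewrite preimage_rectangle; have [hG hind hlaw] := hS.
pose B' j := if [pick i | f i == j] is Some i then B i else G.
have B'f i : B' (f i) = B i.
  rewrite /B'; case: pickP => [i' /eqP/finj ->//|/(_ i)]; by rewrite eqxx.
have KB' j : hborel G (B' j).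
  by rewrite /B'; case: pickP => // _; exact: hborel_K.
have -> : \bigcap_i (S (f i) @^-1` B i) = \bigcap_j (S j @^-1` B' j).
  apply/seteqP; split => w h j _.
    rewrite /preimage /B' /=; case: pickP => [i /eqP <-|_]; first exact: h.
    exact: (hG j).1.
  by have := h (f j) Logic.I; rewrite /preimage /= B'f.
rewrite hind//.
rewrite (bigID (fun j => j \in codom f))/= [X in _ * X]big1 ?mule1; last first.
  move=> j jf; rewrite /B'; case: pickP => [i /eqP fi|_].
    by rewrite -fi codom_f in jf.
  rewrite (_ : _ @^-1` _ = setT) ?probability_setT//.
  by apply/seteqP; split => // w _; exact: (hG j).1.
rewrite (eq_bigl (fun j => j \in f @: finset.setTfor 'I_m)); last first.
  move=> j; apply/idP/imsetP => [/codomP[i ->]|[i _ ->]]; last exact: codom_f.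
  by exists i; rewrite ?inE.
rewrite big_imset /=; last by move=> i j _ _ /finj.
rewrite (eq_bigl xpredT) => [|i]; last by rewrite inE.
by apply: eq_bigr => i _; rewrite B'f hlaw.
Qed.

End Family.

Lemma subfamily_law (dO dO' : measure_display) (Omega : measurableType dO)
    (Omega' : measurableType dO') (P : probability Omega R) (P' : probability Omega' R)
    (kappa0 : probability (borelV R d) R) (n m : nat)
    (S : 'I_n -> Omega -> set V) (S' : 'I_m -> Omega' -> set V) (f : 'I_m -> 'I_n) D :
  iid_hyperspheres P kappa0 S -> iid_hyperspheres P' kappa0 S' -> injective f ->
  tuple_borel m D ->
  [/\ measurable (subfamily S f @^-1` D), measurable (subfamily S' id @^-1` D) &
      P (subfamily S f @^-1` D) = P' (subfamily S' id @^-1` D)].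
Proof.
move=> hS hS' finj; have PT : P setT < +oo by rewrite probability_setT ltry.
apply: (pi_lambda_unique PT).
- by move=> w; exact: (subfamily_hyperspheres hS).
- by move=> w; exact: (subfamily_hyperspheres hS').
- exact: rectangles_setI.
- exact: rectangles_all.
- exact: rectangles_sub.
move=> A RA; split; [exact: (measurable_rectangle hS)|exact: (measurable_rectangle hS')|].
have [B KB ->] := RA.
have PB := rectangle_probability hS finj KB.
exact: etrans PB (esym (rectangle_probability hS' (@inj_id _) KB)).
Qed.

(** On rectangles this is [rectangle_probability] for the family [f] extended by [j]. Both sides, as
    functions of [D], come from finite measures: [P] restricted to the event on [S j], and a
    multiple of [P]. *)
Lemma subfamily_independent (dO : measure_display) (Omega : measurableType dO)
    (P : probability Omega R) (kappa0 : probability (borelV R d) R) (n m : nat)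
    (S : 'I_n -> Omega -> set V) (f : 'I_m -> 'I_n) (j : 'I_n) D B :
  iid_hyperspheres P kappa0 S -> injective f -> (forall i, f i != j) ->
  tuple_borel m D -> hborel G B ->
  P (subfamily S f @^-1` D `&` S j @^-1` B) =
  P (subfamily S f @^-1` D) * directional_distribution kappa0 B.
Proof.
move=> hS finj fj mD KB; have [hG _ hlaw] := hS.
have mB : measurable (S j @^-1` B) by exact: (hG j).2.
have c0 : 0 <= directional_distribution kappa0 B by exact: measure_ge0.
have c1 : directional_distribution kappa0 B \is a fin_num.
  rewrite -(hlaw j)//; exact: fin_num_measure.
pose mu := mrestr P mB.
pose c : {nonneg R} := NngNum (fine_ge0 c0).
pose nu := mscale c P.
have fD w : hyperspheres_tuple m (subfamily S f w) by exact: (subfamily_hyperspheres hS).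
have muoo : mu setT < +oo.
  by rewrite /mu /mrestr setTI ltey_eq fin_num_measure.
have [|_ _] := pi_lambda_unique (nu := nu) muoo fD fD (@rectangles_setI m)
    (rectangles_all m) (@rectangles_sub m) _ mD; last first.
  by rewrite /= /mu /nu /mrestr /mscale /= fineK// muleC.
move=> A RA; have mA := measurable_rectangle hS f RA; split=> //.
have [C KC AE] := RA.
rewrite /= /mu /nu /mrestr /mscale /= fineK// AE (rectangle_probability hS)//.
pose f' (i : 'I_m.+1) := if unlift ord0 i is Some i' then f i' else j.
pose C' (i : 'I_m.+1) := if unlift ord0 i is Some i' then C i' else B.
have f'inj : injective f'.
  move=> i i'; rewrite /f'; case: unliftP => [l ->|->]; case: unliftP => [l' ->|->] //.
  - by move=> /finj ->.
  - by move=> /eqP; rewrite (negbTE (fj _)).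
  - by move=> /esym/eqP; rewrite (negbTE (fj _)).
have KC' i : hborel G (C' i) by rewrite /C'; case: unliftP.
have := rectangle_probability hS f'inj KC'.
rewrite big_ord_recl {2}/C' unlift_none.
rewrite (eq_bigr (fun i => directional_distribution kappa0 (C i))) => [|i _]; last first.
  by rewrite /C' liftK.
move=> <-; congr (P _); apply/seteqP; split => w.
  move=> [h Bw] i; rewrite /subfamily /f' /C'; case: unliftP => [l _|_] //; exact: h.
move=> h; split.
  by move=> i; have := h (lift ord0 i); rewrite /subfamily /f' /C' liftK.
by have := h ord0; rewrite /subfamily /f' /C' unlift_none.
Qed.

End Laws.

(** * General position almost surely *)

Section GeneralPositionAS.
Context {R : realType} {d : nat}.
Local Notation V := ('rV[R]_d.+1).
Hypothesis d0 : (0 < d)%N.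
Local Notation G := (great_subspheres R d d.-1).
Local Open Scope ereal_scope.
Variable kappa0 : probability (borelV R d) R.
Hypothesis hkappa0 : nondegenerate_even kappa0.
Implicit Types (x y u : V).

Lemma borel_open (A : set V) : open A -> @measurable _ (borelV R d) A.
Proof. exact: sub_sigma_algebra. Qed.

Lemma borel_closed (A : set V) : closed A -> @measurable _ (borelV R d) A.
Proof.
move=> cA; rewrite -[A]setCK; apply: measurableC; apply: borel_open; exact: closed_openC.
Qed.

Lemma closed_slab x (e : R) : closed [set u : V | sphere R d u /\ (`|dot u x| <= e)%R].
Proof.
apply: closedI; first exact: sphere_closed.
apply: (@preimage_closed _ _ (fun u : V => `|dot u x|%R) [set r | (r <= e)%R]); last exact: closed_le.
move=> u _; apply: (@lipschitz_continuous _ _ _ (enorm x)) => y z.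
by rewrite mulrC; apply: le_trans (ler_dist_dist _ _) _; exact: dot_lipschitz.
Qed.

(** The slabs shrink to the great hypersphere of normals orthogonal to [x], a null set by
    non-degeneracy. *)
Lemma slab_small x (eta : R) : sphere R d x -> (0 < eta)%R ->
  exists2 e : R, (0 < e)%R &
    kappa0 [set u | sphere R d u /\ (`|dot u x| <= e)%R] <= eta%:E.
Proof.
move=> x1 eta0; pose F (m : nat) := [set u : borelV R d | sphere R d u /\ (`|dot u x| <= m.+1%:R^-1)%R].
have mF m : measurable (F m) by apply: borel_closed; exact: closed_slab.
have FE : \bigcap_m F m = great_hypersphere x.
  apply/seteqP; split => u.
    move=> h; have [u1 _] := h 0%N Logic.I; split => //=.
    apply/eqP; rewrite -normr_le0; apply/ler_addgt0Pl => e e0; rewrite addr0.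
    have [m me] := ltr_add_invr (y := 0%R) (x := e) e0.
    by rewrite add0r in me; apply: le_trans (ltW me); exact: (h m Logic.I).2.
  by move=> [/= ux u1] m _; split => //; rewrite ux normr0 invr_ge0.
have k0 : kappa0 (\bigcap_m F m) = 0.
  have [_ _ h] := hkappa0; rewrite FE; apply: h.
  by apply/(great_hypersphereP d0); exists x.
have cv : kappa0 (F m) @[m --> \oo] --> (0 : \bar R).
  rewrite -k0; apply: nonincreasing_cvg_mu => //.
  - by apply: le_lt_trans (probability_le1 _ (mF _)) _; rewrite ltry.
  - by apply: bigcapT_measurable.
  - move=> m p mp; apply/subsetPset => u [u1 ux]; split => //.
    by apply: le_trans ux _; rewrite lef_pV2 ?posrE// ler_nat ltnS.
apply: contrapT => nh.
have : eta%:E <= 0 :> \bar R.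
  rewrite -(cvg_lim _ cv)//; apply: lime_ge; first by apply/cvg_ex; exists 0.
  apply: nearW => m; rewrite leNgt; apply/negP => lt; apply: nh.
  by exists m.+1%:R^-1%R; [rewrite invr_gt0|exact: ltW].
by rewrite lee_fin leNgt eta0.
Qed.

(** Nearby normals have nearby hyperspheres, so [A] is relatively open; in this form it is visibly
    Borel in the ambient space. *)
Lemma hits_open x (e : R) (A := [set u : V | sphere R d u /\ hits (oball x e) (great_hypersphere u)]) :
  A = sphere R d `&` (~` sphere R d `|` A)^°.
Proof.
apply/seteqP; split => u; last by move=> [u1 /interior_subset[]].
move=> Au; have [u1 [y [[/= yu y1] xy]]] := Au; split => //.
apply/nbhs_eballP; exists (Num.min ((e - enorm (x - y)) / 2) 1)%R.
  by rewrite lt_min ltr01 andbT divr_gt0// subr_gt0.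
move=> v; rewrite lt_min => /andP[uv uv1].
have [v1|nv] := pselect (sphere R d v); [right|by left].
split => //; have vv := (sphereP v).1 v1.
pose z : V := (y - dot y v *: v)%R.
have zv : dot z v = 0%R by rewrite dotBl dotZl vv mulr1 subrr.
have yz : (enorm (z - y) <= enorm (u - v))%R.
  rewrite /z addrAC subrr sub0r enormN enormZ v1 mulr1.
  have -> : dot y v = dot y (v - u) by rewrite dotBr yu subr0.
  by apply: le_trans (dot_le_enorm _ _) _; rewrite y1 mul1r enormBC.
have z0 : z != 0%R.
  by apply/eqP => z0; move: yz; rewrite z0 sub0r enormN y1; lra.
exists (normalize z); split; first split => /=.
- by rewrite dotZl zv mulr0.
- exact: normalize_sphere.
- apply: le_lt_trans (enorm_triangle y _ _) _.
  have := dist_normalize z y1; rewrite (enormBC y).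
  rewrite ltr_pdivlMr// in uv; lra.
Qed.

Lemma hits_probability x (e : R) : sphere R d x ->
  directional_distribution kappa0 [set L | G L /\ hits (oball x e) L] <=
  kappa0 [set u | sphere R d u /\ (`|dot u x| <= e)%R].
Proof.
move=> x1; rewrite /directional_distribution.
have -> : [set u | sphere R d u /\ [set L | G L /\ hits (oball x e) L] (great_hypersphere u)] =
    [set u : V | sphere R d u /\ hits (oball x e) (great_hypersphere u)].
  apply/seteqP; split => u [u1]; first by move=> [].
  by move=> h; split => //; split => //; apply/(great_hypersphereP d0); exists u.
apply: le_measure; rewrite ?inE.
- rewrite hits_open; apply: measurableI; first exact: (borel_closed sphere_closed).
  by apply: borel_open; exact: open_interior.
- exact: (borel_closed (@closed_slab x e)).
- move=> u [u1 [y [[/= yu _] xy]]]; split => //.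
  have -> : dot u x = dot (x - y) u by rewrite dotBl yu subr0 dotC.
  by apply: le_trans (dot_le_enorm _ _) _; rewrite u1 mulr1 ltW.
Qed.

Context {dO : measure_display} {Omega : measurableType dO}.
Variable P : probability Omega R.
Variables (n : nat) (S : 'I_n -> Omega -> set V).
Hypothesis hS : iid_hyperspheres P kappa0 S.

(* Whatever the first [m] hyperspheres are, their intersection meets one of
   finitely many small balls, and the independent hypersphere [S j] is unlikely
   to meet the first such ball. *)
Lemma containment_small m (f : 'I_m -> 'I_n) j (eta : R) :
  injective f -> (forall i, f i != j) -> (0 < eta)%R ->
  exists E, [/\ measurable E, P E <= eta%:E &
    [set w | (\bigcap_i S (f i) w) `&` sphere R d !=set0 /\
             (\bigcap_i S (f i) w) `&` sphere R d `<=` S j w] `<=` E].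
Proof.
move=> finj fj eta0; have [hG _ _] := hS.
have /choice[r rP] x : exists r : R, (0 < r)%R /\ (sphere R d x ->
    kappa0 [set u | sphere R d u /\ (`|dot u x| <= 2 * r)%R] <= eta%:E).
  have [x1|nx] := pselect (sphere R d x); last by exists 1%R.
  have [e e0 he] := slab_small x1 eta0; exists (e / 2)%R; split; first by rewrite divr_gt0.
  by move=> _; rewrite mulrC divfK.
have [s [sS cov]] := @sphere_finite_cover _ _ r (fun x _ => (rP x).1).
pose Q a := cball s`_a (r s`_a) `&` sphere R d.
pose Hit a := if (a < size s)%N then
  subfamily S f @^-1` [set g | hyperspheres_tuple m g /\ (\bigcap_i g i) `&` Q a !=set0] else set0.
(* Closed balls for the intersection, open balls of twice the radius for [S j]: both hitting events
   are measurable, and [S j], containing the intersection, meets the larger ball whenever the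
   intersection meets the smaller one. *)
pose B a := [set L | G L /\ hits (oball s`_a (2 * r s`_a)) L].
pose HitD a := [set g : 'I_m -> set V | hyperspheres_tuple m g /\ (\bigcap_i g i) `&` Q a !=set0].
have cQ a : closed (Q a).
  apply: closedI; last exact: sphere_closed.
  apply: (@preimage_closed _ _ (fun y => enorm (s`_a - y)) [set t | (t <= r s`_a)%R]); last exact: closed_le.
  move=> y _; apply: (@lipschitz_continuous _ _ _ 1) => {}y z; rewrite mul1r.
  by apply: le_trans (enorm_lipschitz _ _) _; rewrite opprB addrC addrA subrK enormBC.
have sM := tuple_borel_sigma_algebra (R := R) (d := d) m; have [M0 MD MU] := sM.
have MHit a : tuple_borel m (HitD a).
  have -> : HitD a = hyperspheres_tuple m `\`
      [set g | hyperspheres_tuple m g /\ (\bigcap_i g i) `&` Q a = set0].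
    apply/seteqP; split => g.
      by move=> [gG [y gy]]; split => // -[_ g0]; move: gy; rewrite g0.
    move=> [gG h]; split => //; apply/set0P/negP => /eqP g0; exact: h.
  by apply: (MD _); apply: bigcap_miss_open => //; exact: subIsetr.
have mHit a : measurable (Hit a).
  by rewrite /Hit; case: ifP => // _; exact: (measurable_subfamily hS finj (MHit a)).
have mSj a : measurable (S j @^-1` B a) by apply: (hG j).2; exact: hborel_hits_oball.
(* [F a] says that ball [a] is the first one met; it depends only on the hyperspheres [S (f i)],
   hence is independent of [S j]. *)
pose F := seqDU Hit.
have mF a : measurable (F a) by apply: seqDU_measurable.
have FB a : P (F a `&` S j @^-1` B a) <= eta%:E * P (F a).
  have [as_|as_] := ltnP a (size s); last first.
    have -> : F a = set0 by rewrite /F /seqDU /Hit ltnNge as_ set0D.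
    by rewrite set0I measure0 mule0.
  have s1 : sphere R d s`_a by apply: sS; exact: mem_nth.
  pose DU := HitD a `\` \big[setU/set0]_(b < a) HitD b.
  have MDU : tuple_borel m DU.
    have -> : DU = hyperspheres_tuple m `&` \bigcap_b (if b is b'.+1 then
        (if (b' < a)%N then hyperspheres_tuple m `\` HitD b' else HitD a) else HitD a).
      apply/seteqP; split => g.
        move=> [gA gB]; have [gG _] := gA; split => // -[|b] _ //.
        case: ifP => // ba; split => // gb; apply: gB.
        by rewrite -bigcup_mkord; exists b.
      move=> [gG h]; split; first exact: (h 0%N Logic.I).
      rewrite -bigcup_mkord => -[b /= ba gb].
      by have := h b.+1 Logic.I; rewrite ba => -[].
    apply: (sigma_algebra_bigcapI sM) => -[|b]; first exact: MHit.
    by case: ifP => _; [apply: (MD _); exact: MHit|exact: MHit].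
  have -> : F a = subfamily S f @^-1` DU.
    rewrite /F /seqDU /DU -!bigcup_mkord {1}/Hit as_.
    apply/seteqP; split => w [wA wB]; split => // -[b /= ba wb]; apply: wB; exists b => //.
      by rewrite /Hit (ltn_trans ba as_).
    by move: wb; rewrite /Hit (ltn_trans ba as_).
  rewrite (subfamily_independent hS)//; last exact: hborel_hits_oball.
  rewrite muleC; apply: lee_wpmul2r => //; apply: le_trans (hits_probability _ s1) _.
  exact: (rP _).2.
exists (\bigcup_a (F a `&` S j @^-1` B a)); split.
- by apply: bigcup_measurable => a _; exact: measurableI.
- apply: (@le_trans _ _ (\sum_(0 <= a <oo) P (F a `&` S j @^-1` B a))).
    apply: measure_sigma_subadditive => //; first by move=> a; exact: measurableI.
    by apply: bigcup_measurable => a _; exact: measurableI.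
  apply: (@le_trans _ _ (\sum_(0 <= a <oo) eta%:E * P (F a))).
    by apply: lee_nneseries => a *; [exact: measure_ge0|exact: FB].
  rewrite nneseriesZl//.
  have <- : P (\bigcup_a F a) = \sum_(0 <= a <oo) P (F a).
    rewrite measure_bigcup//; last exact: trivIset_seqDU.
    by apply: eq_eseriesl => a; rewrite in_setT.
  rewrite -[leRHS]mule1; apply: lee_wpmul2l; first by rewrite lee_fin ltW.
  exact/probability_le1/bigcup_measurable.
- move=> w [[y [gy y1]] wS]; have [x xs xy] := cov y y1.
  have xi : (index x s < size s)%N by rewrite index_mem.
  have : (\bigcup_a Hit a) w.
    exists (index x s) => //; rewrite /Hit xi; split.
      by move=> i; exact: (subfamily_hyperspheres hS).
    exists y; split => //; split => //=; rewrite nth_index//; exact: ltW.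
  rewrite seqDU_bigcup_eq => -[a _ Fa]; exists a => //; split => //.
  have : Hit a w by have [] := Fa.
  rewrite /Hit; case: ifP => // as_ [_ [z [gz [/= xz z1]]]].
  have Sz : S j w z by apply: wS.
  split; first exact: (hG j).1.
  exists z; split => //=; apply: le_lt_trans xz _.
  have := (rP s`_a).1; lra.
Qed.

(** The event need not be measurable, so it is enclosed in the intersection of the covers obtained
    for eta = 1 / (p + 1). *)
Lemma containment_negligible m (f : 'I_m -> 'I_n) j :
  injective f -> (forall i, f i != j) ->
  P.-negligible [set w | (\bigcap_i S (f i) w) `&` sphere R d !=set0 /\
                         (\bigcap_i S (f i) w) `&` sphere R d `<=` S j w].
Proof.
move=> finj fj.
have /choice[E EP] (p : nat) : exists E, [/\ measurable E, P E <= (p.+1%:R^-1)%:E &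
    [set w | (\bigcap_i S (f i) w) `&` sphere R d !=set0 /\
             (\bigcap_i S (f i) w) `&` sphere R d `<=` S j w] `<=` E].
  by apply: containment_small => //; rewrite invr_gt0.
exists (\bigcap_p E p); split.
- by apply: bigcapT_measurable => p; have [] := EP p.
- apply/eqP; rewrite eq_le measure_ge0 andbT; apply/lee_addgt0Pr => e e0; rewrite add0e.
  have [p pe] := ltr_add_invr (y := 0%R) (x := e) e0; rewrite add0r in pe.
  have [mE PE _] := EP p; apply: le_trans (le_trans PE _); last by rewrite lee_fin ltW.
  apply: le_measure; rewrite ?inE//; last exact: bigcap_inf.
  by apply: bigcapT_measurable => q; have [] := EP q.
- by move=> w wN p _; have [_ _] := EP p; apply.
Qed.

Lemma general_position_as (nu : Omega -> 'I_n -> V) :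
  (forall w i, sphere R d (nu w i) /\ S i w = great_hypersphere (nu w i)) ->
  P.-negligible [set w | ~ general_position (nu w)].
Proof.
move=> nuP.
(* Intersecting with the sphere matters for empty [p.1], where the intersection of hyperspheres is
   the whole space. *)
pose N (p : {set 'I_n} * 'I_n) := [set w | p.2 \notin p.1 /\
   (\bigcap_(i in [set` p.1]) S i w) `&` sphere R d !=set0 /\
   (\bigcap_(i in [set` p.1]) S i w) `&` sphere R d `<=` S p.2 w].
have Nneg p : P.-negligible (N p).
  have [jJ|jJ] := boolP (p.2 \in p.1).
    by apply: negligibleS (negligible_set0 P) => w [/negP].
  have capE w : \bigcap_(i in [set` p.1]) S i w = \bigcap_i S (@enum_val _ (mem p.1) i) w.
    apply/seteqP; split => x h i; first by move=> _; apply: h; exact: enum_valP.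
    by move=> /= ip; rewrite -(enum_rankK_in ip ip); exact: h.
  apply: negligibleS (@containment_negligible _ (fun i => @enum_val _ (mem p.1) i) p.2 _ _).
  - by move=> w [_ []]; rewrite capE.
  - exact: enum_val_inj.
  - by move=> i; apply: contraNneq jJ => <-; exact: enum_valP.
have : P.-negligible (\bigcup_q (if choice.unpickle q is Some p then N p else set0)).
  apply: negligible_bigcup => q; case: (choice.unpickle q) => [p|]; first exact: Nneg.
  exact: negligible_set0.
apply: negligibleS => w; apply: contra_notP => nN I j jI I0.
apply/negP => /subvP Ij; apply: nN; exists (choice.pickle (I, j)) => //.
rewrite choice.pickleK; split => //=.
have capE : (\bigcap_(i in [set` I]) S i w) `&` sphere R d = [set` flat (nu w) I] `&` sphere R d.
  apply/seteqP; split => x [h x1]; split => //=.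
    by apply/mem_flat => i iI; have := h i iI; rewrite (nuP w i).2 => -[].
  by move=> i /= iI; rewrite (nuP w i).2; split => //=; move/mem_flat : h; exact.
rewrite capE; split.
  exists (normalize (vpick (flat (nu w) I))); split.
    by apply: normalize_mem; exact: memv_pick.
  by apply: normalize_sphere; rewrite vpick0.
move=> x [/= /Ij xj x1]; rewrite (nuP w j).2; split => //=.
by apply/eqP; rewrite -mem_orth.
Qed.

End GeneralPositionAS.

(* The functions integrated here need not be measurable: for a nonnegative
   function the library's integral is then the lower integral. *)
Section LowerIntegral.
Local Open Scope ereal_scope.
Context {dO : measure_display} {T : measurableType dO} {R : realType}.
Variable mu : {measure set T -> \bar R}.
Implicit Types (f g : T -> \bar R).
Import HBNNSimple.

Lemma lower_integralE f : (forall x, 0 <= f x) ->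
  \int[mu]_x f x = ereal_sup [set sintegral mu h |
    h in [set h : {nnsfun T >-> R} | forall x, (h x)%:E <= f x]].
Proof. by move=> f0; rewrite ge0_integralTE. Qed.

Lemma le_lower_integral f g : (forall x, 0 <= f x) -> (forall x, f x <= g x) ->
  \int[mu]_x f x <= \int[mu]_x g x.
Proof.
move=> f0 fg; rewrite !lower_integralE//; last by move=> x; exact: le_trans (fg x).
apply: ge_ereal_sup => _ [h /= hf <-]; apply: ereal_sup_ubound; exists h => //= x.
exact: le_trans (fg x).
Qed.

Lemma lower_integral_gt f (a : \bar R) : (forall x, 0 <= f x) -> a < \int[mu]_x f x ->
  exists h : T -> R, [/\ measurable_fun setT h, (forall x, (0 <= h x)%R),
    (forall x, (h x)%:E <= f x) & a < \int[mu]_x (h x)%:E].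
Proof.
move=> f0; rewrite lower_integralE// => /ereal_sup_gt[_ [h /= hf <-] ah].
exists h; split; [exact: measurable_funP|exact: fun_ge0|exact: hf|].
by rewrite integralT_nnsfun.
Qed.

(** Setting a measurable minorant of [f] to 0 on a measurable null set makes it a minorant of [g]
    without changing its integral. *)
Lemma le_lower_integral_ae f g (N : set T) : (forall x, 0 <= f x) -> (forall x, 0 <= g x) ->
  mu.-negligible N -> (forall x, ~ N x -> f x <= g x) ->
  \int[mu]_x f x <= \int[mu]_x g x.
Proof.
move=> f0 g0 [A [mA A0 NA]] fg; rewrite leNgt; apply/negP => /(lower_integral_gt f0)[h [mh h0 hf]].
rewrite ltNge => /negP; apply.
pose h' x := (h x * \1_(~` A) x)%R.
have mh' : measurable_fun setT h'.
  by apply: measurable_funM => //; exact: measurable_indic (measurableC mA).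
have <- : \int[mu]_x (h' x)%:E = \int[mu]_x (h x)%:E.
  apply: ge0_ae_eq_integral => //.
  - exact/measurable_EFinP.
  - exact/measurable_EFinP.
  - by move=> x _; rewrite lee_fin mulr_ge0.
  - by move=> x _; rewrite lee_fin.
  - exists A; split => // x /=; apply: contra_notP => nA _.
    by rewrite /h' indicE mem_set// mulr1.
apply: le_lower_integral => x; first by rewrite lee_fin mulr_ge0.
rewrite /h' indicE; have [Ax|nAx] := pselect (A x).
  by rewrite memNset ?mulr0//; apply; exact: Ax.
by rewrite mem_set// mulr1; apply: le_trans (hf x) _; apply: fg => /NA.
Qed.

Lemma integralD_EFin (h k : T -> R) : measurable_fun setT h -> measurable_fun setT k ->
  (forall x, (0 <= h x)%R) -> (forall x, (0 <= k x)%R) ->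
  \int[mu]_x (h x)%:E + \int[mu]_x (k x)%:E = \int[mu]_x ((h x)%:E + (k x)%:E).
Proof.
move=> mh mk h0 k0; rewrite [RHS]ge0_integralD => //.
- by move=> x _; rewrite lee_fin.
- exact/measurable_EFinP.
- by move=> x _; rewrite lee_fin.
- exact/measurable_EFinP.
Qed.

(** Lower integrals are superadditive but in general not additive; this direction is the one needed
    to bound a sum over cells. *)
Lemma lower_integralD f g : (forall x, 0 <= f x) -> (forall x, 0 <= g x) ->
  \int[mu]_x f x \is a fin_num ->
  \int[mu]_x f x + \int[mu]_x g x <= \int[mu]_x (f x + g x).
Proof.
move=> f0 g0 ffin.
have gle : \int[mu]_x g x <= \int[mu]_x (f x + g x).
  by apply: le_lower_integral => // x; rewrite leeDr.
have [gfin|goo] := boolP (\int[mu]_x g x \is a fin_num); last first.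
  move: gle; have -> : \int[mu]_x g x = +oo.
    by move: goo; rewrite ge0_fin_numE ?integral_ge0// -leNgt leye_eq => /eqP.
  by rewrite leye_eq => /eqP ->; rewrite leey.
apply/lee_addgt0Pr => e e0; have e2 : (0 < e / 2)%R by rewrite divr_gt0.
have lt (X : \bar R) : X \is a fin_num -> X - (e / 2)%:E < X.
  by move=> Xf; rewrite lteBlDr// lteDl// lte_fin.
have [h [mh h0 hf fh]] := lower_integral_gt f0 (lt _ ffin).
have [k [mk k0 kg gk]] := lower_integral_gt g0 (lt _ gfin).
apply: (@le_trans _ _ (\int[mu]_x (h x)%:E + \int[mu]_x (k x)%:E + e%:E)).
  rewrite {1}(splitr e) EFinD addeACA leeD// -leeBlDr//; exact: ltW.
rewrite leeD2r// integralD_EFin//.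
apply: le_lower_integral => x; first by rewrite adde_ge0// lee_fin.
exact: leeD.
Qed.

Lemma lower_integral_sum (I : Type) (s : seq I) (f : I -> T -> \bar R) :
  (forall i x, 0 <= f i x) -> (forall i, \int[mu]_x f i x \is a fin_num) ->
  \sum_(i <- s) \int[mu]_x f i x <= \int[mu]_x \sum_(i <- s) f i x.
Proof.
move=> f0 ffin; elim: s => [|i s IH].
  by rewrite big_nil integral_ge0// => x _; rewrite big_nil.
rewrite big_cons.
have -> : \int[mu]_x \sum_(j <- i :: s) f j x = \int[mu]_x (f i x + \sum_(j <- s) f j x).
  by apply: eq_integral => x _; rewrite big_cons.
apply: le_trans (lower_integralD _ _ _) => //; first exact: leeD2l.
by move=> x; exact: sume_ge0.
Qed.

End LowerIntegral.

Section LowerIntegralLimit.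
Local Open Scope ereal_scope.
Context {dO : measure_display} {T : measurableType dO} {R : realType}.
Variable P : probability T R.

(* Reverse Fatou, applied to almost optimal measurable minorants. *)
Lemma lower_integral_limit (f : nat -> T -> \bar R) (g : T -> R) (N : set T) (a b : R) :
  (forall m x, 0 <= f m x) -> measurable_fun setT g -> (forall x, (0 <= g x <= b)%R) ->
  P.-negligible N ->
  (forall x, ~ N x -> (forall m, f m x <= b%:E) /\ f m x @[m --> \oo] --> (g x)%:E) ->
  (forall m, a%:E <= \int[P]_x f m x) -> a%:E <= \int[P]_x (g x)%:E.
Proof.
move=> f0 mg gb [A [mA A0 NA]] fA af.
have b0 : (0 <= b)%R.
  by have /andP[] := gb point; exact: le_trans.
have /choice[h hP] (m : nat) : exists h : T -> R, [/\ measurable_fun setT h, (forall x, (0 <= h x)%R),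
    (forall x, (h x)%:E <= f m x) & (a - m.+1%:R^-1)%:E < \int[P]_x (h x)%:E].
  apply: lower_integral_gt => //; apply: lt_le_trans (af m).
  by rewrite lte_fin ltrBlDr ltrDl invr_gt0.
pose h' m x := (h m x * \1_(~` A) x)%R.
have mh' m : measurable_fun setT (h' m).
  by apply: measurable_funM; [have [] := hP m|exact: measurable_indic (measurableC mA)].
have h'b m x : (0 <= h' m x <= b)%R.
  have [_ h0 hf _] := hP m; rewrite /h' indicE; have [Ax|nAx] := pselect (A x).
    by rewrite memNset ?mulr0 ?lexx ?b0//; apply; exact: Ax.
  rewrite mem_set// mulr1 h0 /= -lee_fin; apply: le_trans (hf x) _.
  by have [] := fA x (fun Nx => nAx (NA x Nx)).
have ih m : \int[P]_x (h' m x)%:E = \int[P]_x (h m x)%:E.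
  have [mh h0 _ _] := hP m; apply: ge0_ae_eq_integral => //.
  - exact/measurable_EFinP.
  - exact/measurable_EFinP.
  - by move=> x _; rewrite lee_fin; have /andP[] := h'b m x.
  - by move=> x _; rewrite lee_fin.
  - exists A; split => // x /=; apply: contra_notP => nA _.
    by rewrite /h' indicE mem_set// mulr1.
(* Fatou's lemma is applied to these nonnegative complements; the defect 1 / (m + 1) of the
   minorants vanishes in the limit. *)
pose k m x := (b - h' m x)%R.
have k0 m x : (0 <= k m x)%R by rewrite subr_ge0; have /andP[] := h'b m x.
have mk m : measurable_fun setT (EFin \o k m).
  by apply/measurable_EFinP; apply: measurable_funB.
have compl (f1 f2 : T -> R) : measurable_fun setT f1 -> measurable_fun setT f2 ->
    (forall x, (0 <= f1 x)%R) -> (forall x, (0 <= f2 x)%R) -> (forall x, (f1 x + f2 x = b)%R) ->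
    \int[P]_x (f1 x)%:E + \int[P]_x (f2 x)%:E = b%:E.
  move=> m1 m2 p1 p2 e; rewrite integralD_EFin//.
  under eq_integral do rewrite -EFinD e.
  rewrite integral_cst// -[RHS]mule1; congr (_ * _); exact: probability_setT.
have kle m : \int[P]_x (k m x)%:E <= (b - a + m.+1%:R^-1)%:E.
  have [_ _ _] := hP m; rewrite -ih => lt.
  have kh : \int[P]_x (k m x)%:E + \int[P]_x (h' m x)%:E = b%:E.
    apply: compl => //; first exact/measurable_EFinP.
      by move=> x; have /andP[] := h'b m x.
    by move=> x; rewrite /k subrK.
  have p1 : 0 <= \int[P]_x (k m x)%:E by apply: integral_ge0 => x _; rewrite lee_fin.
  have p2 : 0 <= \int[P]_x (h' m x)%:E.
    by apply: integral_ge0 => x _; rewrite lee_fin; have /andP[] := h'b m x.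
  move: kh p1 p2 lt; case: (\int[P]_x (k m x)%:E) => [r||]; case: (\int[P]_x (h' m x)%:E) => [t||] //=.
  rewrite -EFinD => -[<-] _ _; rewrite lte_fin lee_fin.
  by move: (m.+1%:R^-1)%R => q; lra.
have liminf_ge x : ~ A x -> (b - g x)%:E <= limn_einf (fun m => (k m x)%:E).
  move=> nA; have [_ fg] := fA x (fun Nx => nA (NA x Nx)).
  apply/lee_addgt0Pr => e e0; rewrite -leeBlDr// -EFinB limn_einf_lim.
  apply: (lime_ge (@is_cvg_einfs _ _)).
  have : \forall m \near \oo, f m x < (g x + e)%:E.
    by apply: (fg [set y | y < (g x + e)%:E]); apply: open_ereal_lt'; rewrite lte_fin ltrDl.
  move=> [M _ Mf]; exists M => // m Mm; apply: le_ereal_inf_tmp => _ [p /= mp <-].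
  have fp : f p x < (g x + e)%:E by apply: Mf; exact: leq_trans Mm mp.
  rewrite lee_fin /k /h' indicE mem_set// mulr1.
  have [_ _ /(_ x) hf _] := hP p.
  by have := le_lt_trans hf fp; rewrite lte_fin; lra.
have fat := fatou P measurableT mk (fun m x _ => k0 m x : 0 <= (k m x)%:E).
have bg : \int[P]_x (b - g x)%:E <= (b - a)%:E.
  apply: (@le_trans _ _ (\int[P]_x limn_einf (fun m => (k m x)%:E))).
    apply: (@le_lower_integral_ae _ _ _ _ _ _ A).
    - by move=> x; rewrite lee_fin subr_ge0; have /andP[] := gb x.
    - move=> x; rewrite limn_einf_lim; apply: (lime_ge (@is_cvg_einfs _ _)).
      by apply: nearW => m; apply: le_ereal_inf_tmp => _ [p _ <-]; rewrite lee_fin.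
    - by exists A; split.
    - exact: liminf_ge.
  apply: le_trans fat _.
  have c : (b - a + m.+1%:R^-1)%:E @[m --> \oo] --> (b - a)%:E.
    apply: cvg_EFin; first exact: nearW.
    rewrite -[X in _ --> X]addr0; apply: cvgD; first exact: cvg_cst.
    exact: cvg_harmonic.
  rewrite -(cvg_limn_einf_sup c).1 !limn_einf_lim.
  apply: lee_lim; [exact: (@is_cvg_einfs _ _)|exact: (@is_cvg_einfs _ _)|].
  apply: nearW => m; apply: le_ereal_inf_tmp => _ [p mp <-].
  apply: le_trans (kle p); apply: ereal_inf_lbound; exists p => //.
have pg x : (0 <= g x)%R by have /andP[] := gb x.
have pbg x : (0 <= b - g x)%R by rewrite subr_ge0; have /andP[] := gb x.
have mbg : measurable_fun setT (fun x => b - g x)%R by apply: measurable_funB.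
have := compl _ _ mbg mg pbg pg (fun x => subrK (g x) b).
have i1 : 0 <= \int[P]_x (b - g x)%:E by apply: integral_ge0 => x _; rewrite lee_fin.
have i2 : 0 <= \int[P]_x (g x)%:E by apply: integral_ge0 => x _; rewrite lee_fin.
move: i1 i2 bg; case: (\int[P]_x (b - g x)%:E) => [r||]; case: (\int[P]_x (g x)%:E) => [t||] //=.
by rewrite -EFinD !lee_fin => _ _ le -[eq]; lra.
Qed.

End LowerIntegralLimit.

(** * Typical and weighted typical faces *)

Section Tessellation.
Local Open Scope ereal_scope.
Context {R : realType} {d k n : nat}.
Local Notation V := ('rV[R]_d.+1).
Hypothesis kd : (k < d)%N.
Hypothesis kn : (d - k <= n)%N.
Variable kappa0 : probability (borelV R d) R.
Hypothesis hkappa0 : nondegenerate_even kappa0.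
Context {dO : measure_display} {Omega : measurableType dO}.
Variables (P : probability Omega R) (S : 'I_n -> Omega -> set V).
Hypothesis hS : iid_hyperspheres P kappa0 S.
Context {dO' : measure_display} {Omega' : measurableType dO'}.
Variables (P' : probability Omega' R) (S' : 'I_(d - k) -> Omega' -> set V).
Hypothesis hS' : iid_hyperspheres P' kappa0 S'.
Implicit Types (I J : {set 'I_n}) (C : set (set V)).

Let T w := tessellation (fun i => S i w).
Let kappa C := P' [set w | C (\bigcap_i S' i w)].
Let d0 : (0 < d)%N. Proof. exact: leq_ltn_trans kd. Qed.
Let n0 : (0 < n)%N. Proof. by apply: leq_trans kn; rewrite subn_gt0. Qed.

Local Notation G k := (great_subspheres R d k).

(** A pointwise choice, without any measurability in [w]; events whose measurability matters are
    expressed by [S]. *)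
Lemma exists_normals : exists nu : Omega -> 'I_n -> V,
  forall w i, sphere R d (nu w i) /\ S i w = great_hypersphere (nu w i).
Proof.
have /choice[nu nuP] w : exists v : 'I_n -> V, forall i,
    sphere R d (v i) /\ S i w = great_hypersphere (v i).
  apply: (hyperspheres_tuple_normals d0) => i; have [hG _ _] := hS; exact: (hG i).1.
by exists nu.
Qed.

Let nu : Omega -> 'I_n -> V := projT1 (cid exists_normals).
Let nu1 w i : sphere R d (nu w i).
Proof. by have [] := projT2 (cid exists_normals) w i. Qed.
Let SE w i : S i w = great_hypersphere (nu w i).
Proof. by have [] := projT2 (cid exists_normals) w i. Qed.
Let nu0 w i : nu w i != 0%R. Proof. exact: sphere_neq0. Qed.
Let TE w : T w = tessellation (fun i => great_hypersphere (nu w i)).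
Proof. by congr tessellation; apply/funext => i; exact: SE. Qed.

Definition intersection I w : set V := \bigcap_(i in [set` I]) S i w.

Let intersectionE I w : intersection I w = \bigcap_(i in [set` I]) great_hypersphere (nu w i).
Proof. by apply: eq_bigcapr => i _; exact: SE. Qed.

Let degenerate := [set w | ~ general_position (nu w)].

Let degenerate_negligible : P.-negligible degenerate.
Proof. by apply: (general_position_as d0 hkappa0 hS) => w i; split; [exact: nu1|exact: SE]. Qed.

(** The cardinality is part of the event, which is therefore empty for the other [I], and sums may
    run over all subsets. *)
Definition hit_event C I : set Omega :=
  [set w | #|I| = (d - k)%N /\ C (intersection I w)].

Lemma hit_event_law C I : #|I| = (d - k)%N -> hborel (G k) C ->
  measurable (hit_event C I) /\ P (hit_event C I) = kappa C.
Proof.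
move=> Ik kC; pose f (i : 'I_(d - k)) : 'I_n := enum_val (cast_ord (esym Ik) i).
have finj : injective f by move=> i j /enum_val_inj/cast_ord_inj.
have capE w : \bigcap_i S (f i) w = intersection I w.
  apply/seteqP; split => x h i.
    move=> /= iI; have := h (cast_ord Ik (enum_rank_in iI i)) Logic.I.
    by rewrite /f cast_ordK enum_rankK_in.
  by move=> _; apply: h; exact: enum_valP.
have [+ _ +] := subfamily_law hS hS' finj (bigcap_great_measurable d0 kd kC).
have -> : subfamily S f @^-1` [set g | hyperspheres_tuple (d - k) g /\ C (\bigcap_i g i)] = hit_event C I.
  apply/seteqP; split => w; first by move=> [_ Cw]; split => //; rewrite -capE.
  by move=> [_ Cw]; split; [exact: (subfamily_hyperspheres hS)|rewrite /subfamily capE].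
have -> : subfamily S' id @^-1` [set g | hyperspheres_tuple (d - k) g /\ C (\bigcap_i g i)] =
    [set w | C (\bigcap_i S' i w)].
  apply/seteqP; split => w; first by move=> [].
  by move=> Cw; split => //; exact: (subfamily_hyperspheres hS').
by [].
Qed.

Lemma measurable_hit_event C I : hborel (G k) C -> measurable (hit_event C I).
Proof.
move=> kC; have [Ik|Ik] := eqVneq #|I| (d - k)%N; first by have [] := hit_event_law Ik kC.
rewrite (_ : hit_event C I = set0)// -subset0 => w [Ik' _].
by rewrite Ik' eqxx in Ik.
Qed.

Let bin := #|finset (fun I : {set 'I_n} => #|I| == (d - k)%N)|.

Let bin_gt0 : (0 < bin)%N.
Proof. by rewrite /bin card_draws card_ord bin_gt0. Qed.

Definition hit_count C w : nat :=
  #|finset (fun I : {set 'I_n} => (#|I| == (d - k)%N) && `[< C (intersection I w) >])|.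

(** Outside [degenerate], the conditional probability that the typical face has its direction in
    [C]; for the weighted face it appears as the limit of the bounds [slab_sum]. *)
Definition hit_frequency C (w : Omega) : R := ((hit_count C w)%:R / bin%:R)%R.

Lemma hit_countE C w : ((hit_count C w)%:R = \sum_I \1_(hit_event C I) w :> R)%R.
Proof.
rewrite /hit_count -sum1_card natr_sum big_mkcond; apply: eq_bigr => I _.
rewrite inE indicE; have [/andP[/eqP Ik /asboolP CI]|h] := boolP (_ && _).
  by rewrite mem_set.
rewrite memNset// => -[Ik CI]; move: h; rewrite Ik eqxx /= => /negP; apply.
exact/asboolP.
Qed.

Lemma hit_frequency_bounds C w : (0 <= hit_frequency C w <= 1)%R.
Proof.
have b0 : (0 < bin%:R :> R)%R by rewrite ltr0n.
rewrite divr_ge0//= ler_pdivrMr// mul1r ler_nat; apply: subset_leq_card.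
by apply/fintype.subsetP => I; rewrite !inE => /andP[].
Qed.

Lemma measurable_hit_frequency C : hborel (G k) C -> measurable_fun setT (hit_frequency C).
Proof.
move=> kC; apply: measurable_funM => //.
rewrite (_ : (fun w => _) = fun w => \sum_I \1_(hit_event C I) w)%R; last first.
  by apply/funext => w; exact: hit_countE.
apply: measurable_sum => I; apply: measurable_indic; exact: measurable_hit_event.
Qed.

Lemma integral_hit_frequency C : hborel (G k) C -> \int[P]_w (hit_frequency C w)%:E = kappa C.
Proof.
move=> kC; have b0 : (bin%:R != 0 :> R)%R by rewrite pnatr_eq0 -lt0n.
have -> : \int[P]_w (hit_frequency C w)%:E =
    \int[P]_w ((bin%:R^-1)%:E * \sum_I (\1_(hit_event C I) w)%:E).
  apply: eq_integral => w _; rewrite /hit_frequency hit_countE sumEFin -EFinM.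
  by rewrite mulrC.
have mI I : measurable_fun setT (fun w => (\1_(hit_event C I) w)%:E : \bar R).
  by apply/measurable_EFinP; apply: measurable_indic; exact: measurable_hit_event.
have -> : \int[P]_w ((bin%:R^-1)%:E * \sum_I (\1_(hit_event C I) w)%:E) =
    (bin%:R^-1)%:E * \int[P]_w \sum_I (\1_(hit_event C I) w)%:E.
  apply: ge0_integralZl_EFin => //.
  - by move=> w _; apply: sume_ge0 => I _; rewrite lee_fin.
  - exact: emeasurable_sum.
rewrite ge0_integral_sum//.
have -> : \sum_I \int[P]_w (\1_(hit_event C I) w)%:E =
    \sum_(I : {set 'I_n} | #|I| == (d - k)%N) kappa C.
  rewrite [RHS]big_mkcond; apply: eq_bigr => I _.
  rewrite integral_indic//; last exact: measurable_hit_event.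
  rewrite setIT; case: eqP => [Ik|nIk]; first exact: (hit_event_law Ik kC).2.
  by rewrite (_ : hit_event C I = set0) ?measure0// -subset0 => w [].
have -> : \sum_(I : {set 'I_n} | #|I| == (d - k)%N) kappa C = bin%:R%:E * kappa C.
  by rewrite sumr_const mule_natl; congr (_ *+ _); apply: eq_card => I; rewrite inE.
by rewrite muleA -EFinM mulVf// mul1e.
Qed.

Lemma counting_ge0 (X : choiceType) (A : set X) : 0 <= counting A :> \bar R.
Proof. by rewrite /counting; case: ifP => // _; rewrite lee_fin. Qed.

Let counting_hits C w : ~ degenerate w ->
  counting (tess_faces k (T w) `&` [set F | sphere_compacts F /\ C (direction F)]) =
  ((chambers (n - (d - k)) k.+1)%:R * (hit_count C w)%:R)%:E :> \bar R.
Proof.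
move=> /contrapT gp; rewrite TE (counting_faces gp kd kn) natrM; congr (_ * _%:R)%:E.
by apply: eq_card => I; rewrite !inE intersectionE.
Qed.

(* Almost surely every one of the [bin] flats carries the same number of faces. *)
Lemma uniform_hit_frequency C w : ~ degenerate w ->
  uniform_on (tess_faces k (T w)) [set F | sphere_compacts F /\ C (direction F)] =
  (hit_frequency C w)%:E.
Proof.
move=> nd; rewrite /uniform_on counting_hits//.
have -> : counting (tess_faces k (T w)) = ((chambers (n - (d - k)) k.+1)%:R * bin%:R)%:E :> \bar R.
  have -> : tess_faces k (T w) = tess_faces k (T w) `&`
      [set F | sphere_compacts F /\ setT (direction F)].
    rewrite TE; have gp := contrapT nd; apply/seteqP; split => F; last by move=> [].
    rewrite tess_facesE// => -[[I E] /= IE <-]; split; first by exists (I, E).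
    have [Ik sE] := face_indexP IE; split => //; exact: (face_of_compact gp kd kn Ik sE).
  rewrite counting_hits//; congr (_ * _%:R)%:E.
  by apply: eq_card => I; rewrite !inE asboolT ?andbT.
have c0 : ((chambers (n - (d - k)) k.+1)%:R != 0 :> R)%R by rewrite pnatr_eq0 -lt0n chambers_gt0.
have b0 : (bin%:R != 0 :> R)%R by rewrite pnatr_eq0 -lt0n.
rewrite inver mulf_eq0 (negbTE c0) (negbTE b0) /= -EFinM; congr EFin.
by rewrite /hit_frequency; field; rewrite c0 b0.
Qed.

(** Conditioning on the sure event suffices: the conditional probability equals [hit_frequency]
    almost surely, and the mean of the latter is [kappa C]. *)
Lemma typical_face_direction Z C : typical_face P k T Z -> hborel (G k) C ->
  P [set w | C (direction (Z w))] = kappa C.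
Proof.
move=> [[ZK Zm] Zc] kC.
pose B := [set F : set V | sphere_compacts F /\ C (direction F)].
have mB : hborel (@sphere_compacts R d) B by exact: (direction_measurable kC).
have -> : [set w | C (direction (Z w))] = setT `&` Z @^-1` B.
  by apply/seteqP; split => w; [move=> Cw; split => //; split|move=> [_ []]].
rewrite Zc//; last by exists setT.
rewrite -(integral_hit_frequency kC).
have q0 w : 0 <= uniform_on (tess_faces k (T w)) B :> \bar R.
  by rewrite mule_ge0 ?inve_ge0 ?counting_ge0.
have f0 w : 0 <= (hit_frequency C w)%:E.
  by rewrite lee_fin; have /andP[] := hit_frequency_bounds C w.
apply/eqP; rewrite eq_le; apply/andP; split;
  by apply: (le_lower_integral_ae _ _ degenerate_negligible) => // w nd;
    rewrite uniform_hit_frequency.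
Qed.

Let skelE' w : ~ degenerate w -> skel k (T w) = flats_union (nu w) k.
Proof.
move=> /contrapT gp; rewrite TE skelE//; apply/seteqP; split => x [I /= Ik].
  rewrite bigcap_hyperspheres; last by rewrite -card_gt0 Ik subn_gt0.
  by move=> xI; exists I => //=; apply/eqP.
move/eqP : Ik => Ik xI; exists I => //; rewrite bigcap_hyperspheres//.
by rewrite -card_gt0 Ik subn_gt0.
Qed.

Let intersection_flat I w : #|I| = (d - k)%N -> intersection I w = flat_sphere (nu w) I.
Proof.
by move=> Ik; rewrite intersectionE bigcap_hyperspheres// -card_gt0 Ik subn_gt0.
Qed.

Let normalized_ge0 (A B : set V) : 0 <= normalized_hausdorff k A B :> \bar R.
Proof. by rewrite mule_ge0 ?inve_ge0 ?hausdorff_ge0. Qed.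

(* The law of [v] has total mass one, so the skeleton has positive finite
   measure: no volume has to be computed. *)
Lemma hausdorff_great_pos (v : Omega -> borelV R d) L :
  conditional_distribution P T (@measurable _ (borelV R d)) v
    (fun t => normalized_hausdorff k (skel k t)) ->
  G k L -> 0 < hausdorff_measure k L < +oo.
Proof.
move=> vc kL.
have one : \int[P]_w normalized_hausdorff k (skel k (T w)) setT = 1.
  rewrite -(vc setT setT)//; last by exists setT.
  by rewrite preimage_setT setTI probability_setT.
have null : (forall w, ~ degenerate w -> normalized_hausdorff k (skel k (T w)) setT = 0 :> \bar R) -> False.
  move=> h; have : \int[P]_w normalized_hausdorff k (skel k (T w)) setT <= \int[P]_w (cst 0 w : \bar R).
    by apply: (le_lower_integral_ae _ _ degenerate_negligible) => // w /h ->.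
  by rewrite one integral0 lee_fin ler10.
apply/andP; split.
  rewrite lt_def hausdorff_ge0 andbT; apply/negP => /eqP L0; apply: null => w nd.
  rewrite skelE'// /normalized_hausdorff setIT (hausdorff_flats_union (contrapT nd) kd kL).
    by rewrite L0 mule0 mul0e.
  by rewrite L0 ltry.
rewrite ltey; apply/negP => /eqP Loo; apply: null => w nd.
have [I0 I0k] : exists I : {set 'I_n}, #|I| = (d - k)%N.
  by have /card_gt0P[I] := bin_gt0; rewrite inE => /eqP Ik; exists I.
(* By the conventions for [\bar R], an infinite skeleton has quotient +oo * 0 = 0, so it too
   contradicts total mass one. *)
have -> : normalized_hausdorff k (skel k (T w)) setT = +oo * +oo^-1 :> \bar R.
  rewrite skelE'// /normalized_hausdorff setIT.
  suff -> : hausdorff_measure k (flats_union (nu w) k) = +oo :> \bar R by [].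
  apply/eqP; rewrite -leye_eq -Loo.
  rewrite (hausdorff_great_eq k kL (flat_sphere_great (contrapT nd) kd I0k)).
  by apply: hausdorff_sub => x xI; exists I0 => //=; apply/eqP.
by rewrite invey mule0.
Qed.

Lemma slab_ratio_cvg L I w : G k L -> 0 < hausdorff_measure k L < +oo ->
  ~ degenerate w -> #|I| = (d - k)%N ->
  hausdorff_measure k (flats_union (nu w) k `&` slab (nu w) I (m.+1%:R^-1)) /
    hausdorff_measure k (flats_union (nu w) k) @[m --> \oo] --> (bin%:R^-1 : R)%:E.
Proof.
move=> kL /andP[L0 Loo] /contrapT gp Ik.
have Lfin : hausdorff_measure k L \is a fin_num by rewrite ge0_fin_numE// hausdorff_ge0.
have b0 : (bin%:R != 0 :> R)%R by rewrite pnatr_eq0 -lt0n.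
have := flats_union_slab_cvg gp kd kL Loo Ik; rewrite (hausdorff_flats_union gp kd kL Loo) -/bin.
move: L0; rewrite -(fineK Lfin); move: (fine _) => c; rewrite lte_fin => c0 cv.
have bc0 : (bin%:R * c != 0)%R by rewrite mulf_neq0// gt_eqF.
rewrite -EFinM inver (negbTE bc0).
have -> : (bin%:R^-1)%:E = c%:E * ((bin%:R * c)^-1)%:E :> \bar R.
  by rewrite -EFinM; congr EFin; field; rewrite b0 gt_eqF.
exact: cvgeZr.
Qed.

Definition cell_pattern (s : seq V) (r : R) (L : set V) : {ffun 'I_(size s) -> bool} :=
  [ffun i => `[< hits (oball s`_(nat_of_ord i) r) L >]].

Lemma hborel_cell C (s : seq V) r c : hborel (G k) C ->
  hborel (G k) [set L | C L /\ cell_pattern s r L = c].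
Proof.
move=> kC; have sM := hborel_sigma_algebra (G k); have [M0 MD MU] := sM.
have -> : [set L | C L /\ cell_pattern s r L = c] = C `&` (G k `&` \bigcap_j
   (if choice.unpickle j is Some i then
      (if c i then [set L | G k L /\ hits (oball s`_(nat_of_ord i) r) L]
       else G k `\` [set L | G k L /\ hits (oball s`_(nat_of_ord i) r) L])
    else G k)).
  apply/seteqP; split => L.
    move=> [CL <-]; have GL := hborel_sub kC CL; split => //; split => // j _.
    case: (choice.unpickle j) => // i; rewrite ffunE.
    by case: asboolP => h; split => // -[].
  move=> [CL [GL h]]; split => //.
  apply/ffunP => i; rewrite ffunE.
  have := h (choice.pickle i) Logic.I; rewrite choice.pickleK; case: (c i) => -[h1 h2].
    exact/asboolP.
  by apply/asboolP => hi; apply: h2.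
apply: hborel_setI => //; apply: (sigma_algebra_bigcapI sM) => j.
case: (choice.unpickle j) => [i|]; last exact: hborel_K.
by case: (c i); [exact: hborel_hits_oball|apply: (MD _); exact: hborel_hits_oball].
Qed.

(** Applied to the pattern of a flat, this contains the flat when the balls cover the sphere, and
    stays within 2 r of it. As it depends on the pattern only, one fixed set serves all flats of a
    cell. *)
Definition cell_neighborhood (s : seq V) (r : R) (c : {ffun 'I_(size s) -> bool}) : set V :=
  \bigcup_(i in [set i | c i]) oball s`_(nat_of_ord i) r.

Lemma open_cell_neighborhood s r c : open (@cell_neighborhood s r c).
Proof.
apply: bigcup_open => i _; rewrite openE => x xi; apply/nbhs_eballP.
exists (r - enorm (s`_i - x))%R; first by rewrite subr_gt0.
move=> y /= xy; apply: (le_lt_trans (enorm_triangle x _ _)).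
by rewrite -ltrBrDl.
Qed.

Lemma cell_neighborhood_slab s r I w : #|I| = (d - k)%N ->
  cell_neighborhood r (cell_pattern s r (intersection I w)) `<=` slab (nu w) I (r *+ 2).
Proof.
move=> Ik x [i /=]; rewrite ffunE => /asboolP[y [yI yi]] xi j jI.
have yj : dot y (nu w j) = 0%R.
  by move: yI; rewrite intersectionE => /(_ j jI)[].
have := dot_lipschitz (nu w j) x y; rewrite yj subr0 [enorm (nu w j)](nu1 w j) mulr1.
move=> /le_trans; apply; apply: le_trans (enorm_triangle s`_i _ _) _.
by rewrite mulr2n lerD// ?(enormBC x) ltW.
Qed.

Lemma cell_neighborhood_cover s r L : L `<=` sphere R d ->
  (forall y, sphere R d y -> exists2 x, x \in s & (enorm (x - y) < r)%R) ->
  L `<=` cell_neighborhood r (cell_pattern s r L).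
Proof.
move=> Ls cov x Lx; have [y ys yx] := cov x (Ls x Lx).
have yi : (index y s < size s)%N by rewrite index_mem.
exists (Ordinal yi); last by rewrite /oball /= nth_index.
by rewrite /= ffunE; apply/asboolP; exists x; split => //; rewrite /oball /= nth_index.
Qed.

Definition slab_ratio I (m : nat) w : \bar R :=
  normalized_hausdorff k (flats_union (nu w) k) (slab (nu w) I m.+1%:R^-1).

Let indic_ratio_ge0 (A : set Omega) I m w : 0 <= (\1_A w)%:E * slab_ratio I m w.
Proof. by apply: mule_ge0; [rewrite lee_fin|exact: normalized_ge0]. Qed.

Lemma slab_ratio_le1 L I m w : G k L -> 0 < hausdorff_measure k L < +oo ->
  ~ degenerate w -> slab_ratio I m w <= 1.
Proof.
move=> kL /andP[L0 Loo] /contrapT gp; rewrite /slab_ratio /normalized_hausdorff.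
set A := flats_union _ _; set B := slab _ _ _.
have AB : hausdorff_measure k (A `&` B) <= hausdorff_measure k A :> \bar R.
  by apply: hausdorff_sub; exact: subIsetl.
have AE : hausdorff_measure k A = bin%:R%:E * hausdorff_measure k L := hausdorff_flats_union gp kd kL Loo.
have A0 : 0 < hausdorff_measure k A by rewrite AE mule_gt0// lte_fin ltr0n.
have Aoo : hausdorff_measure k A < +oo by rewrite AE lte_mul_pinfty// ?lee_fin.
have Afin : hausdorff_measure k A \is a fin_num by rewrite ge0_fin_numE// ltW.
move: AB A0; rewrite -(fineK Afin); move: (fine _) => a AB; rewrite lte_fin => a0.
by rewrite inver gt_eqF// lee_pdivrMr// mul1e.
Qed.

Lemma bigsetU_bound (X : Type) (s : seq X) (A : X -> set Omega) :
  (forall c, measurable (A c)) ->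
  measurable (\big[setU/set0]_(c <- s) A c) /\
    P (\big[setU/set0]_(c <- s) A c) <= \sum_(c <- s) P (A c).
Proof.
move=> mA; elim: s => [|c s [mU IH]]; first by rewrite !big_nil measure0.
rewrite !big_cons; split; first exact: measurableU.
by apply: le_trans (measureU2 _ _ _) _ => //; exact: leeD2l.
Qed.


Definition patterned C (s : seq V) r c : set (set V) := [set L | C L /\ cell_pattern s r L = c].

Let sum_patterned s r C I w : \sum_(c : {ffun 'I_(size s) -> bool})
  (\1_(hit_event (@patterned C s r c) I) w)%:E = (\1_(hit_event C I) w)%:E :> \bar R.
Proof.
rewrite (bigD1 (cell_pattern s r (intersection I w)))//= big1 ?adde0 => [|c cN].
  rewrite !indicE; congr (_%:R)%:E; congr nat_of_bool.
  by apply/idP/idP => /set_mem[Ik]; [move=> [CI _]|move=> CI]; apply/mem_set.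
by rewrite indicE memNset// => -[_ [_ /esym/eqP]]; exact/negP.
Qed.

(** Each flat in [C] is charged with the share of the skeleton in its slab, which bounds the chance
    that [v] lies close to that flat. *)
Let slab_sum C m w : \bar R := \sum_I (\1_(hit_event C I) w)%:E * slab_ratio I m w.

Lemma slab_sum_cvg L C w : G k L -> 0 < hausdorff_measure k L < +oo -> ~ degenerate w ->
  slab_sum C m w @[m --> \oo] --> (hit_frequency C w)%:E.
Proof.
move=> kL L0 nd.
have -> : (hit_frequency C w)%:E = \sum_I (\1_(hit_event C I) w)%:E * (bin%:R^-1)%:E.
  rewrite /hit_frequency hit_countE mulr_suml -sumEFin; apply: eq_bigr => I _; exact: EFinM.
apply: cvg_nnesum => I _; first exact: nearW.
rewrite indicE; have [/set_mem[Ik _]|_] := boolP (w \in hit_event C I).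
  rewrite mul1e (_ : (fun m => _) = (fun m => slab_ratio I m w)); last by apply/funext => m; rewrite mul1e.
  have h := slab_ratio_cvg kL L0 nd Ik.
  exact: h.
rewrite mul0e (_ : (fun m => _) = (fun=> 0)); last by apply/funext => m; rewrite mul0e.
exact: cvg_cst.
Qed.

Lemma slab_sum_bounded L C m w : G k L -> 0 < hausdorff_measure k L < +oo -> ~ degenerate w ->
  slab_sum C m w <= #|{set 'I_n}|%:R%:E.
Proof.
move=> kL L0 nd; apply: (@le_trans _ _ (\sum_(I : {set 'I_n}) 1)).
  apply: lee_sum => I _; rewrite indicE; case: (_ \in _); last by rewrite mul0e.
  by rewrite mul1e; exact: slab_ratio_le1 kL _ _.
by rewrite sumEFin sumr_const.
Qed.


(** [v] lies in the flat that is the direction of [W], so confining the flat to a cell confines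
    [v]. *)
Lemma weighted_face_intersection v W : weighted_typical_face P k T v W ->
  exists N, [/\ measurable N, P N = 0 & forall w, ~ N w ->
    exists I, [/\ #|I| = (d - k)%N, direction (W w) = intersection I w,
      G k (intersection I w) & intersection I w (v w)]].
Proof.
move=> [_ _ [WK _] [N [mN N0 hN]]]; have [M [mM M0 hM]] := degenerate_negligible.
exists (N `|` M); split; [exact: measurableU|by rewrite null_set_setU|].
move=> w nNM; have [Fw vw] : tess_faces k (T w) (W w) /\ srelint (W w) (v w).
  by apply: contrapT => h; apply: nNM; left; exact: hN.
have gp : general_position (nu w).
  by apply: contrapT => h; apply: nNM; right; exact: hM.
move: Fw; rewrite TE tess_facesE// => -[[I F] /= /face_indexP[Ik IF] WE].
have DW : direction (W w) = intersection I w.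
  by rewrite -WE (direction_face_of kd Ik IF) intersectionE.
exists I; split => //; first by rewrite intersection_flat//; exact: flat_sphere_great.
rewrite -DW; case: vw => vW _; split; first by move=> U; apply.
by case: (WK w) => _ _; apply.
Qed.

(* The conditional law of [v] only gives the probability of [v] lying in a fixed
   set on an event determined by [T].  So [C] is cut into cells of flats at
   distance at most [1/(m+1)] from each other: on the event that some
   [intersection I] lies in a given cell, [v] is confined to a fixed set contained
   in [slab I], whose share of the skeleton tends to [1 / bin] as [m] grows. *)
Lemma weighted_face_direction_le v W C : weighted_typical_face P k T v W ->
  hborel (G k) C -> P [set w | C (direction (W w))] <= kappa C.
Proof.
move=> Wtyp kC; have [N [mN N0 hN]] := weighted_face_intersection Wtyp.
have [vm vc [WK Wm] _] := Wtyp.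
have [L kL] : exists L, G k L.
  have kdV : (k.+1 <= \dim (fullv : {vspace V}))%N by rewrite dim_fullV ltnW.
  have [U _ dU] := exists_subspace kdV.
  by exists ([set` U] `&` sphere R d); exists U.
have L0 := hausdorff_great_pos vc kL.
set E := [set w | C (direction (W w))].
have mE : measurable E.
  rewrite (_ : E = W @^-1` [set F | sphere_compacts F /\ C (direction F)]).
  apply: (Wm [set F | sphere_compacts F /\ C (direction F)]); exact: (direction_measurable kC).
  by apply/seteqP; split => w; [move=> h; split|move=> []].
have Efin : P E \is a fin_num by exact: fin_num_measure.
rewrite -(fineK Efin) -(integral_hit_frequency kC).
apply: (@lower_integral_limit _ _ _ P (slab_sum C) (hit_frequency C) degenerate _ #|{set 'I_n}|%:R).
- by move=> m w; exact: sume_ge0.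
- exact: measurable_hit_frequency.
- move=> w; have /andP[-> h1] := hit_frequency_bounds C w; rewrite (le_trans h1)// ler1n.
  by apply/card_gt0P; exists finset.set0.
- exact: degenerate_negligible.
- move=> w nd; split; first by move=> m; exact: slab_sum_bounded kL L0 nd.
  exact: slab_sum_cvg kL L0 nd.
move=> m; rewrite fineK//.
pose r : R := (m.+1%:R^-1 / 2)%R.
have r0 : (0 < r)%R by rewrite divr_gt0.
have rE : (r *+ 2 = m.+1%:R^-1)%R by rewrite /r -[LHS]mulr_natr divfK.
have [s [_ cov]] := @sphere_finite_cover R d (fun=> r) (fun _ _ => r0).
pose A (c : {ffun 'I_(size s) -> bool}) := \bigcup_(I : {set 'I_n}) hit_event (@patterned C s r c) I.
pose B c := @cell_neighborhood s r c.
have mA c : measurable (A c).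
  apply: fin_bigcup_measurable => // I _; apply: measurable_hit_event; exact: hborel_cell.
have mB c : @measurable _ (borelV R d) (B c) by apply: borel_open; exact: open_cell_neighborhood.
have mvB c : measurable (v @^-1` B c) by rewrite -[X in measurable X]setTI; exact: vm.
(* A union over all [I] forgets the labels of the hyperspheres; [tessellation_determines_flats] then
   shows that [A c] is an event of [T]. *)
have AT c : exists D, A c = T @^-1` D.
  exists [set t | exists2 w, T w = t & A c w].
  apply/seteqP; split => w; first by move=> Aw; exists w.
  move=> [w' TT [I _ [Ik CI]]].
  have CG : @patterned C s r c `<=` G k by move=> M [CM _]; exact: hborel_sub CM.
  have TT' := TT; rewrite !TE in TT'.
  have hI : exists2 I : {set 'I_n}, #|I| = (d - k)%N &
      @patterned C s r c (\bigcap_(i in [set` I]) great_hypersphere (nu w' i)).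
    by exists I => //; rewrite -intersectionE.
  have [J Jk CJ] := tessellation_determines_flats kd n0 CG (nu0 w') (nu0 w) TT' hI.
  by exists J => //; split => //; rewrite intersectionE.
have indic_law_ge0 c w : 0 <= normalized_hausdorff k (skel k (T w)) (B c) * (\1_(A c) w)%:E.
  by rewrite mule_ge0 ?lee_fin.
have PE c : P (A c `&` v @^-1` B c) =
    \int[P]_w (normalized_hausdorff k (skel k (T w)) (B c) * (\1_(A c) w)%:E).
  rewrite (vc _ _ (mA c) (AT c) (mB c)) integral_mkcond; apply: eq_integral => w _.
  by rewrite patchE indicE; case: ifP; rewrite ?mule1 ?mule0.
have [mU PU] := @bigsetU_bound _ (index_enum {ffun 'I_(size s) -> bool}) (fun c => A c `&` v @^-1` B c)
  (fun c => measurableI _ _ (mA c) (mvB c)).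
(* Outside [N], the pattern [c] of the direction of [W] puts the outcome in [A c] and [v] in
   [B c]. *)
apply: (@le_trans _ _ (\sum_c P (A c `&` v @^-1` B c))).
  apply: le_trans PU; rewrite -[leRHS]adde0.
  rewrite -N0; apply: le_trans (measureU2 _ _ _) => //.
  apply: le_measure; rewrite ?inE//; first exact: measurableU.
  move=> w Cw; have [Nw|nN] := pselect (N w); first by right.
  left; have [I [Ik DW _ vI]] := hN w nN.
  have LS : intersection I w `<=` sphere R d by move=> x; rewrite -DW => -[].
  rewrite -bigcup_seq; exists (cell_pattern s r (intersection I w)); first exact: mem_index_enum.
  split; first by exists I => //; split => //; split => //; rewrite -DW.
  exact: cell_neighborhood_cover LS cov _ vI.
rewrite (eq_bigr _ (fun c _ => PE c)).
have PEfin c : \int[P]_w (normalized_hausdorff k (skel k (T w)) (B c) * (\1_(A c) w)%:E) \is a fin_num.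
  by rewrite -PE; apply: fin_num_measure; exact: measurableI.
apply: (le_trans (lower_integral_sum (index_enum _) indic_law_ge0 PEfin)).
apply: (le_lower_integral_ae _ _ degenerate_negligible).
- by move=> w; apply: sume_ge0 => c _; exact: indic_law_ge0.
- by move=> w; exact: sume_ge0.
move=> w nd; apply: (@le_trans _ _ (\sum_c \sum_I
  (\1_(hit_event (@patterned C s r c) I) w)%:E * slab_ratio I m w)).
  (* For any [I] witnessing [A c], the set [B c] lies in the slab of [I]; the term of this [I]
     dominates the left-hand side. *)
  apply: lee_sum => c _; rewrite indicE; have [/set_mem[I _ cI]|_] := boolP (w \in A c); last first.
    by rewrite mule0; exact: sume_ge0.
  rewrite mule1 (bigD1 I)//= indicE mem_set// mul1e; apply: le_trans (leeDl _ _); last first.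
    by exact: sume_ge0.
  rewrite skelE'//; apply: lee_wpmul2r; first by rewrite inve_ge0 hausdorff_ge0.
  apply: hausdorff_sub; apply: setIS; rewrite -rE; case: cI => Ik [_ <-].
  exact: cell_neighborhood_slab.
rewrite exchange_big /=; apply: lee_sum => I _.
rewrite -ge0_sume_distrl ?sum_patterned// => c _; rewrite lee_fin//.
Qed.

Lemma measurable_kappa C : hborel (G k) C -> measurable [set w | C (\bigcap_i S' i w)].
Proof.
move=> kC; have idinj : injective (@id 'I_(d - k)) by [].
have [+ _ _] := subfamily_law hS' hS' idinj (bigcap_great_measurable d0 kd kC).
congr measurable; apply/seteqP; split => w; first by move=> [].
by move=> Cw; split => //; exact: (subfamily_hyperspheres hS').
Qed.

(* The upper bound for [C] and for its complement add up to an equality. *)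
Lemma weighted_face_direction v W C : weighted_typical_face P k T v W ->
  hborel (G k) C -> P [set w | C (direction (W w))] = kappa C.
Proof.
move=> Wtyp kC; apply/eqP; rewrite eq_le (weighted_face_direction_le Wtyp kC) /=.
have [M0 MD MU] := hborel_sigma_algebra (G k); have kD := MD _ kC.
have mE D : hborel (G k) D -> measurable [set w | D (direction (W w))].
  move=> kD'; have [_ _ [WK Wm] _] := Wtyp.
  rewrite (_ : [set w | _] = W @^-1` [set F | sphere_compacts F /\ D (direction F)]).
    apply: (Wm [set F | sphere_compacts F /\ D (direction F)]); exact: (direction_measurable kD').
  by apply/seteqP; split => w; [move=> h; split|move=> []].
have PE : 1 <= P [set w | C (direction (W w))] + P [set w | (G k `\` C) (direction (W w))].
  have [N [mN N0 hN]] := weighted_face_intersection Wtyp.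
  rewrite -(probability_setT P) -[leRHS]adde0 -N0.
  apply: le_trans (leeD (measureU2 _ _ _) (lexx _)) => //; [|exact: mE..].
  apply: le_trans (measureU2 _ _ _) => //; last by apply: measurableU; exact: mE.
  apply: le_measure; rewrite ?inE//; first by do 2?[apply: measurableU => //]; exact: mE.
  move=> w _; have [Nw|/hN[I [_ DW GI _]]] := pselect (N w); first by right.
  by left; rewrite /= DW; have [CI|nC] := pselect (C (intersection I w)); [left|right].
have kE : kappa C + kappa (G k `\` C) <= 1.
  rewrite /kappa -measureU; [|exact: measurable_kappa..|].
    by apply: probability_le1; apply: measurableU; exact: measurable_kappa.
  by rewrite -subset0 => w [Cw [_ nC]].
have h := weighted_face_direction_le Wtyp kD.
have fin (A : set Omega) : measurable A -> P A \is a fin_num by move=> ?; exact: fin_num_measure.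
have fin' (A : set Omega') : measurable A -> P' A \is a fin_num by move=> ?; exact: fin_num_measure.
move: PE kE h; rewrite /kappa -(fineK (fin _ (mE _ kC))) -(fineK (fin _ (mE _ kD))).
rewrite -(fineK (fin' _ (measurable_kappa kC))) -(fineK (fin' _ (measurable_kappa kD))).
rewrite -!EFinD !lee_fin ; lra.
Qed.

End Tessellation.

Theorem theorem4p1 (R : realType) (d k n : nat)
    (hd : (1 <= d)%N) (hk : (k < d)%N) (hn : (d - k <= n)%N)
    (kappa0 : probability (borelV R d) R)
    (hkappa0 : nondegenerate_even kappa0)
    (dO : measure_display) (Omega : measurableType dO)
    (P : probability Omega R)
    (S : 'I_n -> Omega -> set 'rV[R]_d.+1)
    (hS : iid_hyperspheres P kappa0 S)
    (* independent hyperspheres whose intersection has distribution kappa_k *)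
    (dO' : measure_display) (Omega' : measurableType dO')
    (P' : probability Omega' R)
    (S' : 'I_(d - k) -> Omega' -> set 'rV[R]_d.+1)
    (hS' : iid_hyperspheres P' kappa0 S')
    (C : set (set 'rV[R]_d.+1))
    (hC : hborel (great_subspheres R d k) C) :
  let T := fun w => tessellation (fun i => S i w) in
  let kappa_k := P' [set w | C (\bigcap_i S' i w)] in
  (forall Z : Omega -> set 'rV[R]_d.+1,
     typical_face P k T Z ->
     P [set w | C (direction (Z w))] = kappa_k) /\
  (forall (v : Omega -> borelV R d) (W : Omega -> set 'rV[R]_d.+1),
     weighted_typical_face P k T v W ->
     P [set w | C (direction (W w))] = kappa_k).
Proof.
split=> [Z Ztyp|v W Wtyp].
  exact: (typical_face_direction hk hn hkappa0 hS hS' Ztyp hC).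
exact: (weighted_face_direction hk hn hkappa0 hS hS' Wtyp hC).
Qed.
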